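(* Let $A$ be an almost locally simple artinian algebra over its center $F$, where $F$ contains at least four elements, let $G$ be a non-abelian subnormal subgroup of $A^\times$, and let $\star$ be an involution of the first kind on $A$. Then the following conditions are all equivalent: (C1) $x^\star x=xx^\star$ for all $x\in A$; (C2) for each $x\in A$ there exists a positive integer $N$ depending on $x$ such that $\mathrm{d}_x^N(x^\star)=0$; (C3) for each $x\in A$ there exists a positive integer $N$ depending on $x$ such that $x^\star x^N=x^Nx^\star$; (C4) $x+x^\star$ is central for all $x\in A$; (C5) $xx^\star$ is central for all $x\in A$; (1) $x+x^\star$ is central for all $x\in G$; (2) $xx^\star$ is central for all $x\in G$. Moreover, if one of these assertions holds, then either (i) $A$ is a quaternion division algebra over its center $F$, and $\star$ is the symplectic involution, or (ii) $A\cong \mathrm{M}_2(F)$ and $\star$ is the ordinary symplectic involution on $A$.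
   Context: Rings are associative with identity $1\neq 0$, and subrings and subalgebras contain the identity. An algebra $A$ over a field $K$ is almost locally simple artinian if every finitely generated $K$-subalgebra of $A$ is contained in a subring of $A$ that is a simple artinian algebra over some field. An involution on a ring $A$ is a map $\star:A\to A$ with $(x+y)^\star=x^\star+y^\star$, $(xy)^\star=y^\star x^\star$ and $(x^\star)^\star=x$ for all $x,y\in A$. It is of the first kind if $z^\star=z$ for every $z$ in the center $Z(A)$. An element of $A$ is central if it lies in $Z(A)$. An involution is symplectic if $x+x^\star\in Z(A)$ for all $x\in A$. For $x\in A$, $\mathrm{d}_x:A\to A$ is the map $y\mapsto yx-xy$, and $\mathrm{d}_x^N$ is its $N$-th power under composition. $A^\times$ is the multiplicative group of $A$. A quaternion division algebra over $F$ is a division ring with center $F$ and of dimension $4$ over $F$. The ordinary symplectic involution on $\mathrm{M}_2(F)$ is $\begin{pmatrix} a & b\\ c& d\end{pmatrix}^\star=\begin{pmatrix} d & -b\\ -c& a\end{pmatrix}$; in (ii) $\star$ is regarded as an involution on $\mathrm{M}_2(F)$ via the isomorphism. *)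

(* Defs.v *)
From HB Require Import structures.
From mathcomp Require Import all_boot all_order all_algebra.

Set Implicit Arguments.
Unset Strict Implicit.
Unset Printing Implicit Defensive.

Import GRing.Theory.
Local Open Scope ring_scope.

(* Subsets of possibly infinite rings are given by boolean predicates
   {pred R}; classically these are all the subsets of R. *)

Section Artinian.
Variable R : nzRingType.

Definition left_ideal (I : {pred R}) :=
  zmod_closed I /\ (forall a x, x \in I -> a * x \in I).

Definition right_ideal (I : {pred R}) :=
  zmod_closed I /\ (forall a x, x \in I -> x * a \in I).

Definition dcc (ideal : {pred R} -> Prop) :=
  forall I : nat -> {pred R},
    (forall n, ideal (I n)) ->
    (forall n, {subset I n.+1 <= I n}) ->
    exists n, forall m, (n <= m)%N -> I m =i I n.

Definition artinian := dcc left_ideal /\ dcc right_ideal.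

(* R is nonzero because it is an nzRingType. *)
Definition simple_ring :=
  forall I : {pred R}, left_ideal I -> right_ideal I ->
    I =i pred1 0 \/ I =i predT.

End Artinian.

Section LocallyArtinian.
Variables (K : fieldType) (A : algType K).

Definition subalg_generated (s : seq A) (S : {pred A}) :=
  [/\ subalg_closed S, {subset s <= S} &
      forall T : {pred A},
        subalg_closed T -> {subset s <= T} -> {subset S <= T}].

(* The subring of A is the image of the embedding iota. The field L over which
   it is an algebra is unrelated to K. *)
Definition almost_locally_simple_artinian :=
  forall (s : seq A) (S : {pred A}), subalg_generated s S ->
    exists (L : fieldType) (B : algType L) (iota : {rmorphism B -> A}),
      [/\ injective iota, simple_ring B, artinian B &
          forall x, x \in S -> exists b, iota b = x].

End LocallyArtinian.

Section Rings.
Variable R : nzRingType.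

Definition central (x : R) := forall y, GRing.comm x y.

Definition involution (star : R -> R) :=
  [/\ forall x y, star (x + y) = star x + star y,
      forall x y, star (x * y) = star y * star x
    & forall x, star (star x) = x].

Definition first_kind (star : R -> R) := forall z, central z -> star z = z.

Definition symplectic (star : R -> R) := forall x, central (x + star x).

Definition inner_der (x y : R) := y * x - x * y.

End Rings.

Section UnitGroup.
Variable R : unitRingType.

Definition normal_subgroup (N H : {pred R}) :=
  [/\ {subset N <= H}, divr_closed N &
      {in N & H, forall x y, y^-1 * x * y \in N}].

Definition subnormal_in_units (G : {pred R}) :=
  exists (n : nat) (H : nat -> {pred R}),
    [/\ H 0%N =i GRing.unit, H n =i G &
        forall i, (i < n)%N -> normal_subgroup (H i.+1) (H i)].

Definition abelian_set (G : {pred R}) := {in G &, forall x y, GRing.comm x y}.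

End UnitGroup.

Definition has_center (F : fieldType) (A : algType F) :=
  forall z : A, central z <-> exists a : F, z = a%:A.

Definition quaternion_division_algebra (F : fieldType) (A : unitAlgType F) :=
  [/\ has_center A, GRing.field_axiom A &
      exists e : 'I_4 -> A,
        forall x, exists! c : 'rV[F]_4, x = \sum_i c 0 i *: e i].

Definition ordinary_symplectic (F : fieldType) (M : 'M[F]_2) : 'M[F]_2 :=
  \matrix_(i, j)
    (nth [::] [:: [::   M 1 1; - M 0 1];
                  [:: - M 1 0;   M 0 0] ] i)`_j.

(* Main.v *)
From Stdlib Require Import Ncring Ncring_tac.
From HB Require Import structures.
From mathcomp Require Import all_boot all_order all_algebra all_fingroup all_solvable all_field.
From mathcomp Require Import boolp ring zify.
Require Import Defs.

Set Implicit Arguments.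
Unset Strict Implicit.
Unset Printing Implicit Defensive.

Import GRing.Theory.
Local Open Scope ring_scope.

(** Write st for the involution. If t = x + st x is central, then x commutes with st x and
    x st x = t x - x^2; linearising the trace of x y shows that t x - x^2 is central as well
    ([symplectic_norm_central]). So the central trace condition C4 implies all the others,
    and C5 gives it back through (1 + x) st (1 + x). What has to be proved is that C1,
    C2, C3 and the condition P2 on G each imply C4, and that P1 implies P2.

    If A is not a division ring, a nonzero nonunit lies in a simple artinian subring, where
    Brauer's lemma yields idempotents e different from 0 and 1. Each of C1, C2, C3
    makes e commute with st e, and so does the centrality of x st x for the units
    x = e + l with l in F. Then no nontrivial idempotent is symmetric, hence st e = 1 - e,
    hence two nonzero orthogonal idempotents always add up to 1: the corner e A e is a field,
    A is the ring of 2 x 2 matrices over it, and st is the ordinary symplectic involution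
    ([split_symplectic], [split_structure]).

    Let A be a division ring. That C1 implies C4 is a linearisation argument
    ([normal_symplectic]). For C2 let d be the inner derivation of x. In characteristic 0,
    d is nilpotent on st x and on its inverse, and the top term of Leibniz's rule for their
    product gives d (st x) = 0. In characteristic p, a p-power of every element commutes with
    its image. If x does not commute with st x, some t with t x - x t = 1 commutes with
    everything that commutes with x and st x, and the hypothesis on (t + g) x, for sufficiently
    many symmetric g commuting with x, t and st x, makes a polynomial in g vanish whose leading
    coefficient is a nonzero commutator ([frobenius_normal]). For C3 expand (1 + a z)^n: its
    commutator with st z is a multiple of a term with [z, st z] alone, plus a times terms of the
    bimodule which [z, st z] generates. If z is integral over a domain that contains a, this
    bimodule is finitely generated, and Nakayama's lemma in the form of the determinant trick
    gives [z, st z] = 0 ([power_nakayama]). In characteristic 0 one takes a = 3. In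
    characteristic p one takes for a a symmetric element of infinite order commuting with x and
    st x; the conclusion is then about a p-power of z, and [frobenius_normal] applies to the
    centralizer of a. Such an a exists as soon as some x of infinite order does not commute with
    st x; if all such x had finite order, so would all nonzero elements that commute with
    one of them, and Wedderburn's theorem would exclude this ([nonnormal_nontorsion]).

    The condition P2 is first carried from G up the subnormal chain to the group of all units
    ([norm_central_step]). This step and that from P1 to P2 ([trace_norm_central]) produce a
    unit w such that w g w^-1 g^-1 is central for all g in a noncentral subnormal subgroup N, and
    use that w must then be central
    ([subnormal_weights_central]). In a division ring this goes by induction on the depth of N,
    starting from the theorem of Cartan, Brauer and Hua and from the fact that abelian subnormal
    subgroups are central ([abelian_subnormal_central]). In the other case N contains the
    transvections of every local simple artinian subring that meets it in a noncentral element.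

    Finally, a noncommutative division ring with C4 has dimension 4: if p and q do not
    commute, four functionals built from the trace form and c = p q - q p are triangular on
    1, p, q, p q and have no common zero ([quaternion_basisP]). *)

(** * Noncommutative ring identities *)

Section NcRing.
Variable R : nzRingType.
(** The reflexive noncommutative ring normaliser works over a type class of rings;
    this instance makes it decide identities between ring expressions over any
    nonzero ring. *)
#[export] Instance nc_ops :
  @Ring_ops R 0 1 +%R *%R (fun x y => x - y) (@GRing.opp R) eq := {}.
#[export] Instance nc_ring :
  @Ring R 0 1 +%R *%R (fun x y => x - y) (@GRing.opp R) eq nc_ops.
Proof.
constructor; try typeclasses eauto;
  rewrite /addition /multiplication /zero /one /opposite /subtraction /equality /=.
- exact: add0r.
- exact: addrC.
- exact: addrA.
- exact: mul1r.
- exact: mulr1.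
- exact: mulrA.
- exact: mulrDl.
- by move=> x y z; exact: mulrDr.
- by [].
- exact: subrr.
Qed.
End NcRing.
Ltac ncring := non_commutative_ring.

(** * Subnormal subgroups of the group of units *)

Section UnitSubgroups.
Variable R : unitRingType.
Implicit Types (x y z : R) (S N H P Q : R -> Prop).

Record unit_subgroup N : Prop := UnitSubgroup {
  usg1 : N 1;
  usgM : forall x y, N x -> N y -> N (x * y);
  usgV : forall x, N x -> N x^-1;
  usgU : forall x, N x -> x \is a GRing.unit }.

Definition normal_in N H :=
  [/\ unit_subgroup N, forall x, N x -> H x &
      forall x y, N x -> H y -> N (y^-1 * x * y)].

(** The depth is part of the notion because the main results go by induction on it,
    and the top group Q is a parameter because it changes along the way:
    centralizers of elements are division subrings with their own groups of nonzero
    elements. *)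
Inductive subnormal_in Q : nat -> (R -> Prop) -> Prop :=
  | Subnormal0 N : (forall x, N x <-> Q x) -> subnormal_in Q 0 N
  | SubnormalS n H N :
      subnormal_in Q n H -> normal_in N H -> subnormal_in Q n.+1 N.

Lemma subnormalE Q n N : subnormal_in Q n N ->
  if n is m.+1 then exists2 H, subnormal_in Q m H & normal_in N H
  else forall x, N x <-> Q x.
Proof. by case=> {n N} // n H N sH nN; exists H. Qed.

Definition meet_pred N H x := N x /\ H x.
Definition conj_pred y N x := N (y * x * y^-1).

Lemma conj_pred_comm c x y : y \is a GRing.unit ->
  GRing.comm (y * c * y^-1) x -> GRing.comm c (y^-1 * x * y).
Proof.
move=> uy h; have {h}: y^-1 * (y * c * y^-1 * x) * y =
  y^-1 * (x * (y * c * y^-1)) * y by rewrite h.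
by rewrite !mulrA mulVr // mul1r mulrVK // /GRing.comm !mulrA.
Qed.

Lemma normal_inV N H x y : unit_subgroup H -> normal_in N H ->
  N x -> H y -> N (y * x * y^-1).
Proof.
move=> gH [_ _ nN] Nx Hy; rewrite -{1}[y]invrK.
exact: (nN x y^-1 Nx (usgV gH Hy)).
Qed.

Lemma subnormal_usg Q n N : unit_subgroup Q -> subnormal_in Q n N ->
  unit_subgroup N.
Proof.
move=> gQ; case=> {n N} [N eqN|n H N _ []//].
by split=> [|x y /eqN + /eqN|x /eqN|x /eqN]; rewrite ?eqN;
  [exact: usg1|exact: usgM|exact: usgV|exact: usgU].
Qed.

Lemma subnormal_sub Q n N x : subnormal_in Q n N -> N x -> Q x.
Proof. by move=> sN; elim: sN x => {n N} [N eN x /eN|n H N _ IH [_ s _] x /s/IH]. Qed.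

Lemma normal_refl N : unit_subgroup N -> normal_in N N.
Proof. by move=> gN; split=> // x y Nx Ny; do ?apply: (usgM gN) => //; apply: usgV. Qed.

Lemma subnormal_pad Q n N : unit_subgroup Q -> subnormal_in Q n N ->
  subnormal_in Q n.+1 N.
Proof.
by move=> gQ sN; apply: SubnormalS (sN) (normal_refl (subnormal_usg gQ sN)).
Qed.

Lemma subnormal_leq Q m n N : unit_subgroup Q -> (m <= n)%N ->
  subnormal_in Q m N -> subnormal_in Q n N.
Proof.
move=> gQ /subnKC <-; elim: (n - m)%N => [|k IH] sN; rewrite ?addn0 // addnS.
exact/subnormal_pad/IH.
Qed.

Lemma meet_usg N H : unit_subgroup N -> unit_subgroup H ->
  unit_subgroup (meet_pred N H).
Proof.
move=> gN gH; split=> [|x y [? ?] [? ?]|x [? ?]|x [? _]].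
- by split; exact: usg1.
- by split; exact: usgM.
- by split; exact: usgV.
- exact: (usgU gN).
Qed.

Lemma normal_meet N N' H H' : normal_in N H -> normal_in N' H' ->
  normal_in (meet_pred N N') (meet_pred H H').
Proof.
move=> [gN sN nN] [gN' sN' nN']; split; first exact: meet_usg.
- by move=> x [/sN ? /sN' ?].
- by move=> x y [? ?] [? ?]; split; [exact: nN|exact: nN'].
Qed.

Lemma subnormal_meet Q n N H : subnormal_in Q n N -> subnormal_in Q n H ->
  subnormal_in Q n (meet_pred N H).
Proof.
move=> sN; elim: sN H => {n N} [N eN|n P N sP IH nN] H /subnormalE.
  by move=> eH; constructor=> x; split=> [[/eN]//|Qx]; split; [apply/eN|apply/eH].
by case=> P' sP' nH; apply: SubnormalS (IH _ sP') _; apply: normal_meet.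
Qed.

Lemma subnormal_restrict Q Q' n N : unit_subgroup Q' ->
  (forall x, Q' x -> Q x) -> subnormal_in Q n N ->
  subnormal_in Q' n (meet_pred N Q').
Proof.
move=> gQ' sQ; elim=> {n N} [N eN|n H N sH IH nN].
  by constructor=> x; split=> [[]//|q]; split=> //; apply/eN/sQ.
by apply: SubnormalS IH _; apply: normal_meet => //; apply: normal_refl.
Qed.

(** Chains are built from the top down, so that splitting off the last subgroup is
    case analysis, while splitting off the first one takes an induction. *)
Lemma subnormal_top Q n N : unit_subgroup Q -> subnormal_in Q n.+1 N ->
  exists2 Q1, normal_in Q1 Q & subnormal_in Q1 n N.
Proof.
move=> gQ; elim: n N => [|n IH] N /subnormalE[H sH nN].
  exists N; last by constructor.
  have eH := subnormalE sH; case: nN => gN sNH nN.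
  by split=> // [x /sNH /eH//|x y Nx /eH]; exact: nN.
by have [Q1 nQ1 sH1] := IH _ sH; exists Q1 => //; apply: SubnormalS sH1 nN.
Qed.

Lemma unitr_conj x y : y \is a GRing.unit ->
  (y * x * y^-1 \is a GRing.unit) = (x \is a GRing.unit).
Proof. by move=> uy; rewrite unitrMl ?unitrV // unitrMr. Qed.

Lemma invr_conj x y : y \is a GRing.unit ->
  (y * x * y^-1)^-1 = y * x^-1 * y^-1.
Proof.
move=> uy; have [ux|nux] := boolP (x \is a GRing.unit).
  by rewrite !invrM ?unitrV ?unitrMl // invrK mulrA.
by rewrite [x^-1]invr_out // invr_out // unitr_conj.
Qed.

Lemma mulr_conj x z y : y \is a GRing.unit ->
  (y * x * y^-1) * (y * z * y^-1) = y * (x * z) * y^-1.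
Proof. by move=> uy; rewrite !mulrA mulrVK. Qed.

Lemma comm_conj x z y : y \is a GRing.unit ->
  GRing.comm (y * x * y^-1) (y * z * y^-1) -> GRing.comm x z.
Proof.
move=> uy; rewrite /GRing.comm !mulr_conj // => h; apply: (mulrI uy).
by apply: (@mulIr _ y^-1); rewrite ?unitrV.
Qed.

Lemma conj_usg y N : y \is a GRing.unit -> unit_subgroup N ->
  unit_subgroup (conj_pred y N).
Proof.
move=> uy gN; split; rewrite /conj_pred.
- by rewrite mulr1 divrr //; apply: usg1.
- by move=> x z Nx Nz; rewrite -mulr_conj //; apply: usgM.
- by move=> x Nx; rewrite -invr_conj //; apply: usgV.
- by move=> x /(usgU gN); rewrite unitr_conj.
Qed.

Lemma normal_conj y N H : y \is a GRing.unit -> normal_in N H ->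
  normal_in (conj_pred y N) (conj_pred y H).
Proof.
move=> uy [gN sN nN]; split; first exact: conj_usg.
- by move=> x; apply: sN.
- move=> x z Nx Hz; rewrite /conj_pred -!mulr_conj // -invr_conj //.
  exact: nN.
Qed.

Lemma subnormal_conj Q y n N : unit_subgroup Q -> Q y ->
  subnormal_in Q n N -> subnormal_in Q n (conj_pred y N).
Proof.
move=> gQ Qy; elim=> {n N} [N eN|n H N sH IH nN]; last first.
  by apply: SubnormalS IH _; apply: normal_conj nN; apply: (usgU gQ).
constructor=> x; rewrite /conj_pred eN; split=> [q|Qx]; last first.
  by do ![apply: (usgM gQ) => //]; apply: usgV.
have uy := usgU gQ Qy.
have -> : x = y^-1 * (y * x * y^-1) * y by rewrite !mulrA mulVr // mul1r mulrVK.
by do ![apply: (usgM gQ) => //]; apply: usgV.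
Qed.

(** The intersection of all subgroups containing S, which avoids words. *)
Definition generated_by S x :=
  forall N, unit_subgroup N -> (forall s, S s -> N s) -> N x.

Lemma generated_usg S : (forall s, S s -> s \is a GRing.unit) ->
  unit_subgroup (generated_by S).
Proof.
move=> uS; split=> [N gN _|x y gx gy N gN sN|x gx N gN sN|x gx].
- exact: usg1.
- by apply: usgM => //; [apply: gx|apply: gy].
- by apply: usgV => //; apply: gx.
- apply: (gx (fun x => x \is a GRing.unit)) => //; split=> //.
  + exact: unitr1.
  + by move=> a b ua ub; rewrite unitrMl.
  + by move=> a; rewrite unitrV.
Qed.

Lemma generated_mem S s : S s -> generated_by S s.
Proof. by move=> Ss N _; apply. Qed.

Lemma comm_usg c : unit_subgroup (fun x => x \is a GRing.unit /\ GRing.comm c x).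
Proof.
split=> [|x y [ux cx] [uy cy]|x [ux cx]|x []//].
- by split; [exact: unitr1|exact: commr1].
- by rewrite unitrMl //; split=> //; apply: commrM.
- by rewrite unitrV; split=> //; apply: commrV.
Qed.

Lemma generated_comm S c x : (forall s, S s -> s \is a GRing.unit) ->
  (forall s, S s -> GRing.comm c s) -> generated_by S x -> GRing.comm c x.
Proof.
move=> uS cS gx; have [|_ //] := gx _ (comm_usg c).
by move=> s Ss; split; [exact: uS|exact: cS].
Qed.

Lemma generated_normal S H : unit_subgroup H -> (forall s, S s -> H s) ->
  (forall s h, S s -> H h -> S (h^-1 * s * h)) ->
  normal_in (generated_by S) H.
Proof.
move=> gH sS nS; have gS: unit_subgroup (generated_by S).
  by apply: generated_usg => s /sS; apply: usgU.
split=> // [x gx|x y gx Hy]; first exact: gx.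
have uy := usgU gH Hy.
suff: conj_pred y^-1 (generated_by S) x by rewrite /conj_pred invrK.
apply: gx; first by apply: conj_usg; rewrite ?unitrV.
by move=> s Ss; rewrite /conj_pred invrK; apply: generated_mem; apply: nS.
Qed.

End UnitSubgroups.

(** * Division subrings and the Cartan-Brauer-Hua argument *)

Section DivisionSubrings.
Variable D : unitRingType.
Hypothesis hD : GRing.field_axiom D.
Implicit Types (x y z c w : D) (E N H P Q X Y : D -> Prop).

Lemma div_unitE x : (x \is a GRing.unit) = (x != 0).
Proof. by apply/idP/idP => [|/hD//]; apply: contraTneq => ->; rewrite unitr0. Qed.

Lemma div_mulf_eq0 x y : x * y = 0 -> x = 0 \/ y = 0.
Proof.
move=> h; have [->|x0] := eqVneq x 0; [by left|right].
by rewrite -[y](mulKr (hD x0)) h mulr0.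
Qed.

Lemma div_mulf_neq0 x y : x != 0 -> y != 0 -> x * y != 0.
Proof. by move=> x0 y0; apply/eqP => /div_mulf_eq0[]; apply/eqP. Qed.

Record division_subring E : Prop := DivisionSubring {
  dsr1 : E 1;
  dsrB : forall x y, E x -> E y -> E (x - y);
  dsrM : forall x y, E x -> E y -> E (x * y);
  dsrV : forall x, E x -> E x^-1 }.

Definition nonzero_of E x := E x /\ x != 0.
Definition centralizer_in E c x := E x /\ GRing.comm c x.
Definition central_in E x := forall y, E y -> GRing.comm x y.
Definition noncentral E N := exists2 x, N x & ~ central_in E x.

Lemma dsr0 E : division_subring E -> E 0.
Proof. by move=> dE; rewrite -(subrr 1); apply: dsrB => //; apply: dsr1. Qed.

Lemma dsrN E x : division_subring E -> E x -> E (- x).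
Proof. by move=> dE Ex; rewrite -sub0r; apply: dsrB => //; apply: dsr0. Qed.

Lemma dsrD E x y : division_subring E -> E x -> E y -> E (x + y).
Proof. by move=> dE Ex Ey; rewrite -[y]opprK; apply: dsrB => //; apply: dsrN. Qed.

Lemma nonzero_usg E : division_subring E -> unit_subgroup (nonzero_of E).
Proof.
move=> dE; split=> [|x y [Ex x0] [Ey y0]|x [Ex x0]|x [_ /hD]//].
- by split; [exact: dsr1|exact: oner_neq0].
- by split; [exact: dsrM|exact: div_mulf_neq0].
- by split; [exact: dsrV|rewrite invr_eq0].
Qed.

Lemma centralizer_dsr E c : division_subring E ->
  division_subring (centralizer_in E c).
Proof.
move=> dE; split=> [|x y [Ex cx] [Ey cy]|x y [Ex cx] [Ey cy]|x [Ex cx]].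
- by split; [exact: dsr1|exact: commr1].
- by split; [exact: dsrB|exact: commrB].
- by split; [exact: dsrM|exact: commrM].
- by split; [exact: dsrV|exact: commrV].
Qed.

Lemma central_dec E x : ~ central_in E x -> exists2 y, E y & ~ GRing.comm x y.
Proof. by move/existsNP => [y /not_implyP[]]; exists y. Qed.

Lemma noncentralPn E N : ~ noncentral E N -> forall x, N x -> central_in E x.
Proof. by move=> h x Nx; apply: contrapT => nx; apply: h; exists x. Qed.

(** The trick of Cartan, Brauer and Hua. Subtracting y q = r y from (1 + y) q = r'
    (1 + y) leaves (r - r') y = r' - q. If r and r' differ, this writes y as a
    quotient of elements commuting with c; otherwise r' = q. *)
Lemma additive_step c q r r' y : GRing.comm c q -> GRing.comm c r ->
  GRing.comm c r' -> y * q = r * y -> (1 + y) * q = r' * (1 + y) ->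
  GRing.comm c y \/ GRing.comm q y.
Proof.
move=> cq cr cr' e1 e2.
have e3: (r - r') * y = r' - q.
  apply/eqP; rewrite -subr_eq0; apply/eqP.
  transitivity ((1 + y) * q - r' * (1 + y) - (y * q - r * y)); first by ncring.
  by rewrite e1 e2 !subrr.
have [err|nrr] := eqVneq r r'.
  right; move: e3; rewrite err subrr mul0r => /esym/eqP; rewrite subr_eq0.
  by move/eqP=> e4; rewrite /GRing.comm e1 err e4.
left; have u: r - r' \is a GRing.unit by rewrite div_unitE subr_eq0.
rewrite -[y](mulKr u) e3; apply: commrM; last exact: commrB.
by apply: commrV; apply: commrB.
Qed.

Lemma additive_normal E N c q y : division_subring E ->
  normal_in N (nonzero_of E) -> (forall x, N x -> GRing.comm c x) ->
  N q -> E y -> GRing.comm c y \/ GRing.comm q y.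
Proof.
move=> dE nN cN Nq Ey.
have [->|y0] := eqVneq y 0; first by left; exact: commr0.
have [e|y1] := eqVneq (1 + y) 0.
  left; have -> : y = -1 by apply/eqP; rewrite -addr_eq0 addrC e.
  exact/commrN/commr1.
have gE := nonzero_usg dE.
have conjE z : z != 0 -> E z -> z * q = (z * q * z^-1) * z /\
    GRing.comm c (z * q * z^-1).
  move=> z0 Ez; rewrite mulrVK ?hD //; split=> //.
  by apply: cN; apply: normal_inV nN _ _.
have [e1 c1] := conjE _ y0 Ey.
have [e2 c2] := conjE _ y1 (dsrD dE (dsr1 dE) Ey).
exact: additive_step (cN _ Nq) c1 c2 e1 e2.
Qed.

Lemma normal_ext N H H' : (forall x, H x <-> H' x) -> normal_in N H ->
  normal_in N H'.
Proof.
by move=> eH [gN sN nN]; split=> // [x /sN/eH|x y Nx /eH]; last exact: nN.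
Qed.

(** No group is the union of two proper subgroups; here they are the additive
    centralizers of c and a in E. *)
Lemma commute_union E a c : division_subring E ->
  (forall y, E y -> GRing.comm c y \/ GRing.comm a y) ->
  ~ central_in E a -> forall y, E y -> GRing.comm c y.
Proof.
move=> dE h /central_dec[z Ez nz] y Ey; apply: contrapT => ny.
have cz: GRing.comm c z by have [] := h _ Ez.
have cy: GRing.comm a y by have [] := h _ Ey.
case: (h (y + z)) => [|cyz|cyz]; first exact: dsrD.
- by apply: ny; rewrite -(addrK z y); apply: commrB.
- by apply: nz; rewrite -(addKr y z); apply: commrD => //; apply: commrN.
Qed.

(** For a normal subgroup all conjugates of q are available in [additive_step],
    which makes E a union of two centralizers. *)
Lemma centralizer_normal E N c : division_subring E ->
  normal_in N (nonzero_of E) -> noncentral E N ->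
  (forall x, N x -> GRing.comm c x) -> forall y, E y -> GRing.comm c y.
Proof.
move=> dE nN [a Na na] cN; apply: (commute_union dE) na => y Ey.
exact: additive_normal nN cN Na Ey.
Qed.

End DivisionSubrings.

(** * Elements of finite order in positive characteristic *)

Section FiniteDivisionSubring.
Variables (D : unitRingType) (s : seq D).
Hypothesis hD : GRing.field_axiom D.
Hypothesis closed_s : divring_closed [in s].

Let T := seq_sub s.
HB.instance Definition _ := Finite.on T.
HB.instance Definition _ := SubType.on T.
HB.instance Definition _ :=
  GRing.SubChoice_isSubUnitRing.Build D [in s] T closed_s.

(** Wedderburn's little theorem, carried over to the type of the elements of a list.
    *)
Lemma finite_dsr_comm x y : x \in s -> y \in s -> x * y = y * x.
Proof.
move=> xs ys.
have domT : GRing.integral_domain_axiom T.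
  move=> a b ab0; have : val a * val b = 0 by rewrite -[LHS](rmorphM (val : T -> D)) ab0 rmorph0.
  case/(div_mulf_eq0 hD) => e; apply/orP; [left|right]; apply/eqP/val_inj;
    by rewrite rmorph0.
have := finDomain_mulrC domT (SeqSub xs) (SeqSub ys).
by move/(congr1 (val : T -> D)); rewrite !rmorphM.
Qed.
End FiniteDivisionSubring.

Section Torsion.
Variable D : unitRingType.
Hypothesis hD : GRing.field_axiom D.
Implicit Types (x y z : D).

Definition torsion x := exists2 n, (0 < n)%N & x ^+ n = 1.

Lemma torsion_neq0 x : torsion x -> x != 0.
Proof.
case=> n n0; apply: contra_eq_neq => ->; rewrite expr0n eqn0Ngt n0 /=.
by rewrite eq_sym oner_neq0.
Qed.

Lemma torsion_root x n : (0 < n)%N -> torsion (x ^+ n) -> torsion x.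
Proof. by move=> n0 [m m0]; rewrite -exprM; exists (n * m)%N; rewrite ?muln_gt0 ?n0. Qed.

Lemma torsionM x y : GRing.comm x y -> torsion x -> torsion y -> torsion (x * y).
Proof.
move=> cxy [m m0 em] [n n0 en]; exists (m * n)%N; first by rewrite muln_gt0 m0.
by rewrite exprMn_comm // exprM em expr1n mul1r mulnC exprM en expr1n.
Qed.

Lemma torsionV x : torsion x -> torsion x^-1.
Proof. by case=> n n0 e; exists n; rewrite // exprVn e invr1. Qed.

(** Pigeonhole on the powers of x. *)
Lemma torsion_powers (s : seq D) x : x != 0 -> (forall n, x ^+ n \in s) -> torsion x.
Proof.
move=> x0 hs; pose t := [seq x ^+ i | i <- iota 0 (size s).+1].
have : ~~ uniq t.
  apply/negP => ut; have : (size t <= size s)%N.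
    by apply: uniq_leq_size ut _ => _ /mapP[i _ ->].
  by rewrite size_map size_iota ltnn.
case/(uniqPn 0) => i [j [lij]]; rewrite size_map size_iota => lj.
rewrite !(nth_map 0%N) ?size_iota ?(ltn_trans lij) // !nth_iota ?(ltn_trans lij) //.
rewrite !add0n => e; exists (j - i)%N; first by rewrite subn_gt0.
have uxi: x ^+ i \is a GRing.unit by rewrite unitrX // hD.
by rewrite -[LHS](mulKr uxi) -exprD subnKC ?(ltnW lij) // -e mulVr.
Qed.

Lemma finite_subring_divring_closed (s : seq D) : 1 \in s ->
  (forall x y, x \in s -> y \in s -> x - y \in s) ->
  (forall x y, x \in s -> y \in s -> x * y \in s) -> divring_closed [in s].
Proof.
move=> s1 sB sM; split=> // x y xs ys.
have [y0|y0] := eqVneq y 0; first by rewrite y0 invr0 mulr0 -(subrr 1); apply: sB.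
have sX n : y ^+ n \in s by elim: n => [|n IH]; rewrite ?expr0 // exprS; apply: sM.
have [[|n] // _ en] := torsion_powers y0 sX; apply: (sM _ _ xs).
suff -> : y^-1 = y ^+ n by [].
by rewrite -[RHS](mulKr (hD y0)) -exprS en mulr1.
Qed.

Section Span.
Variables (p : nat) (G : seq D).
Hypothesis pD : p \in [pchar D].
Hypothesis G1 : 1 \in G.
Hypothesis GM : forall x y, x \in G -> y \in G -> x * y \in G.

(** Coefficients below p exhaust the multiples, since p = 0; so the span of G over
    the prime field is again a finite list. *)
Definition span_seq : seq D :=
  [seq \sum_(i < size G) G`_i *+ f i | f : {ffun 'I_(size G) -> 'I_p}].

Lemma span_seqP x :
  reflect (exists f : 'I_(size G) -> nat, x = \sum_(i < size G) G`_i *+ f i) (x \in span_seq).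
Proof.
apply: (iffP mapP) => [[f _ ->]|[f ->]]; first by exists (fun i => nat_of_ord (f i)).
have p0 : (0 < p)%N by apply/prime_gt0/(pcharf_prime pD).
exists [ffun i : 'I_(size G) => Ordinal (ltn_pmod (f i) p0)]; first by rewrite mem_enum.
apply: eq_bigr => i _; rewrite ffunE /= {1}(divn_eq (f i) p) mulrnDr.
by rewrite mulrnA mulrn_pchar // add0r.
Qed.

Lemma span_seqD x y : x \in span_seq -> y \in span_seq -> x + y \in span_seq.
Proof.
move=> /span_seqP[f ->] /span_seqP[g ->]; apply/span_seqP.
exists (fun i : 'I_(size G) => (f i + g i)%N); rewrite -big_split /=.
by apply: eq_bigr => i _; rewrite mulrnDr.
Qed.

Lemma span_seq0 : 0 \in span_seq.
Proof. by apply/span_seqP; exists (fun=> 0%N); rewrite big1. Qed.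

Lemma span_seqMn x n : x \in span_seq -> x *+ n \in span_seq.
Proof.
move=> xs; elim: n => [|n IH]; first exact: span_seq0.
by rewrite mulrS; apply: span_seqD.
Qed.

Lemma mem_span_seq x : x \in G -> x \in span_seq.
Proof.
move=> Gx; apply/span_seqP; have lx : (index x G < size G)%N by rewrite index_mem.
exists (fun i : 'I_(size G) => nat_of_bool (i == Ordinal lx)); rewrite (bigD1 (Ordinal lx)) //= big1.
  by rewrite nth_index // eqxx addr0.
by move=> i /negPf ->.
Qed.

Lemma span_seq_sum (I : eqType) (r : seq I) (F : I -> D) :
  (forall i, i \in r -> F i \in span_seq) -> \sum_(i <- r) F i \in span_seq.
Proof.
move=> h; rewrite big_seq; elim/big_ind: _ => //; [exact: span_seq0|exact: span_seqD].
Qed.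

Lemma span_seqM x y : x \in span_seq -> y \in span_seq -> x * y \in span_seq.
Proof.
move=> /span_seqP[f ->] /span_seqP[g ->]; rewrite mulr_suml.
apply: span_seq_sum => i _; rewrite mulr_sumr; apply: span_seq_sum => j _.
rewrite mulrnAl mulrnAr; do 2!apply: span_seqMn.
by apply/mem_span_seq/GM; exact: mem_nth.
Qed.

Lemma span_seqB x y : x \in span_seq -> y \in span_seq -> x - y \in span_seq.
Proof.
move=> xs ys; have p0 : (0 < p)%N by apply/prime_gt0/(pcharf_prime pD).
have -> : - y = y *+ p.-1.
  apply/eqP; rewrite eq_sym -addr_eq0 -mulrSr prednK //; exact/eqP/mulrn_pchar.
by apply: span_seqD => //; apply: span_seqMn.
Qed.

Lemma span_seq_closed : divring_closed [in span_seq].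
Proof.
apply: finite_subring_divring_closed; [exact: mem_span_seq|exact: span_seqB|exact: span_seqM].
Qed.

(** The span of a finite monoid over the prime field is a finite subring, hence a
    finite division ring, and Wedderburn's theorem applies. *)
Lemma finite_monoid_comm x y : x \in G -> y \in G -> x * y = y * x.
Proof.
move=> Gx Gy; apply: (finite_dsr_comm hD span_seq_closed); exact: mem_span_seq.
Qed.

Lemma span_torsion x : x \in span_seq -> x != 0 -> torsion x.
Proof.
move=> xs x0; apply: (torsion_powers (s := span_seq)) => // n.
elim: n => [|n IH]; rewrite ?expr0 ?exprS; [exact: mem_span_seq|exact: span_seqM].
Qed.
End Span.

Section TorsionClosure.
Variable p : nat.
Hypothesis pD : p \in [pchar D].

(** The elements l u^k, for l in L, form a finite monoid because u normalises L. *)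
Lemma torsion_normalizer_comm (L : seq D) u : torsion u -> 1 \in L ->
  (forall x y, x \in L -> y \in L -> x * y \in L) ->
  (forall x, x \in L -> u * x * u^-1 \in L) ->
  forall x, x \in L -> GRing.comm u x.
Proof.
move=> tu L1 LM Lu x Lx; have uu := hD (torsion_neq0 tu).
case: tu => b b0 eb; pose G := [seq l * u ^+ k | l <- L, k <- iota 0 b].
have GP l k : l \in L -> l * u ^+ k \in G.
  move=> Ll; rewrite (divn_eq k b) exprD mulnC exprM eb expr1n mul1r.
  apply/allpairsP; exists (l, (k %% b)%N); split=> //.
  by rewrite mem_iota /= add0n ltn_mod.
have conjX k l : l \in L -> exists2 l', l' \in L & u ^+ k * l = l' * u ^+ k.
  move=> Ll; elim: k => [|k [l' Ll' e]]; first by exists l; rewrite // expr0 mul1r mulr1.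
  exists (u * l' * u^-1); first exact: Lu.
  by rewrite exprS -mulrA e !mulrA mulrVK.
have G1 : 1 \in G by rewrite -[1]mul1r -(expr0 u); apply: GP.
have GM a b' : a \in G -> b' \in G -> a * b' \in G.
  move=> /allpairsP[[l k] /= [Ll _ ->]] /allpairsP[[l' k'] /= [Ll' _ ->]].
  have [l2 Ll2 e] := conjX k l' Ll'.
  rewrite mulrA -[l * _ * l']mulrA e mulrA -mulrA -exprD; apply: GP; exact: LM.
apply: (finite_monoid_comm pD G1 GM).
- by have := GP 1 1%N L1; rewrite expr1 mul1r.
- by have := GP x 0%N Lx; rewrite expr0 mulr1.
Qed.

Lemma torsion_power_comm x u i : torsion x -> torsion u ->
  u * x = x ^+ i * u -> GRing.comm u x.
Proof.
move=> [a a0 ea] tu e; have uu := hD (torsion_neq0 tu).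
have e' : u * x * u^-1 = x ^+ i by rewrite e mulrK.
pose L := [seq x ^+ k | k <- iota 0 a].
have LP k : x ^+ k \in L.
  rewrite (divn_eq k a) exprD mulnC exprM ea expr1n mul1r.
  by apply: map_f; rewrite mem_iota /= add0n ltn_mod.
apply: (torsion_normalizer_comm (L := L)) => //.
- exact: (LP 0%N).
- by move=> _ _ /mapP[k _ ->] /mapP[l _ ->]; rewrite -exprD.
- move=> _ /mapP[k _ ->].
  have -> : u * x ^+ k * u^-1 = (u * x * u^-1) ^+ k; last by rewrite e' -exprM.
  elim: k => [|k IH]; first by rewrite !expr0 mulr1 divrr.
  by rewrite !exprS -IH mulr_conj.
- exact: (LP 1%N).
Qed.

(** The monoid of the z^k x^l is finite and normalised by u. *)
Lemma torsion_twist_comm x u z : torsion x -> torsion u -> torsion z ->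
  GRing.comm z x -> GRing.comm z u -> u * x = z * x * u -> GRing.comm u x.
Proof.
move=> [a a0 ea] tu [c c0 ec] czx czu e; have uu := hD (torsion_neq0 tu).
have e' : u * x * u^-1 = z * x by rewrite e mulrK.
pose L := [seq z ^+ k * x ^+ l | k <- iota 0 c, l <- iota 0 a].
have cX k l : GRing.comm (z ^+ k) (x ^+ l).
  by apply: commrX; apply/commr_sym/commrX/commr_sym.
have LP k l : z ^+ k * x ^+ l \in L.
  rewrite (divn_eq k c) (divn_eq l a) !exprD ![(_ %/ _ * _)%N]mulnC !exprM ea ec.
  rewrite !expr1n !mul1r; apply/allpairsP; exists ((k %% c)%N, (l %% a)%N).
  by rewrite !mem_iota /= !add0n !ltn_mod.
apply: (torsion_normalizer_comm (L := L)) => //.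
- by have := LP 0%N 0%N; rewrite !expr0 mulr1.
- move=> _ _ /allpairsP[[k l] /= [_ _ ->]] /allpairsP[[k' l'] /= [_ _ ->]].
  rewrite mulrA -[z ^+ k * _ * _]mulrA -cX mulrA -mulrA -!exprD.
  exact: LP.
- move=> _ /allpairsP[[k l] /= [_ _ ->]].
  have conjX y n : u * y ^+ n * u^-1 = (u * y * u^-1) ^+ n.
    elim: n => [|n IH]; first by rewrite !expr0 mulr1 divrr.
    by rewrite !exprS -IH mulr_conj.
  rewrite -mulr_conj // !conjX e' -czu mulrK // exprMn_comm // mulrA -exprD.
  exact: LP.
- by have := LP 0%N 1%N; rewrite expr0 expr1 mul1r.
Qed.

(** The sum lies in the finite span of the monomials x^k y^l. *)
Lemma torsionD x y : GRing.comm x y -> torsion x -> torsion y ->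
  x + y != 0 -> torsion (x + y).
Proof.
move=> cxy [a a0 ea] [b b0 eb].
pose G := [seq x ^+ k * y ^+ l | k <- iota 0 a, l <- iota 0 b].
have cX k l : GRing.comm (x ^+ k) (y ^+ l).
  by apply: commrX; apply/commr_sym/commrX/commr_sym.
have GP k l : x ^+ k * y ^+ l \in G.
  rewrite (divn_eq k a) (divn_eq l b) !exprD ![(_ %/ _ * _)%N]mulnC !exprM ea eb.
  rewrite !expr1n !mul1r; apply/allpairsP; exists ((k %% a)%N, (l %% b)%N).
  by rewrite !mem_iota /= !add0n !ltn_mod.
have G1 : 1 \in G by have := GP 0%N 0%N; rewrite !expr0 mulr1.
apply: (span_torsion pD G1).
  move=> _ _ /allpairsP[[k l] /= [_ _ ->]] /allpairsP[[k' l'] /= [_ _ ->]].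
  rewrite mulrA -[x ^+ k * _ * _]mulrA -cX mulrA -mulrA -!exprD.
  exact: GP.
apply: (span_seqD pD); apply: (mem_span_seq pD).
- by have := GP 1%N 0%N; rewrite expr0 expr1 mulr1.
- by have := GP 0%N 1%N; rewrite expr0 expr1 mul1r.
Qed.
End TorsionClosure.
End Torsion.

(** * Engel conditions in groups of class two *)

Section CentralRoots.
Variable D : unitRingType.
Hypothesis hD : GRing.field_axiom D.

Lemma div_uniq_roots (r : seq D) : uniq r ->
  (forall a b, a \in r -> b \in r -> GRing.comm a b) -> uniq_roots r.
Proof.
elim: r => //= a r IH /andP[ar ur] cr; apply/andP; split; last first.
  by apply: IH => // x y xr yr; apply: cr; rewrite inE ?xr ?yr orbT.
apply/allP => x xr; rewrite /diff_roots; apply/andP; split.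
  by apply/eqP/cr; rewrite inE ?eqxx ?xr ?orbT.
by rewrite div_unitE // subr_eq0; apply: contraNneq ar => <-.
Qed.

(** Differences of distinct elements of a division ring are invertible, so pairwise
    commuting roots are counted as over a field. *)
Lemma poly_infinite_roots (P : {poly D}) (lam : nat -> D) : injective lam ->
  (forall i j, GRing.comm (lam i) (lam j)) ->
  (forall i, (i < size P)%N -> P.[lam i] = 0) -> P = 0.
Proof.
move=> il cl hP; apply/eqP; apply: contraT => P0.
have h := @max_ring_poly_roots _ P (mkseq lam (size P)) P0.
rewrite size_mkseq ltnn in h; apply: h.
  by apply/allP => y /mapP[i]; rewrite mem_iota /= => li ->; apply/eqP/hP.
apply: div_uniq_roots; first exact: mkseq_uniq.
by move=> x y /mapP[i _ ->] /mapP[j _ ->].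
Qed.

End CentralRoots.

Section QuantumPlane.
Variable D : unitRingType.
Hypothesis hD : GRing.field_axiom D.

Section Eval.
Variables (z u : D).
Hypothesis cuz : GRing.comm u z.

Fact intr_comm (w : D) : commr_rmorph (intr : int -> D) w.
Proof. by move=> n; apply: commr_int. Qed.

(** Polynomials in z and u with z central are evaluated in two stages: first the
    coefficients at z, then the polynomial at u. *)
Definition coef_ev : {poly int} -> D := horner_morph (intr_comm z).

Lemma coef_ev_comm (w : D) (q : {poly int}) : GRing.comm w z ->
  GRing.comm w (coef_ev q).
Proof.
move=> cw; rewrite /coef_ev /horner_morph horner_coef; apply: commr_sum => i _.
apply: commrM; last exact: commrX.
by rewrite coef_map; apply: commr_int.
Qed.

HB.instance Definition _ := GRing.RMorphism.copy coef_ev (horner_morph (intr_comm z)).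

Lemma coef_evX : coef_ev 'X = z.
Proof. by rewrite /coef_ev horner_morphX. Qed.

Fact ev_comm : commr_rmorph coef_ev u.
Proof. by move=> q; apply: coef_ev_comm. Qed.

Definition poly_ev : {poly {poly int}} -> D := horner_morph ev_comm.
HB.instance Definition _ := GRing.RMorphism.copy poly_ev (horner_morph ev_comm).

Lemma poly_evE n (P : {poly {poly int}}) : (size P <= n)%N ->
  poly_ev P = \sum_(i < n) coef_ev P`_i * u ^+ i.
Proof.
move=> sP; rewrite /poly_ev /horner_morph (@horner_coef_wide _ n) //.
  by apply: eq_bigr => i _; rewrite coef_map.
by apply: leq_trans (size_poly _ _) sP.
Qed.

(** The substitution of z u for u, which is what conjugation by b does when b u b^-1
    = z u. *)
Definition twist (P : {poly {poly int}}) := \poly_(i < size P) (P`_i * 'X^i).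

Lemma coef_twist P i : (twist P)`_i = P`_i * 'X^i.
Proof.
rewrite coef_poly; case: ltnP => // h; by rewrite nth_default // mul0r.
Qed.

Lemma poly_ev_twist (b : D) P : b \is a GRing.unit -> GRing.comm b z ->
  b * u * b^-1 = z * u -> poly_ev (twist P) = b * poly_ev P * b^-1.
Proof.
move=> ub cb e; rewrite (@poly_evE (size P)) ?size_poly // (@poly_evE (size P)) //.
rewrite mulr_sumr mulr_suml; apply: eq_bigr => i _.
rewrite coef_twist rmorphM rmorphXn /= coef_evX.
rewrite mulrA (coef_ev_comm _ cb) -mulrA -[in RHS]mulrA -[RHS]mulrA; congr (_ * _).
have conjX n : b * (u ^+ n * b^-1) = (b * u * b^-1) ^+ n.
  rewrite mulrA; elim: n => [|n IH]; first by rewrite !expr0 mulr1 divrr.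
  by rewrite !exprS -IH mulr_conj.
by rewrite conjX e exprMn_comm //; apply/commr_sym.
Qed.

(** Numerators and denominators, as polynomials in u, of the elements v_0 = 1 + u
    and v_(k+1) = v_k b v_k^-1 b^-1. The iterates of v |-> v b v^-1 at 1 + u are the
    v_k b v_k^-1, and conjugation by b twists polynomials in u. *)
Fixpoint frac (k : nat) : {poly {poly int}} * {poly {poly int}} :=
  if k is j.+1 then ((frac j).1 * twist (frac j).2, (frac j).2 * twist (frac j).1)
  else ('X + 1, 1).

Definition conj_on (b v : D) := v * b * v^-1.

Lemma iter_frac (b : D) k : b \is a GRing.unit -> GRing.comm b z ->
    b * u * b^-1 = z * u -> 1 + u != 0 ->
  [/\ poly_ev (frac k).1 != 0, poly_ev (frac k).2 != 0 &
    iter k.+1 (conj_on b) (1 + u) =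
    conj_on b (poly_ev (frac k).1 * (poly_ev (frac k).2)^-1)].
Proof.
move=> ub cb e u1; have b0 : b != 0 by rewrite -(div_unitE hD).
have nz P : poly_ev P != 0 -> poly_ev (twist P) != 0.
  move=> P0; rewrite (poly_ev_twist P ub cb e).
  by do ![apply: (div_mulf_neq0 hD) => //]; rewrite invr_eq0.
elim: k => [|k [n1 n2 IH]].
  have eX : poly_ev ('X + 1) = 1 + u.
    by rewrite rmorphD rmorph1 /= /poly_ev horner_morphX addrC.
  by rewrite /= eX rmorph1 /= invr1 mulr1 oner_neq0; split.
split; try by rewrite /= rmorphM /=; apply: (div_mulf_neq0 hD) => //; apply: nz.
rewrite iterS IH !rmorphM /=.
set N := poly_ev _.1 in n1 *; set M := poly_ev _.2 in n2 *.
have utN : poly_ev (twist (frac k).1) \is a GRing.unit by rewrite hD // nz.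
have utM : poly_ev (twist (frac k).2) \is a GRing.unit by rewrite hD // nz.
have eN := poly_ev_twist (frac k).1 ub cb e.
have eM := poly_ev_twist (frac k).2 ub cb e.
have cMN : GRing.comm M (poly_ev (twist (frac k).2) * (poly_ev (twist (frac k).1))^-1).
  apply: commrM; last apply: commrV;
  by rewrite /GRing.comm -!rmorphM mulrC.
move: utN utM eN eM cMN; set tN := poly_ev _; set tM := poly_ev _.
rewrite -/N -/M => utN utM eN eM cMN; have uN := hD n1; have uM := hD n2.
pose w := N * M^-1; have uw : w \is a GRing.unit by rewrite unitrMl ?unitrV.
have -> : N * tM * (M * tN)^-1 = w * b * w^-1 * b^-1.
  have -> : w * b * w^-1 * b^-1 = w * (b * w * b^-1)^-1 by rewrite invr_conj // !mulrA.
  have -> : b * w * b^-1 = tN * tM^-1 by rewrite eN eM invr_conj // mulr_conj.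
  rewrite /w !invrM ?unitrV // invrK.
  rewrite -!mulrA; congr (N * _); rewrite [LHS]mulrA.
  exact: (commrV (commr_sym cMN)).
rewrite /conj_on -/w; have uX : w * b * w^-1 \is a GRing.unit by rewrite unitr_conj.
by rewrite [(_ * b^-1)^-1]invrM ?unitrV // invrK mulrVK // mulrA.
Qed.

(** The linear coefficients show that the fraction is not 1 as long as z differs
    from 1. *)
Lemma coef_frac k : [/\ (frac k).1`_0 = 1, (frac k).2`_0 = 1 &
  (frac k).1`_1 - (frac k).2`_1 = (1 - 'X) ^+ k].
Proof.
elim: k => [|k [a0 b0 e]] /=.
  by rewrite !coefD !coefX !coef1 /= add0r addr0 subr0 expr0.
rewrite !coef0M !coef_twist a0 b0 expr0 !mulr1; split=> //.
rewrite !coefM !big_ord_recl !big_ord0 /= !coef_twist a0 b0 expr0 expr1 !mulr1 !mul1r.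
rewrite exprS -e; ring.
Qed.
End Eval.

(** The iterates at 1 + lam x are rational functions of lam x, all with the same
    coefficients. If they commute with b for infinitely many lam, numerator and
    denominator agree up to twist as polynomials, and their linear coefficients
    differ by a power of 1 - z. *)
Lemma twist_not_engel (x b z : D) (k : nat) (lam : nat -> D) :
  x \is a GRing.unit -> b \is a GRing.unit -> z != 1 ->
  GRing.comm z x -> GRing.comm z b -> b * x * b^-1 = z * x ->
  injective lam -> (forall i j, GRing.comm (lam i) (lam j)) ->
  (forall i, GRing.comm (lam i) x) -> (forall i, GRing.comm (lam i) b) ->
  ~ (forall i, iter k (conj_on b) (1 + lam i * x) = b).
Proof.
move=> ux ub z1 czx czb e il cl clx clb hk.
have ez : z = b * x * b^-1 * x^-1 by rewrite e mulrK.
have clz i : GRing.comm (lam i) z.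
  by rewrite ez; do ![apply: commrM => //]; apply: commrV.
have cuz i : GRing.comm (lam i * x) z.
  by apply/commr_sym; apply: commrM => //; apply/commr_sym.
have eu i : b * (lam i * x) * b^-1 = z * (lam i * x).
  by rewrite mulrA -clb -2!mulrA [b * _]mulrA e mulrA clz mulrA.
have zb : b * x != x * b.
  apply: contra_neq z1 => e2; rewrite ez e2 mulrK // divrr //.
have u1 i : 1 + lam i * x != 0.
  rewrite addrC addr_eq0; apply: contra_neqN z1 => /eqP e2.
  have := eu i; rewrite e2 mulrN1 mulNr divrr // mulrN1 => /oppr_inj ->//.
pose P := (frac k).1 * twist (frac k).2 - (frac k).2 * twist (frac k).1.
have P1 : P`_1 = (1 - 'X) ^+ k.+1.
  by have [_ _] := coef_frac k.+1; rewrite -coefB.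
have P0 i : poly_ev (cuz i) P = 0.
  have [n1 n2] := iter_frac (cuz i) k ub (commr_sym czb) (eu i) (u1 i).
  rewrite iterS hk {1}/conj_on mulrK // rmorphB !rmorphM /=.
  rewrite !(poly_ev_twist (cuz i) _ ub (commr_sym czb) (eu i)).
  set N := poly_ev _ _ in n1 *; set M := poly_ev _ _ in n2 *.
  rewrite /conj_on => e2; apply/eqP; rewrite subr_eq0; apply/eqP.
  have cNM : GRing.comm N M by rewrite /GRing.comm -!rmorphM mulrC.
  have uN := hD n1; have uM := hD n2.
  have e3 : N * M^-1 * b = b * (N * M^-1).
    by rewrite {2}e2 mulrVK // unitrMl ?unitrV.
  have e4 : b * M * b^-1 = M * N^-1 * (b * N * b^-1).
    have -> : b * N = b * (N * M^-1) * M by rewrite !mulrA mulrVK.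
    rewrite -e3 !mulrA mulrVK // divrr // mul1r //.
  rewrite e4 !mulrA cNM mulrK //.
pose Q := \poly_(i < size P) (coef_ev z P`_i * x ^+ i).
have Q0 : Q = 0.
  apply: (poly_infinite_roots hD il cl) => i _.
  rewrite (horner_coef_wide _ (size_poly _ _)) -[RHS](P0 i) (poly_evE _ (leqnn _)).
  apply: eq_bigr => j _; rewrite coef_poly ltn_ord -mulrA; congr (_ * _).
  rewrite exprMn_comm; last exact: clx.
  exact: (commrX _ (commr_sym (commrX _ (clx i)))).
have : coef_ev z P`_1 = 0.
  have := congr1 (fun q : {poly D} => q`_1) Q0; rewrite coef_poly coef0.
  case: ltnP => [_|h _]; last by rewrite nth_default // rmorph0.
  by move/(div_mulf_eq0 hD) => [//|/eqP]; rewrite expr1 -(negbK (_ == 0)) -(div_unitE hD) ux.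
rewrite P1 rmorphXn rmorphB rmorph1 /= coef_evX => /eqP.
by rewrite -(negbK (_ == 0)) -(div_unitE hD) unitrX // hD // subr_eq0 eq_sym.
Qed.

End QuantumPlane.

(** * Abelian subnormal subgroups of division rings *)

Section AbelianSubnormal.
Variable D : unitRingType.
Hypothesis hD : GRing.field_axiom D.
Implicit Types (x y z c w b : D) (E N H P Q X Y : D -> Prop).

(** The least prime factor of a vanishing natural number vanishes, or else so does
    the cofactor. *)
Lemma pchar_cases : (exists p, p \in [pchar D]) \/
  forall n, (0 < n)%N -> n%:R != 0 :> D.
Proof.
have [hn|/existsNP[n /not_implyP[n0 /negP/negPn e]]] :=
  pselect (forall n, (0 < n)%N -> n%:R != 0 :> D); [by right|left].
have [p p_pr pn] : exists2 p, prime p & p%:R == 0 :> D.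
  elim/ltn_ind: n n0 e => n IH n0 e.
  have [n1|n1] := leqP n 1.
    move: e; have -> : n = 1%N by apply/eqP; rewrite eqn_leq n1.
    by rewrite oner_eq0.
  have [p_pr dv] := (pdiv_prime n1, pdiv_dvd n).
  have [p0|p0] := eqVneq ((pdiv n)%:R : D) 0; first by exists (pdiv n); rewrite ?p0.
  apply: (IH (n %/ pdiv n)%N).
  - by rewrite ltn_Pdiv ?prime_gt1.
  - by rewrite divn_gt0 ?prime_gt0 // dvdn_leq.
  - move: e; rewrite -{1}(divnK dv) natrM => /eqP/(div_mulf_eq0 hD)[->//|e].
    by rewrite e eqxx in p0.
by exists p; rewrite inE p_pr.
Qed.

Lemma natr_inj : (forall n, (0 < n)%N -> n%:R != 0 :> D) ->
  injective (fun n : nat => n%:R : D).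
Proof.
move=> h i j e; wlog lij : i j e / (i <= j)%N.
  by move=> hw; case/orP: (leq_total i j) => l; [apply: hw|apply/esym/hw].
apply/eqP; rewrite eqn_leq lij /= leqNgt -subn_gt0; apply/negP => /h/eqP; apply.
by rewrite natrB // e subrr.
Qed.

Lemma powers_inj c : c != 0 -> ~ torsion c -> injective (fun n => c ^+ n).
Proof.
move=> c0 nc i j e; wlog lij : i j e / (i <= j)%N.
  by move=> hw; case/orP: (leq_total i j) => l; [apply: hw|apply/esym/hw].
apply/eqP; rewrite eqn_leq lij /= leqNgt -subn_gt0; apply/negP => h; apply: nc.
exists (j - i)%N => //; have uc : c ^+ i \is a GRing.unit by rewrite unitrX // hD.
by rewrite -[LHS](mulKr uc) -exprD subnKC // -e mulVr.
Qed.

Lemma dsrX E x n : division_subring E -> E x -> E (x ^+ n).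
Proof.
by move=> dE Ex; elim: n => [|n IH]; rewrite ?expr0 ?exprS; [exact: dsr1|exact: dsrM].
Qed.

Lemma dsr_natr E n : division_subring E -> E n%:R.
Proof.
move=> dE; elim: n => [|n IH]; first exact: dsr0.
by rewrite -natr1; apply: dsrD => //; exact: dsr1.
Qed.

(** If z differs from 1, [twist_not_engel] forbids infinitely many parameters
    commuting with x and b. In characteristic 0 the natural numbers are such
    parameters. In characteristic p the powers of any element of infinite order that
    commutes with x and b are, so all these elements have finite order; this applies
    to z and to powers of x and b, and [torsion_twist_comm] concludes. *)
Lemma engel_pair_comm E k x b z : division_subring E -> E x -> E b ->
  x != 0 -> b != 0 -> GRing.comm z x -> GRing.comm z b -> b * x * b^-1 = z * x ->
  (forall w, nonzero_of E w -> iter k (conj_on b) w = b) -> GRing.comm b x.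
Proof.
move=> dE Ex Eb x0 b0 czx czb e hk; have [ux ub] := (hD x0, hD b0).
have ebx : b * x = z * x * b by rewrite -e mulrVK.
have [z1|z1] := eqVneq z 1; first by rewrite /GRing.comm ebx z1 mul1r.
have ez : z = b * x * b^-1 * x^-1 by rewrite e mulrK.
have Ez : E z by rewrite ez; do ![apply: (dsrM dE)|apply: (dsrV dE)].
have key (lam : nat -> D) : injective lam -> (forall i j, GRing.comm (lam i) (lam j)) ->
    (forall i, E (lam i)) ->
    (forall i, GRing.comm (lam i) x) -> (forall i, GRing.comm (lam i) b) -> False.
  move=> il cl El clx clb.
  apply: (twist_not_engel hD (k := k) ux ub z1 czx czb e il cl clx clb) => i.
  apply: hk; split; first by apply: dsrD => //; [exact: dsr1|exact: dsrM].
  rewrite addrC addr_eq0; apply: contra_neqN z1 => /eqP e2.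
  have : b * (lam i * x) * b^-1 = lam i * (z * x).
    by rewrite -e !mulrA clb.
  rewrite e2 mulrN1 mulNr divrr // => e3.
  have uz : z \is a GRing.unit by rewrite ez !unitrMl ?unitrV.
  apply: (mulIr ux); rewrite mul1r; apply: (@mulrI _ (lam i)).
    apply: hD; apply/eqP => l0; move: e2; rewrite l0 mul0r => /eqP.
    by rewrite eq_sym oppr_eq0 oner_eq0.
  by rewrite -e3 e2.
have [[p pD]|h0] := pchar_cases; last first.
  case: (key (fun n => n%:R)) => //; first exact: natr_inj.
  - by move=> i j; exact: commr_nat.
  - by move=> i; exact: dsr_natr.
  - by move=> i; exact/commr_sym/commr_nat.
  - by move=> i; exact/commr_sym/commr_nat.
have tor c : E c -> c != 0 -> GRing.comm c x -> GRing.comm c b -> torsion c.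
  move=> Ec c0 cx cb; apply: contrapT => nc.
  apply: (key (fun n => c ^+ n)); first exact: powers_inj.
  - by move=> i j; apply/commr_sym/commrX/commr_sym/commrX/commr_refl.
  - by move=> i; exact: dsrX.
  - by move=> i; exact/commr_sym/commrX/commr_sym.
  - by move=> i; exact/commr_sym/commrX/commr_sym.
have z0 : z != 0 by rewrite -(div_unitE hD) ez !unitrMl ?unitrV.
have tz := tor z Ez z0 czx czb; have [r r0 er] := tz.
have tx : torsion x.
  apply: (torsion_root r0); apply: tor.
  - exact: dsrX.
  - by rewrite -(div_unitE hD) unitrX.
  - exact/commr_sym/commrX/commr_refl.
  - have conjX n : b * x ^+ n * b^-1 = (b * x * b^-1) ^+ n.
      elim: n => [|n IH]; first by rewrite !expr0 mulr1 divrr.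
      by rewrite !exprS -IH mulr_conj.
    apply/commr_sym; rewrite /GRing.comm -[LHS](mulrVK ub) conjX e.
    by rewrite exprMn_comm // er mul1r.
have tb : torsion b.
  apply: (torsion_root r0); apply: tor.
  - exact: dsrX.
  - by rewrite -(div_unitE hD) unitrX.
  - have bX n : b ^+ n * x = z ^+ n * x * b ^+ n.
      elim: n => [|n IH]; first by rewrite !expr0 mul1r mulr1.
      rewrite exprS -mulrA IH !mulrA.
      by rewrite (commrX n (commr_sym czb)) -[_ * b * x]mulrA ebx !mulrA -exprSr.
    by rewrite /GRing.comm bX er mul1r.
  - exact/commr_sym/commrX/commr_refl.
exact: (torsion_twist_comm hD pD tx tb tz czx czb ebx).
Qed.

(** Each conjugation of b by an element of one member of the chain lands in the next
    member. *)
Lemma iter_conj_mem Q n N b w : unit_subgroup Q -> subnormal_in Q n N ->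
  N b -> Q w -> N (iter n (conj_on b) w).
Proof.
move=> gQ sN; elim: sN b w => {n N} [N eN b w _ /eN //|n H N sH IH nN b w Nb Qw].
have gH := subnormal_usg gQ sH; have [gN sNH _] := nN.
by rewrite iterS /conj_on; apply: normal_inV gH nN Nb (IH _ _ (sNH _ Nb) Qw).
Qed.

(** Induction on the depth. Let N lie in P and P in P'. If a and b are in N and a
    conjugate of N under P', their commutator lies in both groups and commutes with
    a and b, while b is an Engel element since its iterated conjugates end in an
    abelian group; so a and b commute by [engel_pair_comm]. Thus the conjugates of N
    under P' generate an abelian group, which is normal in P' and so has smaller
    depth. *)
Lemma abelian_subnormal_central E n N : division_subring E ->
  subnormal_in (nonzero_of E) n N ->
  (forall x y, N x -> N y -> GRing.comm x y) ->
  forall x, N x -> central_in E x.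
Proof.
move=> dE; have gE := nonzero_usg hD dE.
elim: n N => [|[|n] IH] N sN cN x Nx.
- move=> y Ey; have [->|y0] := eqVneq y 0; first exact: commr0.
  by apply: cN => //; apply/(subnormalE sN).
- move=> y Ey; have [H sH nN] := subnormalE sN.
  have nN' : normal_in N (nonzero_of E).
    by apply: normal_ext nN => t; apply: (subnormalE sH).
  have cx t : N t -> GRing.comm x t by apply: cN.
  by case: (additive_normal hD dE nN' cx Nx Ey).
have [P sP nN] := subnormalE sN; have gP := subnormal_usg gE sP.
have [P' sP' nP] := subnormalE sP; have gP' := subnormal_usg gE sP'.
have [gN sNP _] := nN; have [_ sPP' _] := nP.
have NE t : N t -> nonzero_of E t by move/(subnormal_sub sN).
have P'E t : P' t -> nonzero_of E t by move/(subnormal_sub sP').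
(* the group N and its conjugate by y are both normal in P, so each contains the
   commutator of its elements with those of the other *)
have key y a b : P' y -> N a -> N (y * b * y^-1) -> GRing.comm b a.
  move=> P'y Na Nb; have uy := usgU gP' P'y.
  have nNy : normal_in (conj_pred y N) P.
    have := normal_conj uy nN; apply: normal_ext => t; rewrite /conj_pred.
    split=> [Pt|Pt]; last exact: normal_inV gP' nP Pt P'y.
    have [_ _ nP'] := nP; have := nP' _ _ Pt P'y.
    by rewrite !mulrA mulVr // mul1r mulrVK.
  have [gNy sNyP _] := nNy.
  have Pb : P b by apply: sNyP.
  have Pa := sNP _ Na.
  pose z := b * a * b^-1 * a^-1.
  have Nz : N z.
    by apply: (usgM gN); [exact: normal_inV gP nN Na Pb|exact: usgV].
  have Nyz : conj_pred y N z.
    have -> : z = b * (a * b^-1 * a^-1) by rewrite /z !mulrA.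
    apply: (usgM gNy) => //; exact: (normal_inV gP nNy (usgV gNy Nb) Pa).
  have ub : b \is a GRing.unit := usgU gP Pb.
  have ua : a \is a GRing.unit := usgU gP Pa.
  have [[Ea a0] [Eb b0]] := (NE _ Na, subnormal_sub sP Pb).
  have czb : GRing.comm z b.
    exact: (comm_conj uy (cN _ _ Nyz Nb)).
  apply: (@engel_pair_comm E n.+3 a b z) => //.
  - exact: cN.
  - by rewrite /z mulrVK.
  move=> w nzw; have sNy := subnormal_conj gE (P'E _ P'y) sN.
  rewrite iterS; have := iter_conj_mem gE sNy Nb nzw.
  set v := iter _ _ w => Nv.
  have uv : v \is a GRing.unit by apply: (usgU gNy).
  rewrite /conj_on; have -> : v * b = b * v; last by rewrite mulrK.
  exact: (comm_conj uy (cN _ _ Nv Nb)).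
pose C t := exists2 y, P' y & N (y * t * y^-1).
have CP' t : C t -> P' t.
  move=> [y P'y Nt]; have := sPP' _ (sNP _ Nt); have uy := usgU gP' P'y => h.
  have -> : t = y^-1 * (y * t * y^-1) * y by rewrite !mulrA mulVr // mul1r mulrVK.
  by apply: (usgM gP') => //; apply: (usgM gP') => //; exact: usgV.
have nC : normal_in (generated_by C) P'.
  apply: generated_normal => // s h [y P'y Ns] P'h.
  have [uy uh] := (usgU gP' P'y, usgU gP' P'h).
  exists (y * h); first exact: usgM.
  rewrite invrM // !mulrA mulrK // -[_ * h * h^-1]mulrA divrr // mulr1.
  by [].
have sC : subnormal_in (nonzero_of E) n.+1 (generated_by C) by apply: SubnormalS sP' nC.
have uC s : C s -> s \is a GRing.unit by move/CP'; apply: usgU.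
have cC a b : C a -> C b -> GRing.comm a b.
  move=> [y P'y Na] [t P't Nb].
  have [uy ut] := (usgU gP' P'y, usgU gP' P't).
  have P'yt : P' (t * y^-1) by apply: usgM => //; exact: usgV.
  have eb : t * y^-1 * (y * b * y^-1) * (t * y^-1)^-1 = t * b * t^-1.
    rewrite invrM ?unitrV // invrK !mulrA mulrVK // -[_ * y^-1 * y]mulrA mulVr //.
    by rewrite mulr1.
  apply/commr_sym; apply: (comm_conj uy).
  by apply: (key (t * y^-1)) => //; rewrite eb.
apply: (IH _ sC); last first.
  by apply: generated_mem; exists 1; [exact: usg1|rewrite mul1r invr1 mulr1].
move=> a b ga gb; apply: generated_comm gb => // t Ct.
by apply/commr_sym; apply: generated_comm ga => // s Cs; apply: cC.
Qed.
End AbelianSubnormal.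

(** * Weights of subnormal subgroups of division rings *)

Section SubnormalDivision.
Variable D : unitRingType.
Hypothesis hD : GRing.field_axiom D.
Implicit Types (x y z c w : D) (E N H P Q X Y : D -> Prop).

Definition commutator x y := x * y * x^-1 * y^-1.

Definition derived N :=
  generated_by (fun z => exists x y, [/\ N x, N y & z = commutator x y]).

Lemma commutator_normal N H x y : unit_subgroup H -> normal_in N H ->
  N x -> H y -> N (commutator x y).
Proof.
move=> gH nN Nx Hy; have [gN _ _] := nN.
rewrite /commutator -!mulrA mulrA -[x * _ * _]mulrA; apply: (usgM gN) => //.
by rewrite mulrA; apply: normal_inV nN _ _ => //; apply: usgV.
Qed.

Lemma commutator_normalr N H x y : unit_subgroup H -> normal_in N H ->
  H x -> N y -> N (commutator x y).
Proof.
move=> gH nN Hx Ny; have [gN _ _] := nN.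
rewrite /commutator; apply: (usgM gN); last exact: usgV.
exact: normal_inV nN _ _.
Qed.

Lemma commutator_conj h x y : h \is a GRing.unit ->
  commutator (h * x * h^-1) (h * y * h^-1) = h * commutator x y * h^-1.
Proof. by move=> uh; rewrite /commutator !invr_conj // !mulr_conj. Qed.

Lemma commutatorMl a x y : a \is a GRing.unit -> x \is a GRing.unit ->
  GRing.comm a x -> GRing.comm a y -> commutator (a * x) y = commutator x y.
Proof.
move=> ua ux cx cy; rewrite /commutator invrM //.
have c : GRing.comm a (x * y * x^-1).
  by apply: commrM; [exact: commrM|exact: commrV].
have -> : a * x * y * (x^-1 * a^-1) = a * (x * y * x^-1) * a^-1 by rewrite !mulrA.
by rewrite c mulrK.
Qed.

Lemma commutatorMr b x y : b \is a GRing.unit -> y \is a GRing.unit ->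
  GRing.comm b x -> GRing.comm b y -> commutator x (b * y) = commutator x y.
Proof.
move=> ub uy cx cy; rewrite /commutator invrM //.
have c : GRing.comm b (x * y * x^-1 * y^-1).
  by do ![apply: commrM => //]; exact: commrV.
have -> : x * (b * y) * x^-1 * (y^-1 * b^-1) = b * (x * y * x^-1 * y^-1) * b^-1.
  by rewrite !mulrA cx.
by rewrite c mulrK.
Qed.

Lemma derived_normal N H : unit_subgroup H -> normal_in N H ->
  normal_in (derived N) H.
Proof.
move=> gH nN; have [gN sN _] := nN; apply: generated_normal => //.
- move=> z [x [y [Nx Ny ->]]]; apply: sN.
  by apply: (commutator_normal gN) => //; apply: normal_refl.
- move=> z h [x [y [Nx Ny ->]]] Hh; exists (h^-1 * x * h), (h^-1 * y * h).
  have [_ _ nN'] := nN; split; [exact: nN'|exact: nN'|].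
  by rewrite -{2 4 6}[h]invrK commutator_conj ?unitrV ?(usgU gH).
Qed.

Lemma derived_subnormal Q n N : unit_subgroup Q ->
  subnormal_in Q n.+1 N -> subnormal_in Q n.+1 (derived N).
Proof.
move=> gQ /subnormalE[H sH nN]; apply: (SubnormalS sH).
by apply: derived_normal => //; apply: subnormal_usg sH.
Qed.

(** Conjugation by w multiplies every element of N by a central factor, and
    commutators do not see central factors. *)
Lemma derived_comm_center E N w : unit_subgroup N -> division_subring E ->
  (forall x, N x -> E x) -> E w -> w != 0 ->
  (forall h, N h -> central_in E (commutator w h)) ->
  forall z, derived N z -> GRing.comm w z.
Proof.
move=> gN dE sN Ew w0 hw z; have uw := hD w0.
have wE h : N h -> exists zt, [/\ central_in E zt, E zt, zt != 0 &
    w * h * w^-1 = zt * h].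
  move=> Nh; have uh := usgU gN Nh; exists (commutator w h); split.
  - exact: hw.
  - by do ![apply: (dsrM dE)|apply: (dsrV dE)] => //; exact: sN.
  - rewrite -div_unitE // /commutator.
    by rewrite !(unitrMl, unitrMr) ?unitrV.
  - by rewrite /commutator mulrVK.
apply: generated_comm.
  move=> s [x [y [Nx Ny ->]]]; apply: (usgU gN).
  by apply: (commutator_normal gN) => //; apply: normal_refl.
move=> s [x [y [Nx Ny ->]]].
have [a [ca Ea a0 ea]] := wE _ Nx; have [b [cb Eb b0 eb]] := wE _ Ny.
have Exy : E (commutator x y).
  by do ![apply: (dsrM dE)|apply: (dsrV dE)] => //; exact: sN.
have: commutator (w * x * w^-1) (w * y * w^-1) = commutator x y.
  have ux := usgU gN Nx; have uy := usgU gN Ny.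
  have Ey := sN _ Ny; have Ex := sN _ Nx.
  rewrite ea eb commutatorMl ?commutatorMr //; do ?exact: hD.
  - exact: cb.
  - exact: cb.
  - exact: ca.
  - by apply: ca; apply: dsrM.
rewrite commutator_conj // => e.
by rewrite /GRing.comm -{2}e mulrVK.
Qed.

(** If the commutators of N are central, a noncentral a in N and the central
    elements of N generate a normal abelian subgroup of N, which must be central. *)
Lemma derived_noncentral E n N : division_subring E ->
  subnormal_in (nonzero_of E) n N -> noncentral E N -> noncentral E (derived N).
Proof.
move=> dE sN [a Na na]; apply: contrapT => /noncentralPn hd; apply: na.
have gE := nonzero_usg hD dE; have gN := subnormal_usg gE sN.
pose S z := z = a \/ N z /\ central_in E z.
have sS z : S z -> N z by case=> [->|[]].
have NE z : N z -> E z by move/(subnormal_sub sN) => [].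
have nS: normal_in (generated_by S) N.
  have gS: unit_subgroup (generated_by S).
    by apply: generated_usg => s /sS; apply: usgU.
  split=> // [x gx|x h gx Nh]; first exact: gx.
  have uh := usgU gN Nh.
  suff: conj_pred h^-1 (generated_by S) x by rewrite /conj_pred invrK.
  apply: gx; first by apply: conj_usg; rewrite ?unitrV.
  move=> s Ss; rewrite /conj_pred invrK.
  case: Ss => [->|[Ns cs]]; last first.
    by rewrite -mulrA (cs _ (NE _ Nh)) mulKr //; apply: generated_mem; right.
  (* a conjugate of a differs from a by a commutator, which is central *)
  have -> : h^-1 * a * h = commutator h^-1 a * a.
    by rewrite /commutator invrK mulrVK ?(usgU gN).
  have NVh := usgV gN Nh.
  apply: (usgM gS); last by apply: generated_mem; left.
  apply: generated_mem; right; split.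
    by apply: (commutator_normal gN) => //; apply: normal_refl.
  by apply: hd; apply: generated_mem; exists h^-1, a.
apply: (abelian_subnormal_central hD dE (SubnormalS sN nS)); last first.
  by apply: generated_mem; left.
have uS s : S s -> s \is a GRing.unit by move/sS; apply: usgU.
have cS s t : S s -> S t -> GRing.comm s t.
  case=> [->|[Ns cs]] [->|[Nt ct]]; first exact: commr_refl.
  - exact/commr_sym/ct/NE.
  - exact/cs/NE.
  - exact/cs/NE.
move=> x y gx gy; apply: generated_comm gy => // t St.
by apply/commr_sym; apply: generated_comm gx => // s Ss; apply: cS.
Qed.

(** The conditions [centralizer_trivial] and [weights_trivial] are proved together
    by induction on the depth. *)
Definition centralizer_trivial n := forall E N c, division_subring E ->
  subnormal_in (nonzero_of E) n N -> noncentral E N ->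
  (forall x, N x -> GRing.comm c x) -> forall y, E y -> GRing.comm c y.

(** An element w whose commutators with N are central multiplies the elements of N
    by scalars under conjugation; those scalars are the weights. *)
Definition weights_trivial n := forall E N w, division_subring E ->
  subnormal_in (nonzero_of E) n N -> noncentral E N -> E w -> w != 0 ->
  (forall h, N h -> central_in E (commutator w h)) -> central_in E w.

(** The derived group of N is centralized by w, has the same depth, and is not
    central. *)
Lemma weights_of_centralizer n : centralizer_trivial n.+1 -> weights_trivial n.+1.
Proof.
move=> hn E N w dE sN ncN Ew w0 hw; have gE := nonzero_usg hD dE.
have gN := subnormal_usg gE sN.
apply: (hn E (derived N)) => //; first exact: derived_subnormal.
  exact: derived_noncentral sN ncN.
by apply: derived_comm_center hw => // x /(subnormal_sub sN)[].
Qed.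

(** Let E1 be the centralizer of q. The group Y lies in E1, and its conjugates under
    T, the part of P' in E1, generate a normal subgroup of T, which has depth n + 1
    in E1. Every conjugate of q under P commutes with that subgroup, hence with all
    of E1 and in particular with q. So the conjugates of q generate an abelian
    normal subgroup of P. *)
Lemma commuting_normal_central n E P X Y : centralizer_trivial n.+1 ->
  division_subring E -> subnormal_in (nonzero_of E) n.+1 P ->
  normal_in X P -> normal_in Y P ->
  (forall x y, X x -> Y y -> GRing.comm x y) -> noncentral E Y ->
  forall q, X q -> central_in E q.
Proof.
move=> hn dE sP nX nY cXY ncY q Xq.
have gE := nonzero_usg hD dE; have gP := subnormal_usg gE sP.
have [P' sP' nP] := subnormalE sP; have gP' := subnormal_usg gE sP'.
have [gX sX _] := nX; have [gY sY _] := nY; have [_ sPP' _] := nP.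
have PE x : P x -> E x by move/(subnormal_sub sP) => [].
pose E1 := centralizer_in E q; have dE1 : division_subring E1.
  exact: centralizer_dsr.
have gE1 := nonzero_usg hD dE1.
have YE1 y : Y y -> nonzero_of E1 y.
  move=> Yy; split; last by rewrite -div_unitE // (usgU gY).
  by split; [exact/PE/sY|exact: cXY].
pose T := meet_pred P' (nonzero_of E1).
have sT : subnormal_in (nonzero_of E1) n T.
  by apply: subnormal_restrict sP' => // x [[]].
have gT := subnormal_usg gE1 sT.
pose S z := exists r y, [/\ T r, Y y & z = r^-1 * y * r].
have YT y : Y y -> T y by move=> Yy; split; [exact/sPP'/sY|exact: YE1].
have nY1 : normal_in (generated_by S) T.
  apply: generated_normal => // [s [r [y [Tr Yy ->]]]|s h [r [y [Tr Yy ->]]] Th].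
    by do ![apply: (usgM gT) => //]; [exact: usgV|exact: YT].
  exists (r * h), y; split=> //; first exact: usgM.
  by rewrite invrM ?(usgU gT) // !mulrA.
have YY1 y : Y y -> generated_by S y.
  move=> Yy; apply: generated_mem; exists 1, y; split=> //; first exact: usg1.
  by rewrite invr1 mul1r mulr1.
have uS s : S s -> s \is a GRing.unit.
  move=> [r [y [Tr Yy ->]]].
  rewrite -{2}[r]invrK unitr_conj; first exact: (usgU gY).
  by rewrite unitrV; apply: (usgU gT).
have ncY1 : noncentral E1 (generated_by S).
  apply: contrapT => /noncentralPn hY1; case: ncY => y Yy; apply.
  apply: (abelian_subnormal_central hD dE (SubnormalS sP nY)) Yy.
  move=> a b Ya Yb; apply: hY1 (YY1 _ Ya) _ _; exact: (YE1 _ Yb).1.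
have key g : P g -> GRing.comm (g^-1 * q * g) q.
  move=> Pg; apply: (hn E1 _ _ dE1 (SubnormalS sT nY1) ncY1); last first.
    by split; [exact/PE/sX|exact: commr_refl].
  move=> x; apply: generated_comm => // s [r [y [Tr Yy ->]]].
  have [P'r [[Er qr] r0]] := Tr.
  apply: conj_pred_comm; first exact: hD.
  apply: cXY => //.
  have Prg: P (r * g * r^-1) by apply: normal_inV nP _ _.
  have := normal_inV gP nX Xq (usgV gP Prg).
  rewrite invrK invr_conj ?hD // !mulrA.
  rewrite -[r * g^-1 * r^-1 * q * r]mulrA qr !mulrA -[_ * r^-1 * r]mulrA mulVr ?hD //.
  by rewrite mulr1.
pose C z := exists2 g, P g & z = g^-1 * q * g.
have CX z : C z -> X z by move=> [g Pg ->]; have [_ _] := nX; apply.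
have nC : normal_in (generated_by C) P.
  apply: generated_normal => // [s /CX/sX//|s h [g Pg ->] Ph].
  exists (g * h); first exact: usgM.
  by rewrite invrM ?(usgU gP) // !mulrA.
have cC a b : C a -> C b -> GRing.comm a b.
  move=> [g Pg ->] [h Ph ->]; apply: conj_pred_comm; first exact: (usgU gP).
  have -> : h * (g^-1 * q * g) * h^-1 = (g * h^-1)^-1 * q * (g * h^-1).
    by rewrite invrM ?unitrV ?(usgU gP) // invrK !mulrA.
  by apply: key; apply: usgM => //; apply: usgV.
have uC s : C s -> s \is a GRing.unit by move/CX; apply: usgU.
apply: (abelian_subnormal_central hD dE (SubnormalS sP nC)); last first.
  apply: generated_mem; exists 1; first exact: usg1.
  by rewrite invr1 mul1r mulr1.
move=> x y gx gy; apply: generated_comm gy => // t Ct.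
by apply/commr_sym; apply: generated_comm gx => // s Cs; apply: cC.
Qed.

(** The elements with weights on H form a group W normalised by P. Inside P, W
    commutes with the derived group of H, so W and P meet in central elements. This
    propagates up the chain to all of W, because commutators of an element of W with
    P lie in W and one step deeper. *)
Lemma weights_succ n : centralizer_trivial n.+1 -> weights_trivial n.+2.
Proof.
move=> hn E H w dE sH ncH Ew w0 hw.
have gE := nonzero_usg hD dE; have gH := subnormal_usg gE sH.
have [P sP nH] := subnormalE sH; have gP := subnormal_usg gE sP.
have [_ sHP _] := nH.
have PE x : P x -> E x by move/(subnormal_sub sP) => [].
have ncP : noncentral E P by case: ncH => a Ha na; exists a => //; apply: sHP.
have wP := weights_of_centralizer hn dE sP ncP.
pose W v := nonzero_of E v /\ forall h, H h -> central_in E (commutator v h).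
have central_conj z v : central_in E z -> E z -> E v -> v != 0 -> v * z * v^-1 = z.
  by move=> cz Ez Ev v0; rewrite -(cz _ Ev) mulrK ?hD.
have EC x y : E x -> E y -> E (commutator x y).
  by move=> Ex Ey; do ![apply: (dsrM dE)|apply: (dsrV dE)].
have HE x : H x -> E x by move=> Hx; apply/PE/sHP.
have gW : unit_subgroup W.
  split=> [|x y [[Ex x0] hx] [[Ey y0] hy]|x [[Ex x0] hx]|x [[_ /hD]]//].
  - split; first exact: usg1.
    move=> h Hh y Ey; rewrite /commutator invr1 mulr1 mul1r divrr ?(usgU gH) //.
    exact/commr_sym/commr1.
  - split; first exact: usgM.
    move=> h Hh; have -> : commutator (x * y) h =
        (x * commutator y h * x^-1) * commutator x h.
      rewrite /commutator invrM ?hD // !mulrA mulrVK ?hD //.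
      by rewrite mulrVK ?(usgU gH) // .
    rewrite central_conj //; [|exact: hy|by apply: EC => //; apply: HE].
    by move=> z Ez; apply/commr_sym; apply: commrM; apply/commr_sym;
      [apply: hy|apply: hx].
  - split; first exact: usgV.
    move=> h Hh; have -> : commutator x^-1 h =
        x^-1 * (commutator x h)^-1 * x^-1^-1.
      have ux := hD x0; have uh := usgU gH Hh.
      rewrite /commutator invrM ?unitrV ?unitr_conj // invr_conj // !invrK !mulrA.
      by rewrite mulrVK.
    have cV: central_in E (commutator x h)^-1.
      by move=> z Ez; apply/commr_sym/commrV/commr_sym/hx.
    rewrite central_conj ?invr_eq0 //; last exact: dsrV.
    by apply: (dsrV dE); apply: EC => //; apply: HE.
have nW h v : P h -> W v -> W (h * v * h^-1).
  move=> Ph [[Ev v0] hv]; have uh := usgU gP Ph.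
  have h0 : h != 0 by rewrite -div_unitE.
  split.
    have Eh := PE _ Ph; split; last by rewrite -div_unitE // unitr_conj // hD.
    by do ![apply: (dsrM dE)|apply: (dsrV dE)].
  move=> k Hk; have -> : k = h * (h^-1 * k * h) * h^-1.
    by rewrite !mulrA mulrV // mul1r mulrK.
  have Hk' : H (h^-1 * k * h) by have [_ _] := nH; apply.
  rewrite commutator_conj // central_conj //; [exact: hv|exact: hv| |exact: PE].
  by apply: EC => //; apply: HE.
have nWP : normal_in (meet_pred W P) P.
  split; [exact: meet_usg|by move=> x []|move=> x y [Wx Px] Py; split].
    by rewrite -{2}[y]invrK; apply: nW => //; apply: usgV.
  by do ![apply: (usgM gP) => //]; apply: usgV.
have base v : W v -> P v -> central_in E v.
  move=> Wv Pv; apply: (commuting_normal_central hn dE sP nWP (derived_normal gP nH));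
    last by split.
  - move=> x y [[[Ex x0] hx] Px] dy.
    exact: (derived_comm_center gH dE HE Ex x0 hx dy).
  - exact: derived_noncentral sH ncH.
have step m Q : unit_subgroup Q -> subnormal_in Q m P ->
    forall v, W v -> Q v -> central_in E v.
  elim: m Q => [|m IH] Q gQ sPQ v Wv Qv.
    by apply: base => //; apply/(subnormalE sPQ).
  have [Q1 nQ1 sP1] := subnormal_top gQ sPQ; have [gQ1 sQ1 _] := nQ1.
  have [[Ev v0] _] := Wv.
  apply: wP => // h Ph; apply: (IH Q1) => //.
    have Wc : W (commutator v h).
      have -> : commutator v h = v * (h * v^-1 * h^-1) by rewrite /commutator !mulrA.
      apply: (usgM gW) => //.
      by apply: nW => //; apply: usgV.
    exact: Wc.
  apply: (commutator_normalr gQ) => //.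
  exact: (subnormal_sub sP1).
exact: (step _ _ gE sP w).
Qed.

(** Go down in one of the two chains at a time. If N meets the group H' above H in a
    noncentral x but N and H meet in central elements, then x has central
    commutators with the group of elements common to H and to the group above N.
    That group is noncentral by induction, so x is central after all. *)
Lemma meet_noncentral n E : weights_trivial n -> division_subring E ->
  forall i j N H, (i <= n)%N -> (j <= n)%N ->
  subnormal_in (nonzero_of E) i N -> subnormal_in (nonzero_of E) j H ->
  noncentral E N -> noncentral E H -> noncentral E (meet_pred N H).
Proof.
move=> hn dE i j; have [k] := ubnP (i + j)%N.
have gE := nonzero_usg hD dE.
elim: k i j => // k IH [|i] [|j] lk N H li lj sN sH ncN ncH.
- by case: ncH => a Ha na; exists a => //; split=> //; apply/(subnormalE sN)/(subnormalE sH).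
- by case: ncH => a Ha na; exists a => //; split=> //; apply/(subnormalE sN); exact: (subnormal_sub sH Ha).
- by case: ncN => a Na na; exists a => //; split=> //; apply/(subnormalE sH); exact: (subnormal_sub sN Na).
have [N' sN' nN] := subnormalE sN; have [H' sH' nH] := subnormalE sH.
have gN' := subnormal_usg gE sN'; have gH' := subnormal_usg gE sH'.
have [_ sNN' _] := nN; have [_ sHH' _] := nH.
have ncN' : noncentral E N' by case: ncN => a Na na; exists a => //; apply: sNN'.
have ncH' : noncentral E H' by case: ncH => a Na na; exists a => //; apply: sHH'.
have [] // : noncentral E (meet_pred N H').
  apply: (IH i.+1 j) => //; last exact: ltnW.
  by move: lk; rewrite addnS ltnS.
have ncY : noncentral E (meet_pred N' H).
  by apply: (IH i j.+1) => //; exact: ltnW.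
move=> x [Nx H'x] nx; apply: contrapT => /noncentralPn cNH; apply: nx.
have sY : subnormal_in (nonzero_of E) n (meet_pred N' H).
  by apply: subnormal_meet; [apply: subnormal_leq sN'|apply: subnormal_leq sH] => //; exact: ltnW.
have [Ex x0] := subnormal_sub sN Nx.
apply: (hn _ _ _ dE sY) => // h [N'h Hh]; apply: cNH; split.
  exact: commutator_normal nN _ _.
exact: (commutator_normalr gH' nH).
Qed.

(** An element q of N whose conjugates by y and by 1 + y lie in N too satisfies the
    assumptions of [additive_step]: if c does not commute with y, then q does. Such
    q form an intersection of three noncentral subnormal subgroups, so y is central
    by the weights of this intersection. *)
Lemma centralizer_succ n : centralizer_trivial n.+1 -> centralizer_trivial n.+2.
Proof.
move=> hn E N c dE sN ncN cN; have gE := nonzero_usg hD dE.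
have wn := weights_succ hn.
have key y : E y -> GRing.comm c y \/ central_in E y.
  move=> Ey; have [->|y0] := eqVneq y 0; first by left; exact: commr0.
  have [e|y1] := eqVneq (1 + y) 0.
    left; have -> : y = -1 by apply/eqP; rewrite -addr_eq0 addrC e.
    exact/commrN/commr1.
  apply: contrapT => /not_orP[ncy ncen]; apply: ncen.
  have E1y : E (1 + y) by apply: dsrD => //; apply: dsr1.
  have nzy : nonzero_of E y by [].
  have nz1y : nonzero_of E (1 + y) by [].
  have nc_conj z : nonzero_of E z -> noncentral E (conj_pred z N).
    move=> [Ez z0]; case: ncN => a Na na; exists (z^-1 * a * z).
      by rewrite /conj_pred !mulrA mulrV ?hD // mul1r mulrK ?hD.
    move=> cz; apply: na => t Et.
    have := cz (z^-1 * t * z) _; rewrite /GRing.comm.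
    have Ezt : E (z^-1 * t * z) by do ![apply: (dsrM dE)|apply: (dsrV dE)].
    move=> /(_ Ezt) e.
    have {e}: z * (z^-1 * a * z * (z^-1 * t * z)) * z^-1 =
              z * (z^-1 * t * z * (z^-1 * a * z)) * z^-1 by rewrite e.
    by rewrite !mulrA !mulrV ?hD // !mul1r !mulrK ?hD // .
  have sy := subnormal_conj gE nzy sN; have s1y := subnormal_conj gE nz1y sN.
  pose J := meet_pred N (meet_pred (conj_pred y N) (conj_pred (1 + y) N)).
  have sJ' := subnormal_meet sy s1y; have sJ := subnormal_meet sN sJ'.
  have ncJ : noncentral E J.
    apply: (meet_noncentral wn dE (leqnn _) (leqnn _) sN sJ') => //.
    by apply: (meet_noncentral wn dE (leqnn _) (leqnn _) sy s1y) => //; exact: nc_conj.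
  apply: (wn _ _ _ dE sJ ncJ Ey y0) => q [Nq [Nyq N1q]] t Et.
  have cyq : GRing.comm q y.
    case: (@additive_step _ hD c q (y * q * y^-1) ((1 + y) * q * (1 + y)^-1) y) => //.
    - exact: cN.
    - exact: cN.
    - exact: cN.
    - by rewrite mulrVK ?hD.
    - by rewrite mulrVK ?hD.
  have q0: q \is a GRing.unit by have [_ /hD] := subnormal_sub sN Nq.
  have -> : commutator y q = 1.
    by rewrite /commutator -cyq mulrK ?hD // divrr.
  exact/commr_sym/commr1.
move=> y Ey; case: (key y Ey) => // cy; case: ncN => a Na na.
have [Ea a0] := subnormal_sub sN Na; have ca := cN _ Na.
have [y0|y0] := eqVneq y 0; first by rewrite y0; exact: commr0.
case: (key (y * a)) => [|h|h]; first exact: dsrM.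
  rewrite -(mulrK (hD a0) y); apply: commrM => //; exact: commrV.
case: na => t Et; rewrite -(mulKr (hD y0) a); apply/commr_sym; apply: commrM.
  by apply: commrV; apply/commr_sym/cy.
exact/commr_sym/h.
Qed.

Lemma centralizer_all n : centralizer_trivial n.+1.
Proof.
elim: n => [|n IH]; last exact: centralizer_succ.
move=> E N c dE /subnormalE[H sH nN] ncN cN.
apply: (centralizer_normal hD dE) cN => //.
by apply: normal_ext nN => x; apply: (subnormalE sH).
Qed.

Lemma subnormal_weight_central E n N w : division_subring E ->
  subnormal_in (nonzero_of E) n N -> noncentral E N -> E w -> w != 0 ->
  (forall h, N h -> central_in E (commutator w h)) -> central_in E w.
Proof.
move=> dE sN; apply: (weights_of_centralizer (@centralizer_all n)) => //.
by apply: subnormal_pad => //; apply: nonzero_usg.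
Qed.

End SubnormalDivision.

(** * Transvections *)

Section Transvections.
Variable R : unitRingType.
Implicit Types (a b c d p q r s u x y : R).
Variables (B : R -> Prop) (e : R).

(** A prime ring B with an idempotent e for which e B e is a division ring, as in a
    matrix ring over a division ring with e of rank one. B is a subset of the
    ambient ring because it will vary among local subrings while the group of units
    stays fixed. *)
Record minimal_corner : Prop := MinimalCorner {
  mcB1 : B 1;
  mcBB : forall x y, B x -> B y -> B (x - y);
  mcBM : forall x y, B x -> B y -> B (x * y);
  mc_prime : forall x y, B x -> B y ->
    (forall b, B b -> x * b * y = 0) -> x = 0 \/ y = 0;
  mc_e : B e;
  mc_idem : e * e = e;
  mc_e0 : e != 0;
  mc_e1 : e != 1;
  mc_div : forall b, B b -> e * b * e != 0 -> exists c,
    [/\ B c, (e * c * e) * (e * b * e) = e & (e * b * e) * (e * c * e) = e] }.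

Hypothesis mc : minimal_corner.

Let B1 := mcB1 mc.
Let BB := mcBB mc.
Let BM := mcBM mc.
Let Be := mc_e mc.
Let ee := mc_idem mc.

(** The columns B e and the rows e B are a right and a left vector space over the
    division ring e B e, in duality by multiplication. *)
Definition column p := B p /\ p * e = p.
Definition row q := B q /\ e * q = q.
Definition corner d := [/\ B d, e * d = d & d * e = d].

Lemma mcB0 : B 0. Proof. by rewrite -(subrr 1); apply: BB. Qed.
Lemma mcBN x : B x -> B (- x). Proof. by move=> Bx; rewrite -sub0r; apply: BB => //; apply: mcB0. Qed.
Lemma mcBD x y : B x -> B y -> B (x + y).
Proof. by move=> Bx By; rewrite -[y]opprK; apply: BB => //; apply: mcBN. Qed.

Lemma columnB p p' : column p -> column p' -> column (p - p').
Proof. by move=> [Bp pe] [Bp' pe']; split; [exact: BB|rewrite mulrBl pe pe']. Qed.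
Lemma columnD p p' : column p -> column p' -> column (p + p').
Proof. by move=> [Bp pe] [Bp' pe']; split; [exact: mcBD|rewrite mulrDl pe pe']. Qed.
Lemma rowB q q' : row q -> row q' -> row (q - q').
Proof. by move=> [Bq eq] [Bq' eq']; split; [exact: BB|rewrite mulrBr eq eq']. Qed.
Lemma rowD q q' : row q -> row q' -> row (q + q').
Proof. by move=> [Bq eq] [Bq' eq']; split; [exact: mcBD|rewrite mulrDr eq eq']. Qed.
Lemma column_mul b p : B b -> column p -> column (b * p).
Proof. by move=> Bb [Bp pe]; split; [exact: BM|rewrite -mulrA pe]. Qed.
Lemma row_mul q b : B b -> row q -> row (q * b).
Proof. by move=> Bb [Bq eq]; split; [exact: BM|rewrite mulrA eq]. Qed.
Lemma pairing q p : row q -> column p -> corner (q * p).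
Proof. by move=> [Bq eq] [Bp pe]; split; [exact: BM|rewrite mulrA eq|rewrite -mulrA pe]. Qed.
Lemma column_corner p d : column p -> corner d -> column (p * d).
Proof. by move=> [Bp pe] [Bd ed de]; split; [exact: BM|rewrite -mulrA de]. Qed.
Lemma corner_row q d : row q -> corner d -> row (d * q).
Proof. by move=> [Bq eq] [Bd ed de]; split; [exact: BM|rewrite mulrA ed]. Qed.
Lemma column_e : column e. Proof. by []. Qed.
Lemma corner_e : corner e. Proof. by []. Qed.

Lemma corner_inv d : corner d -> d != 0 ->
  exists c, [/\ corner c, c * d = e & d * c = e].
Proof.
move=> [Bd ed de] d0; have ede : e * d * e = d by rewrite ed de.
have [|c [Bc e1 e2]] := mc_div mc Bd; first by rewrite ede.
exists (e * c * e); rewrite ede in e1 e2; split=> //.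
by split; [do ![apply: BM]|rewrite !mulrA ee|rewrite -mulrA ee].
Qed.

Lemma row_dual q : row q -> q != 0 -> exists2 p, column p & q * p = e.
Proof.
move=> rq q0; have [Bq eq] := rq.
have [b Bb nz] : exists2 b, B b & q * b * e != 0.
  apply: contrapT => h; have [||] := mc_prime mc Bq Be; last first.
  - by move/eqP: (mc_e0 mc).
  - by move/eqP: q0.
  by move=> b Bb; apply/eqP; apply: contrapT => /negP nb; apply: h; exists b.
have cbe : column (b * e) by apply: column_mul.
have [c [cc _ e2]] := corner_inv (pairing rq cbe) (eq_ind_r (fun x => x != 0) nz (mulrA q b e)).
by exists (b * e * c); [exact: column_corner|rewrite mulrA].
Qed.

Lemma column_dual p : column p -> p != 0 -> exists2 q, row q & q * p = e.
Proof.
move=> cp p0; have [Bp pe] := cp.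
have [b Bb nz] : exists2 b, B b & e * b * p != 0.
  apply: contrapT => h; have [||] := mc_prime mc Be Bp; last first.
  - by move/eqP: p0.
  - by move/eqP: (mc_e0 mc).
  by move=> b Bb; apply/eqP; apply: contrapT => /negP nb; apply: h; exists b.
have rbe : row (e * b) by apply: row_mul.
have [c [cc e1 _]] := corner_inv (pairing rbe cp) nz.
by exists (c * (e * b)); [exact: corner_row|rewrite -mulrA].
Qed.

(** Correct a row dual to the component of p' outside p so that it vanishes on p. *)
Lemma column_separate p p' : column p -> column p' -> p != 0 ->
  (forall d, corner d -> p' <> p * d) ->
  exists q, [/\ row q, q * p = 0 & q * p' = e].
Proof.
move=> cp cp' p0 np; have [q0 rq0 e0] := column_dual cp p0.
have cq : corner (q0 * p') by apply: pairing.
have [|q1 rq1 e1] := column_dual (columnB cp' (column_corner cp cq)).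
  by rewrite subr_eq0; apply/eqP/np.
exists (q1 - q1 * p * q0); split.
- by apply: rowB => //; apply: corner_row => //; apply: pairing.
- by rewrite mulrBl -[_ * q0 * p]mulrA e0 -mulrA; case: cp => _ ->; rewrite subrr.
- by rewrite mulrBl -!mulrA -mulrBr.
Qed.

Lemma row_separate q q' : row q -> row q' -> q != 0 ->
  (forall d, corner d -> q' <> d * q) ->
  exists p, [/\ column p, q * p = 0 & q' * p = e].
Proof.
move=> rq rq' q0 nq; have [p0 cp0 e0] := row_dual rq q0.
have cq : corner (q' * p0) by apply: pairing.
have [|p1 cp1 e1] := row_dual (rowB rq' (corner_row rq cq)).
  by rewrite subr_eq0; apply/eqP/nq.
exists (p1 - p0 * (q * p1)); split.
- by apply: columnB => //; apply: column_corner => //; apply: pairing.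
- by rewrite mulrBr !mulrA e0; case: rq => _ ->; rewrite subrr.
- by rewrite mulrBr !mulrA -mulrBl.
Qed.

(** Since e is not 1, the dimension is at least 2. *)
Lemma independent_from_e : exists2 p, column p & forall d, corner d -> p <> e * d.
Proof.
have B1e : B (1 - e) by apply: BB.
have [b Bb nz] : exists2 b, B b & (1 - e) * b * e != 0.
  apply: contrapT => h; have [||] := mc_prime mc B1e Be; last first.
  - by move/eqP: (mc_e0 mc).
  - by move/eqP; rewrite subr_eq0 eq_sym; apply/negP/(mc_e1 mc).
  by move=> b Bb; apply/eqP; apply: contrapT => /negP nb; apply: h; exists b.
exists ((1 - e) * b * e); first by apply: column_mul => //; exact: BM.
move=> d [_ ed _] h; move/eqP: nz; apply.
have : e * ((1 - e) * b * e) = 0 by rewrite !mulrA mulrBr mulr1 ee subrr !mul0r.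
by rewrite h !mulrA ee ed.
Qed.

Lemma annihilating_row p : column p -> p != 0 ->
  exists q, [/\ row q, q * p = 0 & q != 0].
Proof.
move=> cp p0.
have [p' cp' np'] : exists2 p', column p' & forall d, corner d -> p' <> p * d.
  apply: contrapT => h.
  have {}h p' : column p' -> exists2 d, corner d & p' = p * d.
    move=> cp'; apply: contrapT => h2; apply: h; exists p' => // d cd ed.
    by apply: h2; exists d.
  have [p1 cp1 np1] := independent_from_e.
  have [d cd ed] := h _ column_e; have [d1 cd1 ed1] := h _ cp1.
  have d0 : d != 0 by apply: contra_neq (mc_e0 mc) => d0; rewrite ed d0 mulr0.
  have [c [cc _ dc]] := corner_inv cd d0.
  have pe : p = e * c by rewrite ed -mulrA dc; case: cp.
  apply: (np1 (c * d1)); last by rewrite ed1 pe mulrA.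
  case: cc => ? ? ?; case: cd1 => ? ? ?; split; first exact: BM.
  - by rewrite mulrA; congr (_ * _).
  - by rewrite -mulrA; congr (_ * _).
have [q [rq q1 q2]] := column_separate cp cp' p0 np'.
exists q; split=> //; apply: contra_neq (mc_e0 mc) => q0.
by rewrite -q2 q0 mul0r.
Qed.

(** A linear map that preserves every line is a homothety, and the ring acts
    faithfully on columns because it is prime. *)
Lemma scalar_on_columns a : B a ->
  (forall p, column p -> exists2 d, corner d & a * p = p * d) ->
  forall b, B b -> GRing.comm a b.
Proof.
move=> Ba h; have [l cl el] := h _ column_e; have [_ ell lel] := cl.
have indep p : column p -> (forall d, corner d -> p <> e * d) -> a * p = p * l.
  move=> cp np; have [m cm em] := h _ cp; have [k ck ek] := h _ (columnD column_e cp).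
  have [_ ekk _] := ck.
  have e3 : e * (k - l) = p * (m - k).
    apply/eqP; rewrite -subr_eq0; apply/eqP.
    transitivity ((e + p) * k - (e * l + p * m)); first by ncring.
    by rewrite -ek mulrDr el em subrr.
  have [mk|mk] := eqVneq m k.
    rewrite em mk; move: e3; rewrite mk subrr mulr0 mulrBr ekk ell => /eqP.
    by rewrite subr_eq0 => /eqP ->.
  have cmk : corner (m - k).
    by case: cm ck => ? ? ? [? ? ?]; split; [exact: BB|rewrite mulrBr; congr (_ - _)|rewrite mulrBl; congr (_ - _)].
  have ckl : corner (k - l).
    by case: cl ck => ? ? ? [? ? ?]; split; [exact: BB|rewrite mulrBr; congr (_ - _)|rewrite mulrBl; congr (_ - _)].
  have [|c [cc _ mc']] := corner_inv cmk; first by rewrite subr_eq0.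
  case: (np ((k - l) * c)); last by rewrite mulrA e3 -mulrA mc'; case: cp.
  case: cc ckl => ? ? ? [? ? ?]; split; first exact: BM.
  - by rewrite mulrA; congr (_ * _).
  - by rewrite -mulrA; congr (_ * _).
have [p1 cp1 np1] := independent_from_e.
have all p : column p -> a * p = p * l.
  move=> cp; have [np|/existsNP[d /not_implyP[cd /contrapT pd]]] :=
    pselect (forall d, corner d -> p <> e * d); first exact: indep.
  have np : forall d, corner d -> p1 + p <> e * d.
    move=> d' cd' e2; apply: (np1 (d' - d)).
      by case: cd cd' => ? ? ? [? ? ?]; split; [exact: BB|rewrite mulrBr; congr (_ - _)|rewrite mulrBl; congr (_ - _)].
    by rewrite mulrBr -e2 -pd addrK.
  have := indep _ (columnD cp1 cp) np; rewrite mulrDr mulrDl (indep _ cp1 np1).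
  by move/addrI.
move=> b Bb; have Bab : B (a * b - b * a) by apply: BB; exact: BM.
have [|h0|/eqP h0] := mc_prime mc Bab Be.
- move=> c Bc; rewrite -mulrA mulrBl -[a * b * _]mulrA -[b * a * _]mulrA.
  have cce : column (c * e) by exact: column_mul.
  by rewrite (all _ cce) (all _ (column_mul Bb cce)) [b * (_ * l)]mulrA subrr.
- by apply/eqP; rewrite -subr_eq0 h0.
- by case/negP: (mc_e0 mc).
Qed.

Lemma square_zero_inv u : u * u = 0 -> (1 + u) * (1 - u) = 1.
Proof.
move=> u2; transitivity (1 - u * u); first by ncring.
by rewrite u2 subr0.
Qed.

Lemma square_zero_unit u : u * u = 0 ->
  (1 + u) \is a GRing.unit /\ (1 + u)^-1 = 1 - u.
Proof.
move=> u2; have e1 := square_zero_inv u2.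
have e2 : (1 - u) * (1 + u) = 1.
  by transitivity (1 - u * u); [ncring|rewrite u2 subr0].
have un : 1 + u \is a GRing.unit by apply/unitrP; exists (1 - u).
by split=> //; apply: (mulrI un); rewrite divrr // e1.
Qed.

Lemma square_zeroM p q : q * p = 0 -> (p * q) * (p * q) = 0.
Proof. by move=> h; rewrite -mulrA [q * _]mulrA h mul0r mulr0. Qed.

(** The Steinberg relation between two incident elementary elements. *)
Lemma elementary_commutator x y : x * x = 0 -> y * y = 0 -> y * x = 0 ->
  (1 + x) * (1 + y) * (1 - x) * (1 - y) = 1 + x * y.
Proof.
move=> x2 y2 yx.
transitivity (1 + x * y - x * x - y * x - y * y + x * x * y + y * x * y - x * (y * x)
   + x * (y * x) * y - x * (y * y)); first by ncring.
by rewrite x2 y2 yx !mul0r !mulr0 !mul0r !subr0 !addr0.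
Qed.

(** A scalar different from 0, 1 and -1. The diagonal matrix with entries dl and
    dl^-1 acts on a root group by the factor dl^2, which differs from 1. *)
Variable dl : R.
Hypothesis dlU : dl \is a GRing.unit.
Hypothesis dlC : forall x, GRing.comm dl x.
Hypothesis dl2U : dl * dl - 1 \is a GRing.unit.
Hypothesis Bdl : B dl.
Hypothesis BdlV : B dl^-1.
Hypothesis Bdl2V : B (dl * dl - 1)^-1.

Variable N : R -> Prop.
Hypothesis gN : unit_subgroup N.
(** Only conjugation by transvections is required of N; this allows groups N of
    units of the ambient ring that B knows nothing about. *)
Hypothesis nN : forall p q x, column p -> row q -> q * p = 0 -> N x ->
  N ((1 + p * q) * x * (1 - p * q)).

(** The incident pair (p, q) is recorded together with the fact that its whole root
    group, the elements 1 + p d q for d in the corner, lies in N. *)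
Definition root_group p q :=
  [/\ column p, row q, p != 0, q != 0 & q * p = 0 /\
      forall d, corner d -> N (1 + p * d * q)].

Lemma incident_corner p q d : corner d -> q * p = 0 ->
  row q -> (q * (p * d) = 0) /\ ((d * q) * p = 0).
Proof. by move=> cd h rq; rewrite mulrA h mul0r -mulrA h mulr0. Qed.

Lemma commutator_in p q x y : column p -> row q -> q * p = 0 -> x * x = 0 ->
  N (1 + x) -> N ((1 + p * q) * (1 + x) * (1 - p * q) * (1 - x)).
Proof.
move=> cp rq qp x2 Nx; apply: (usgM gN); first exact: nN.
by have [_ <-] := square_zero_unit x2; apply: usgV.
Qed.

(** A commutator of 1 + p d q with 1 + r q', where q' r = 0 and q r = e, is 1 + p d
    q'. *)
Lemma root_group_row p q q' : root_group p q -> row q' -> q' != 0 -> q' * p = 0 ->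
  root_group p q'.
Proof.
move=> [cp rq p0 q0 [qp Nd]] rq' q'0 q'p; split=> //; split=> // d cd.
have [hn|/existsNP[c /not_implyP[cc /contrapT qe]]] :=
  pselect (forall c, corner c -> q <> c * q'); last first.
  have c0 : c != 0 by apply: contra_neq q0 => c0; rewrite qe c0 mul0r.
  have [c' [cc' c'c _]] := corner_inv cc c0.
  have -> : q' = c' * q by rewrite qe mulrA c'c; case: rq'.
  have -> : p * d * (c' * q) = p * (d * c') * q by rewrite !mulrA.
  apply: Nd; case: cd cc' => ? ? ? [? ? ?]; split; first exact: BM.
  - by rewrite mulrA; congr (_ * _).
  - by rewrite -mulrA; congr (_ * _).
have [r [cr q'r qr]] := row_separate rq' rq q'0 hn.
have cpd : column (p * d) by apply: column_corner.
have [qpd _] := incident_corner cd qp rq.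
have x2 : p * d * q * (p * d * q) = 0 by apply: square_zeroM.
have y2 : (r * q') * (r * q') = 0 by apply: square_zeroM.
have yx : r * q' * (p * d * q) = 0.
  by rewrite -[r * q' * _]mulrA !mulrA -[r * q' * p]mulrA q'p mulr0 !mul0r.
have := elementary_commutator x2 y2 yx.
have -> : p * d * q * (r * q') = p * d * q'.
  rewrite -mulrA [q * _]mulrA qr; case: cd => _ _ de.
  by rewrite !mulrA -[p * d * e]mulrA de.
have Nx := Nd _ cd; have [_ Vx] := square_zero_unit x2.
have := nN cr rq' q'r (usgV gN Nx); rewrite Vx => Ny <-.
by move: (usgM gN Nx Ny); rewrite !(mulrA (1 + p * d * q)).
Qed.

Lemma root_group_column p q p' : root_group p q -> column p' -> p' != 0 ->
  q * p' = 0 -> root_group p' q.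
Proof.
move=> [cp rq p0 q0 [qp Nd]] cp' p'0 qp'; split=> //; split=> // d cd.
have [hn|/existsNP[c /not_implyP[cc /contrapT pe]]] :=
  pselect (forall c, corner c -> p <> p' * c); last first.
  have c0 : c != 0 by apply: contra_neq p0 => c0; rewrite pe c0 mulr0.
  have [c' [cc' _ cc'e]] := corner_inv cc c0.
  have -> : p' = p * c' by rewrite pe -mulrA cc'e; case: cp'.
  have -> : p * c' * d * q = p * (c' * d) * q by rewrite !mulrA.
  apply: Nd; case: cd cc' => ? ? ? [? ? ?]; split; first exact: BM.
  - by rewrite mulrA; congr (_ * _).
  - by rewrite -mulrA; congr (_ * _).
have [s [rs sp' sp]] := column_separate cp' cp p'0 hn.
have cpd : column (p * d) by apply: column_corner.
have [qpd _] := incident_corner cd qp rq.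
have x2 : p * d * q * (p * d * q) = 0 by apply: square_zeroM.
have y2 : (p' * s) * (p' * s) = 0 by apply: square_zeroM.
have yx : p * d * q * (p' * s) = 0.
  by rewrite -[_ * q * _]mulrA [q * _]mulrA qp' mul0r mulr0.
have := elementary_commutator y2 x2 yx.
have -> : p' * s * (p * d * q) = p' * d * q.
  rewrite -[p' * s * _]mulrA !mulrA -[p' * s * p]mulrA sp.
  by case: cp' => _ ->.
by move=> <-; apply: commutator_in => //; exact: Nd.
Qed.

(** First move the column. Transvections permute the nonzero columns transitively: 1
    + r s with r = p' - p takes p to p' when s p = s p' = e. Then change the row
    with [root_group_row]. *)
Lemma root_group_all p q : root_group p q -> forall p' q', column p' -> row q' ->
  q' * p' = 0 -> N (1 + p' * q').
Proof.
move=> rg p' q' cp' rq' qp'.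
have [->|p'0] := eqVneq p' 0; first by rewrite mul0r addr0; apply: usg1.
have [->|q'0] := eqVneq q' 0; first by rewrite mulr0 addr0; apply: usg1.
suff [q2 rg2] : exists q2, root_group p' q2.
  have [_ _ _ _ [_ h]] := root_group_row rg2 rq' q'0 qp'.
  by have := h _ corner_e; case: cp' => _ ->.
have [cp rq p0 q0 [qp Nd]] := rg.
have [hn|/existsNP[c /not_implyP[cc /contrapT pe]]] :=
  pselect (forall c, corner c -> p' <> p * c); last first.
  exists q; apply: root_group_column rg _ _ _ => //.
  by rewrite pe mulrA qp mul0r.
have [s2 [rs2 s2p s2p']] := column_separate cp cp' p0 hn.
have hn' c : corner c -> p <> p' * c.
  move=> cc pe; have c0 : c != 0 by apply: contra_neq p0 => c0; rewrite pe c0 mulr0.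
  have [c' [cc' _ cc'e]] := corner_inv cc c0.
  by apply: (hn c' cc'); rewrite pe -mulrA cc'e; case: cp'.
have [s1 [rs1 s1p' s1p]] := column_separate cp' cp p'0 hn'.
pose s := s1 + s2; pose r := p' - p.
have sp : s * p = e by rewrite mulrDl s1p s2p addr0.
have sp' : s * p' = e by rewrite mulrDl s1p' s2p' add0r.
have sr : s * r = 0 by rewrite mulrBr sp sp' subrr.
have cr : column r by apply: columnB.
have rs : row s by apply: rowD.
have r2 := square_zeroM sr; have [ut Vt] := square_zero_unit r2.
have tp : (1 + r * s) * p = p'.
  by rewrite mulrDl mul1r -mulrA sp; case: cr => _ ->; rewrite addrC subrK.
exists (q * (1 - r * s)).
have rq2 : row (q * (1 - r * s)).
  apply: row_mul => //; apply: BB => //; apply: BM; [by case: cr|by case: rs].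
split=> //.
  apply: contra_neq q0 => h.
  by rewrite -[q](mulrK (_ : 1 - r * s \is a GRing.unit)) ?h ?mul0r // -Vt unitrV.
split=> [|d cd].
  rewrite -tp -mulrA [(1 - _) * _]mulrA -Vt mulVr // mul1r //.
have -> : 1 + p' * d * (q * (1 - r * s)) =
    (1 + r * s) * (1 + p * d * q) * (1 - r * s).
  transitivity ((1 + r * s) * (1 - r * s) + (1 + r * s) * p * d * (q * (1 - r * s))).
    by rewrite square_zero_inv // tp.
  by ncring.
apply: nN => //; exact: Nd.
Qed.

(** The plane spanned by p and p2, on which q2 p2 = q p = 0 and q p2 = e. M is a
    group that contains both root groups and whose commutators fall in N. *)
Section Plane.
Variables (p q p2 q2 k k' : R) (M : R -> Prop).
Hypotheses (cp : column p) (rq : row q) (cp2 : column p2).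
Hypotheses (qp : q * p = 0) (qp2 : q * p2 = e) (q2p2 : q2 * p2 = 0) (q2p : q2 * p = k).
Hypotheses (ck' : corner k') (k'k : k' * k = e).
Hypothesis gM : unit_subgroup M.
Hypothesis M12 : forall d, corner d -> M (1 + p * d * q).
Hypothesis M21 : forall d, corner d -> M (1 + p2 * d * q2).
Hypothesis MN : forall x y, M x -> M y -> N (x * y * x^-1 * y^-1).

Let pe : p * e = p. Proof. by case: cp. Qed.
Let eq : e * q = q. Proof. by case: rq. Qed.
Let p2e : p2 * e = p2. Proof. by case: cp2. Qed.
Let dlV x : GRing.comm dl^-1 x.
Proof. exact/commr_sym/commrV/commr_sym/dlC. Qed.

Let x12 t := 1 + p * (t * e) * q.
Let x21 t := 1 + p2 * (t * k') * q2.

Lemma central_corner t d : B t -> (forall x, GRing.comm t x) -> corner d ->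
  corner (t * d).
Proof.
move=> Bt ct [Bd ed de]; split; first exact: BM.
- by rewrite mulrA -ct -mulrA ed.
- by rewrite -mulrA de.
Qed.

(** The word h in the two root groups is the classical expression of the diagonal
    matrix with entries dl and dl^-1 by elementary ones. Its commutator with 1 + p
    d' q is 1 + (dl^2 - 1) p d' q. *)
Lemma plane_root_group d : corner d -> N (1 + p * d * q).
Proof.
move=> cd.
have dlN x : GRing.comm (- dl^-1) x by apply/commr_sym/commrN/commr_sym/dlV.
have dl1 x : GRing.comm (dl - 1) x.
  by apply/commr_sym/commrB; [apply/commr_sym/dlC|exact: commr1].
have c1 x : GRing.comm 1 x by exact/commr_sym/commr1.
have cN1 x : GRing.comm (- 1) x by apply/commr_sym/commrN/commr1.
have m12 t : B t -> (forall x, GRing.comm t x) -> M (x12 t).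
  by move=> Bt ct; apply: M12; apply: central_corner.
have m21 t : B t -> (forall x, GRing.comm t x) -> M (x21 t).
  by move=> Bt ct; apply: M21; apply: central_corner.
pose h := x12 dl * x21 (- dl^-1) * x12 (dl - 1) * x21 1 * x12 (- 1).
have Mh : M h.
  have h1 := m12 _ Bdl dlC; have h2 := m21 _ (mcBN BdlV) dlN.
  have h3 := m12 _ (BB Bdl B1) dl1; have h4 := m21 _ B1 c1.
  have h5 := m12 _ (mcBN B1) cN1.
  exact: (usgM gM (usgM gM (usgM gM (usgM gM h1 h2) h3) h4) h5).
have a12p t : x12 t * p = p by rewrite /x12 mulrDl mul1r -mulrA qp mulr0 addr0.
have a12p2 t : (forall x, GRing.comm t x) -> x12 t * p2 = p2 + t * p.
  move=> ct; rewrite /x12 mulrDl mul1r -!mulrA qp2 -[e * e]/(e * e) ee.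
  by rewrite mulrA -ct -mulrA pe.
have a21p2 t : x21 t * p2 = p2 by rewrite /x21 mulrDl mul1r -mulrA q2p2 mulr0 addr0.
have a21p t : (forall x, GRing.comm t x) -> x21 t * p = p + t * p2.
  move=> ct; rewrite /x21 mulrDl mul1r -!mulrA q2p k'k.
  by rewrite mulrA -ct -mulrA p2e.
have hp : h * p = dl * p.
  have s2 : x21 1 * p = p + p2 by rewrite a21p // mul1r.
  have s3 : x12 (dl - 1) * (p + p2) = dl * p + p2.
    rewrite mulrDr a12p a12p2 //.
    by transitivity (dl * p + p2); first ncring.
  have s4 : x21 (- dl^-1) * (dl * p + p2) = dl * p.
    rewrite mulrDr a21p2 mulrA -dlC -mulrA a21p //.
    transitivity (dl * p + (1 - dl * dl^-1) * p2); first by ncring.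
    by rewrite divrr // subrr mul0r addr0.
  have s5 : x12 dl * (dl * p) = dl * p by rewrite mulrA -dlC -mulrA a12p.
  by rewrite /h -!mulrA a12p s2 s3 s4 s5.
pose r := k' * q2.
have b12q t : q * x12 t = q.
  by rewrite /x12 mulrDr mulr1 -mulrA mulrA qp mul0r addr0.
have b12r t : (forall x, GRing.comm t x) -> r * x12 t = r + t * q.
  move=> ct; rewrite /x12 mulrDr mulr1; congr (_ + _).
  rewrite /r !mulrA -[k' * q2 * p]mulrA q2p k'k -[e * t]ct -[t * e * e]mulrA ee.
  by rewrite -mulrA eq.
have b21r t : r * x21 t = r.
  by rewrite /x21 /r mulrDr mulr1 !mulrA -[k' * q2 * p2]mulrA q2p2 mulr0 !mul0r addr0.
have b21q t : (forall x, GRing.comm t x) -> q * x21 t = q + t * r.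
  move=> ct; rewrite /x21 mulrDr mulr1 !mulrA qp2; congr (_ + _).
  case: ck' => _ ek' _.
  by rewrite -[e * t]ct -[t * e * k']mulrA ek' /r ?mulrA.
have qh : q * h = dl^-1 * q.
  have s2 : q * x21 (- dl^-1) = q - dl^-1 * r by rewrite b21q // mulNr.
  have s3 : (q - dl^-1 * r) * x12 (dl - 1) = dl^-1 * (q - r).
    rewrite mulrBl b12q -mulrA b12r //.
    transitivity ((1 - dl^-1 * dl) * q + dl^-1 * (q - r)); first by ncring.
    by rewrite mulVr // subrr mul0r add0r.
  have s4 : dl^-1 * (q - r) * x21 1 = dl^-1 * q.
    by rewrite -mulrA mulrBl b21q // b21r mul1r addrK.
  have s5 : dl^-1 * q * x12 (- 1) = dl^-1 * q by rewrite -mulrA b12q.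
  by rewrite /h !mulrA b12q s2 s3 s4 s5.
have uh : h \is a GRing.unit by exact: (usgU gM).
have qhV : q * h^-1 = dl * q.
  by apply: (mulIr uh); rewrite mulrVK // -mulrA qh mulrA divrr // mul1r.
have d2C x : GRing.comm (dl * dl - 1) x.
  apply/commr_sym/commrB; last exact: commr1.
  by apply: commrM; exact/commr_sym/dlC.
have [d' cd' ed'] : exists2 d', corner d' & (dl * dl - 1) * d' = d.
  exists ((dl * dl - 1)^-1 * d); last by rewrite mulrA divrr // mul1r.
  by apply: central_corner => // x; exact/commr_sym/commrV/commr_sym/d2C.
have [qpd _] := incident_corner cd' qp rq.
have [_ Vx] := square_zero_unit (square_zeroM qpd).
have := MN Mh (M12 cd'); rewrite Vx.
have -> : h * (1 + p * d' * q) * h^-1 = 1 + dl * dl * (p * d' * q).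
  rewrite mulrDr mulr1 mulrDl divrr //; congr (_ + _).
  rewrite !mulrA hp -[_ * q * h^-1]mulrA qhV !mulrA -[dl * p * d' * dl]dlC.
  by rewrite !mulrA.
have -> : (1 + dl * dl * (p * d' * q)) * (1 - p * d' * q) =
   1 + (dl * dl - 1) * (p * d' * q) - dl * dl * ((p * d' * q) * (p * d' * q)) by ncring.
rewrite (square_zeroM qpd) mulr0 subr0.
by rewrite !mulrA d2C -[p * _ * d']mulrA ed'.
Qed.

End Plane.

Lemma cornerN d : corner d -> corner (- d).
Proof. by move=> [Bd ed de]; split; [exact: mcBN|rewrite mulrN ed|rewrite mulNr de]. Qed.

Lemma cornerD d d' : corner d -> corner d' -> corner (d + d').
Proof.
move=> [Bd ed de] [Bd' ed' de'].
by split; [exact: mcBD|rewrite mulrDr ed ed'|rewrite mulrDl de de'].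
Qed.

Section RootGroupCosets.
Variables p q : R.
Hypotheses (cp : column p) (rq : row q) (qp : q * p = 0).

Let t d := 1 + p * d * q.

Let tD d d' : t d * t d' = t (d + d').
Proof.
rewrite /t; transitivity (1 + p * (d + d') * q + p * d * (q * p) * d' * q); first by ncring.
by rewrite qp mulr0 !mul0r addr0.
Qed.

Let tV d : t d \is a GRing.unit /\ (t d)^-1 = t (- d).
Proof.
have e1 c : t c * t (- c) = 1 by rewrite tD subrr /t mulr0 mul0r addr0.
have ut : t d \is a GRing.unit.
  by apply/unitrP; exists (t (- d)); split; [rewrite -{2}[d]opprK e1|].
by split=> //; apply: (mulrI ut); rewrite divrr // e1.
Qed.

(** Modulo N the root group of (p, q) is abelian and normalised, so commutators of
    elements of this group lie in N. *)
Definition root_coset x := exists n d, [/\ N n, corner d & x = n * (1 + p * d * q)].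

Let tN d x : corner d -> N x -> N (t d * x * t (- d)).
Proof.
move=> cd Nx; have -> : t (- d) = 1 - p * d * q by rewrite /t mulrN mulNr.
by apply: nN => //; [exact: column_corner|rewrite mulrA qp mul0r].
Qed.

Lemma root_coset_usg : unit_subgroup root_coset.
Proof.
have c0 : corner 0 by split; [exact: mcB0|rewrite mulr0|rewrite mul0r].
split.
- exists 1, 0; split=> //; first exact: usg1.
  by rewrite mulr0 mul0r addr0 mulr1.
- move=> x y [n [d [Nn cd ->]]] [n' [d' [Nn' cd' ->]]].
  exists (n * (t d * n' * t (- d))), (d + d'); split.
  + by apply: usgM => //; exact: tN.
  + exact: cornerD.
  + rewrite -/(t d) -/(t d') -/(t (d + d')) -tD -!mulrA; congr (_ * (_ * (_ * _))).
    by rewrite mulrA tD addNr /t mulr0 mul0r addr0 mul1r.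
- move=> x [n [d [Nn cd ->]]]; have [ut Vt] := tV d.
  exists (t (- d) * n^-1 * t (- - d)), (- d); rewrite ?opprK; split.
  + by rewrite -{2}[d]opprK; apply: tN; [exact: cornerN|exact: usgV].
  + exact: cornerN.
  + rewrite -/(t d) -/(t (- d)) (invrM (usgU gN Nn) ut) Vt -!mulrA tD subrr.
    by rewrite [t 0]/t mulr0 mul0r addr0 mulr1.
- move=> x [n [d [Nn cd ->]]]; have [ut _] := tV d.
  by rewrite unitrMl //; apply: usgU Nn.
Qed.

Lemma root_coset_commutator x y : root_coset x -> root_coset y ->
  N (x * y * x^-1 * y^-1).
Proof.
move=> [n [d [Nn cd ->]]] [n' [d' [Nn' cd' ->]]].
have [ut Vt] := tV d; have [ut' Vt'] := tV d'.
rewrite -/(t d) -/(t d') (invrM (usgU gN Nn) ut) (invrM (usgU gN Nn') ut').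
have -> : n * t d * (n' * t d') * ((t d)^-1 * n^-1) * ((t d')^-1 * n'^-1) =
  n * (t d * n' * t (- d)) * (t d' * n^-1 * t (- d')) * n'^-1.
  rewrite Vt Vt' !mulrA; congr (_ * _ * _ * _).
  by rewrite -!mulrA; congr (_ * (_ * (_ * _))); rewrite !tD addrC.
do 2?apply: (usgM gN) => //; last exact: usgV.
- apply: (usgM gN) => //; exact: tN.
- by apply: tN => //; exact: usgV.
Qed.

End RootGroupCosets.

(** By [scalar_on_columns], a moves some column p off its line, to p2 say.
    Conjugation by a carries the root group of (p, q) to that of (p2, q2), and both
    agree modulo N as a lies in N. If q2 p = 0, their commutators are the root group
    of (p, q2); otherwise p and p2 span a plane as in [plane_root_group]. *)
Lemma noncentral_root_group a : N a -> B a -> B a^-1 ->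
  ~ (forall b, B b -> GRing.comm a b) -> exists p q, root_group p q.
Proof.
move=> Na Ba BaV nca; have ua := usgU gN Na.
have [p cp np] : exists2 p, column p & forall d, corner d -> a * p <> p * d.
  apply: contrapT => h; apply: nca; apply: scalar_on_columns => // p cp.
  apply: contrapT => h2; apply: h; exists p => // d cd e2; apply: h2.
  by exists d.
have c0 : corner 0 by split; [exact: mcB0|rewrite mulr0|rewrite mul0r].
have p0 : p != 0 by apply/eqP => p0; apply: (np 0) => //; rewrite p0 mulr0 mul0r.
pose p2 := a * p; have cp2 : column p2 by apply: column_mul.
have [q [rq qp qp2]] := column_separate cp cp2 p0 np.
have q0 : q != 0 by apply: contra_neq (mc_e0 mc) => q0; rewrite -qp2 q0 mul0r.
pose q2 := q * a^-1; have rq2 : row q2 by apply: row_mul.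
have q2p2 : q2 * p2 = 0 by rewrite /q2 /p2 mulrA mulrVK.
have ck : corner (q2 * p) by apply: pairing.
have conjt d : a * (1 + p * d * q) * a^-1 = 1 + p2 * d * q2.
  by rewrite mulrDr mulr1 mulrDl divrr // !mulrA.
have gM := root_coset_usg cp rq qp.
have M12 d : corner d -> root_coset p q (1 + p * d * q).
  by move=> cd; exists 1, d; split=> //; [exact: usg1|rewrite mul1r].
have unt d : corner d -> [/\ (1 + p * d * q) \is a GRing.unit,
    (1 + p * d * q)^-1 = 1 - p * d * q & N ((1 + p * d * q) * a^-1 * (1 - p * d * q))].
  move=> cd; have [qpd _] := incident_corner cd qp rq.
  have [ut Vt] := square_zero_unit (square_zeroM qpd); split=> //.
  by apply: nN => //; [exact: column_corner|exact: usgV].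
have M21 d : corner d -> root_coset p q (1 + p2 * d * q2).
  move=> cd; have [ut Vt Nt] := unt _ cd.
  exists (a * ((1 + p * d * q) * a^-1 * (1 - p * d * q))), d; split=> //.
    exact: usgM.
  by rewrite -conjt -Vt !mulrA mulrVK.
have [k0|k0] := eqVneq (q2 * p) 0; last first.
  have [k' [ck' k'k _]] := corner_inv ck k0.
  exists p, q; split=> //; split=> // d cd.
  exact: (plane_root_group cp rq cp2 qp qp2 q2p2 erefl ck' k'k gM M12 M21
    (root_coset_commutator cp rq qp)).
have q20 : q2 != 0.
  apply: contra_neq q0 => h; by rewrite -[q](mulrVK ua) -/q2 h mul0r.
exists p, q2; split=> //; split=> // d cd.
have M1 := M12 _ corner_e.
have := root_coset_commutator cp rq qp M1 (M21 _ cd).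
have pe : p * e = p by case: cp.
have p2e : p2 * e = p2 by case: cp2.
rewrite pe; have x2 := square_zeroM qp.
have [q2p2d _] := incident_corner cd q2p2 rq2.
have y2 := square_zeroM q2p2d.
have yx : p2 * d * q2 * (p * q) = 0.
  by rewrite -[_ * q2 * _]mulrA [q2 * _]mulrA k0 mul0r mulr0.
have [_ ->] := square_zero_unit x2; have [_ ->] := square_zero_unit y2.
rewrite elementary_commutator //.
have -> // : p * q * (p2 * d * q2) = p * d * q2.
by rewrite -(mulrA p q) -(mulrA p2 d) (mulrA q p2) qp2 (mulrA p e) pe mulrA.
Qed.

Lemma noncentral_transvections a : N a -> B a -> B a^-1 ->
  ~ (forall b, B b -> GRing.comm a b) ->
  forall p q, column p -> row q -> q * p = 0 -> N (1 + p * q).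
Proof.
move=> Na Ba BaV nca; have [p [q rg]] := noncentral_root_group Na Ba BaV nca.
exact: root_group_all rg.
Qed.

(** If w commutes with p q where q p = 0 and q r = e, then w p = w p q r = p q w r,
    so p is an eigenvector of w. *)
Lemma comm_transvections_central w : B w ->
  (forall p q, column p -> row q -> q * p = 0 -> GRing.comm w (p * q)) ->
  forall b, B b -> GRing.comm w b.
Proof.
move=> Bw h; apply: scalar_on_columns => // p cp.
have c0 : corner 0 by split; [exact: mcB0|rewrite mulr0|rewrite mul0r].
have [->|p0] := eqVneq p 0; first by exists 0; rewrite ?mulr0.
have [q [rq qp q0]] := annihilating_row cp p0.
have [r cr qr] := row_dual rq q0.
exists (q * (w * r)); first by apply: pairing => //; exact: column_mul.
have := congr1 (fun x => x * r) (h _ _ cp rq qp).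
rewrite /= !mulrA => e1; have pe : p * e = p by case: cp.
by rewrite -e1 -!mulrA qr pe.
Qed.

End Transvections.

(** * Idempotents in locally simple artinian algebras *)

Section SimpleArtinian.
Variable B : nzRingType.
Hypothesis simpB : simple_ring B.
Hypothesis artB : artinian B.
Implicit Types (b c x y : B) (I J K : {pred B}).

(** The elements z with z B y = 0 form a two-sided ideal. *)
Lemma simple_prime x y : (forall b, x * b * y = 0) -> x = 0 \/ y = 0.
Proof.
pose I : {pred B} := fun x => `[< forall b, x * b * y = 0 >].
have IE z : reflect (forall b, z * b * y = 0) (z \in I) by apply: asboolP.
have zI : zmod_closed I.
  split; first by apply/IE => b; rewrite !mul0r.
  by move=> u v /IE hu /IE hv; apply/IE => b; rewrite !mulrBl hu hv subrr.
have lI : left_ideal I.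
  by split=> // a u /IE hu; apply/IE => b; rewrite -!mulrA mulrA mulrA -(mulrA a) -(mulrA a) hu mulr0.
have rI : right_ideal I.
  by split=> // a u /IE hu; apply/IE => b; rewrite -(mulrA u).
move=> h; have xI : x \in I by apply/IE.
case: (simpB lI rI) => e; first by left; apply/eqP; rewrite -[_ == 0]e.
right; have /IE/(_ 1) : 1 \in I by rewrite e.
by rewrite !mul1r.
Qed.

Definition minimal_left I := [/\ left_ideal I, exists2 x, x \in I & x != 0 &
  forall K, left_ideal K -> {subset K <= I} ->
    (exists2 x, x \in K & x != 0) -> {subset I <= K}].

(** Otherwise dependent choice builds a strictly decreasing sequence of left ideals.
    *)
Lemma exists_minimal_left J : left_ideal J -> (exists2 x, x \in J & x != 0) ->
  exists2 I, minimal_left I & {subset I <= J}.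
Proof.
move=> lJ nJ; apply: contrapT => hn.
pose good I := [/\ left_ideal I, exists2 x, x \in I & x != 0 & {subset I <= J}].
have step (I : {I | good I}) : {I' : {I' | good I'} |
    {subset sval I' <= sval I} /\ ~ {subset sval I <= sval I'}}.
  apply: cid; case: I => I gI /=; have [lI nI sI] := gI.
  apply: contrapT => h; apply: hn; exists I => //; split=> // K lK sK nK.
  apply: contrapT => nIK; apply: h.
  have gK : good K by split=> // x /sK/sI.
  by exists (exist _ K gK).
have gJ : good J by split.
pose seqI := fix f n : {I | good I} :=
  if n is m.+1 then sval (step (f m)) else exist _ J gJ.
have [lfin _] := artB.
have [||n hn'] := lfin (fun n => sval (seqI n)).
- by move=> n; case: (svalP (seqI n)).
- by move=> n; case: (svalP (step (seqI n))).
have [_] := svalP (step (seqI n)); apply => x xI.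
by have := hn' n.+1 (leqnSn n) x; rewrite xI.
Qed.

Definition principal_left x : {pred B} := fun z => `[< exists b, z = b * x >].

Lemma principal_leftP x z : reflect (exists b, z = b * x) (z \in principal_left x).
Proof. exact: asboolP. Qed.

Lemma principal_left_ideal x : left_ideal (principal_left x).
Proof.
split; first split.
- by apply/principal_leftP; exists 0; rewrite mul0r.
- move=> u v /principal_leftP[b ->] /principal_leftP[c ->].
  by apply/principal_leftP; exists (b - c); rewrite mulrBl.
- move=> a u /principal_leftP[b ->].
  by apply/principal_leftP; exists (a * b); rewrite mulrA.
Qed.

(** Brauer's lemma. A minimal left ideal I in B d satisfies I u = I for some u in I,
    because B is prime. If e in I has e u = u, then e e - e lies in the annihilator
    of u in I, which is a smaller left ideal, so it vanishes. Nonzero elements of e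
    B e are invertible there because I is generated by each of its nonzero elements.
    *)
Lemma primitive_idempotent_in d : d != 0 -> exists e, [/\ exists b, e = b * d,
  e * e = e, e != 0 & forall b, e * b * e != 0 -> exists c,
    (e * c * e) * (e * b * e) = e /\ (e * b * e) * (e * c * e) = e].
Proof.
move=> d0; have [|I [lI [x xI x0] minI] sI] := exists_minimal_left (principal_left_ideal d).
  by exists d => //; apply/principal_leftP; exists 1; rewrite mul1r.
have [[I0 IB] IM] := lI.
have [b0 nz] : exists b, x * b * x != 0.
  apply: contrapT => h; have [||/eqP] := @simple_prime x x; last by rewrite (negPf x0).
    by move=> b; apply/eqP; apply: contrapT => /negP nb; apply: h; exists b.
  by move/eqP; rewrite (negPf x0).
pose u := b0 * x; have uI : u \in I by apply: IM.
have xu : x * u != 0 by rewrite /u mulrA.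
have u0 : u != 0 by apply: contra_neq xu => ->; rewrite mulr0.
pose K : {pred B} := fun z => `[< exists2 i, i \in I & z = i * u >].
have KP z : reflect (exists2 i, i \in I & z = i * u) (z \in K) by apply: asboolP.
have lK : left_ideal K.
  split; first split.
  - by apply/KP; exists 0; rewrite ?mul0r.
  - by move=> y z /KP[i iI ->] /KP[j jI ->]; apply/KP; exists (i - j); [exact: IB|rewrite mulrBl].
  - by move=> a z /KP[i iI ->]; apply/KP; exists (a * i); [exact: IM|rewrite mulrA].
have /(_ _ uI)/KP[e eI eu] : {subset I <= K}.
  apply: minI => //; first by move=> z /KP[i iI ->]; apply: IM.
  by exists (x * u) => //; apply/KP; exists x.
pose K' : {pred B} := fun z => `[< z \in I /\ z * u = 0 >].
have K'P z : reflect (z \in I /\ z * u = 0) (z \in K') by apply: asboolP.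
have lK' : left_ideal K'.
  split; first split.
  - by apply/K'P; rewrite mul0r.
  - by move=> y z /K'P[yI y0] /K'P[zI z0]; apply/K'P; split; [exact: IB|rewrite mulrBl y0 z0 subrr].
  - by move=> a z /K'P[zI z0]; apply/K'P; split; [exact: IM|rewrite -mulrA z0 mulr0].
have K'0 z : z \in K' -> z = 0.
  move=> zK; apply/eqP; apply: contraT => z0; move/eqP: xu; case.
  have /(_ _ xI)/K'P[] // : {subset I <= K'}.
  by apply: minI => //; [move=> w /K'P[]|exists z].
have ee : e * e = e.
  apply/eqP; rewrite -subr_eq0; apply/eqP/K'0/K'P; split.
    by apply: IB => //; exact: IM.
  by rewrite mulrBl -mulrA -!eu subrr.
have e0 : e != 0 by apply: contra_neq u0 => h; rewrite eu h mul0r.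
exists e; split=> //; first by have /principal_leftP := sI _ eI.
have linv b : e * b * e != 0 -> exists c, (e * c * e) * (e * b * e) = e.
  move=> nb; have /(_ _ eI)/principal_leftP[c ec] : {subset I <= principal_left (e * b * e)}.
    apply: minI; first exact: principal_left_ideal.
      by move=> z /principal_leftP[c ->]; rewrite mulrA; exact: IM.
    by exists (e * b * e) => //; apply/principal_leftP; exists 1; rewrite mul1r.
  exists c; have -> : e * c * e * (e * b * e) = e * (c * (e * b * e)).
    by rewrite !mulrA -[e * c * e * e]mulrA ee.
  by rewrite -ec ee.
move=> b nb; have [c ec] := linv b nb; exists c; split=> //.
have nc : e * c * e != 0 by apply: contra_neq e0 => h; rewrite -ec h mul0r.
have [c' ec'] := linv c nc.
have : e * b * e = e * c' * e.
  transitivity (e * c' * e * (e * c * e) * (e * b * e)).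
    by rewrite ec' !mulrA ee.
  by rewrite -mulrA ec -mulrA ee.
by move=> ->.
Qed.

End SimpleArtinian.

Section LocallySimpleArtinian.
Variables (F : fieldType) (A : unitAlgType F).
Hypothesis hA : almost_locally_simple_artinian A.
Implicit Types (x y d : A) (s : seq A).

Lemma subalg_generated_exists s : exists S : {pred A}, subalg_generated s S.
Proof.
pose S : {pred A} := fun x =>
  `[< forall T : {pred A}, subalg_closed T -> {subset s <= T} -> x \in T >].
have SP x : reflect (forall T : {pred A}, subalg_closed T -> {subset s <= T} -> x \in T)
   (x \in S) by apply: asboolP.
exists S; split.
- split; first by apply/SP => T [].
  + move=> a u v /SP hu /SP hv; apply/SP => T cT sT; have [_ l _] := cT.
    by apply: l; [exact: hu|exact: hv].
  + move=> u v /SP hu /SP hv; apply/SP => T cT sT; have [_ _ m] := cT.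
    by apply: m; [exact: hu|exact: hv].
- by move=> x xs; apply/SP => T _; apply.
- by move=> T cT sT x /SP; apply.
Qed.

(** A generated subalgebra contains the scalars, so they lie in the simple artinian
    subring too. *)
Lemma local_subring s : exists (L : fieldType) (B : algType L)
    (iota : {rmorphism B -> A}),
  [/\ injective iota, simple_ring B, artinian B,
    forall x, x \in s -> exists b, iota b = x &
    forall a : F, exists b, iota b = a%:A].
Proof.
have [S hS] := subalg_generated_exists s.
have [L [B [iota [inj sB aB hB]]]] := hA hS; have [cS sS _] := hS.
exists L, B, iota; split=> // [x /sS/hB//|a]; apply: hB.
have [S1 lS _] := cS; have := lS a 1 0 S1; rewrite addr0; apply.
by have := lS (-1) 1 1 S1 S1; rewrite scaleN1r addNr.
Qed.

Lemma locally_prime x y : (forall z, x * z * y = 0) -> x = 0 \/ y = 0.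
Proof.
have [L [B [iota [inj sB aB hB _]]]] := local_subring [:: x; y].
have [|b <-] := hB x; first by rewrite !inE eqxx.
have [|c <-] := hB y; first by rewrite !inE eqxx orbT.
move=> h; have [|->|->] := @simple_prime B sB b c.
- by move=> z; apply: inj; rewrite !rmorphM rmorph0; apply: h.
- by left; rewrite rmorph0.
- by right; rewrite rmorph0.
Qed.

Lemma locally_idempotent d : d != 0 -> exists b, (b * d) * (b * d) = b * d /\ b * d != 0.
Proof.
have [L [B [iota [inj sB aB hB _]]]] := local_subring [:: d].
have [|b <-] := hB d; first by rewrite inE.
move=> d0; have [|e [[c ec] ee e0 _]] := primitive_idempotent_in sB aB (d := b).
  by apply: contra_neq d0 => ->; rewrite rmorph0.
exists (iota c); rewrite -!rmorphM -ec ee; split=> //.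
by rewrite -(rmorph0 iota) (inj_eq inj).
Qed.

Lemma local_minimal_corner (r : A) s : r != 0 -> r \isn't a GRing.unit ->
  exists (P : A -> Prop) (e : A), [/\ minimal_corner P e,
    forall x, x \in s -> P x & forall a : F, P a%:A].
Proof.
move=> r0 nr; have [L [B [iota [inj sB aB hB hF]]]] := local_subring (r :: s).
have [|b eb] := hB r; first by rewrite inE eqxx.
have b0 : b != 0 by apply: contra_neq r0 => b0; rewrite -eb b0 rmorph0.
have [e [_ ee e0 de]] := primitive_idempotent_in sB aB b0.
exists (fun x => exists b, iota b = x), (iota e); split=> //; last first.
  by move=> x xs; apply: hB; rewrite inE xs orbT.
split.
- by exists 1; rewrite rmorph1.
- by move=> _ _ [x <-] [y <-]; exists (x - y); rewrite rmorphB.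
- by move=> _ _ [x <-] [y <-]; exists (x * y); rewrite rmorphM.
- move=> _ _ [x <-] [y <-] h; have [|->|->] := @simple_prime B sB x y.
  + by move=> z; apply: inj; rewrite !rmorphM rmorph0; apply: h; exists z.
  + by left; rewrite rmorph0.
  + by right; rewrite rmorph0.
- by exists e.
- by rewrite -rmorphM ee.
- by rewrite -(rmorph0 iota) (inj_eq inj).
- apply: contra nr; rewrite -(rmorph1 iota) (inj_eq inj) => /eqP e1.
  have [|c] := de b; rewrite e1 !mulr1 !mul1r // => -[e2 e3].
  apply/unitrP; exists (iota c).
  by rewrite -eb -!rmorphM e2 e3 rmorph1.
- move=> _ [x <-]; rewrite -!rmorphM -(rmorph0 iota) (inj_eq inj) => /de[c [e1 e2]].
  exists (iota c); split; first by exists c.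
  + by rewrite -!rmorphM e1.
  + by rewrite -!rmorphM e2.
Qed.

End LocallySimpleArtinian.

(** * Weights of subnormal subgroups in general *)

Section FourScalars.
Variable F : fieldType.
Hypothesis hF4 : exists s : seq F, uniq s /\ size s = 4%N.

(** The form in which the number of elements of F is used. *)
Lemma avoid_three (a b c : F) : exists l, [/\ l != a, l != b & l != c].
Proof.
have [s [us ss]] := hF4; apply: contrapT => h.
have : (size s <= size [:: a; b; c])%N.
  apply: uniq_leq_size us _ => l _; apply: contraT; rewrite !inE !negb_or => /and3P[? ? ?].
  by case: h; exists l.
by rewrite ss.
Qed.
End FourScalars.

Definition unit_elements (R : unitRingType) (x : R) : Prop := x \is a GRing.unit.

Lemma unit_elements_usg (R : unitRingType) : unit_subgroup (@unit_elements R).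
Proof.
split=> [|x y ux uy|x ux|//]; rewrite /unit_elements ?unitr1 ?unitrV //.
by rewrite unitrMl.
Qed.

Arguments unit_elements {R} x.

Section Weights.
Variables (F : fieldType) (A : unitAlgType F).
Hypothesis hF : has_center A.
Hypothesis hA : almost_locally_simple_artinian A.
Hypothesis hF4 : exists s : seq F, uniq s /\ size s = 4%N.
Implicit Types (w x y g h : A) (N H Q : A -> Prop).

Lemma scalar_central (a : F) : central (a%:A : A).
Proof. by apply/hF; exists a. Qed.

Lemma scalarV (a : F) : (a%:A : A)^-1 = a^-1%:A.
Proof.
have [->|a0] := eqVneq a 0; first by rewrite invr0 !scale0r invr0.
have ua : a \is a GRing.unit by rewrite unitfE.
by rewrite invrZ ?unitr1 // invr1.
Qed.

Lemma scalar_unit (a : F) : a != 0 -> (a%:A : A) \is a GRing.unit.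
Proof.
move=> a0; apply/unitrP; exists (a^-1%:A).
by rewrite -!scalerAl !mul1r !scalerA mulVf // mulfV // !scale1r.
Qed.

Lemma subnormal_in_ext Q Q' n N : (forall x, Q x <-> Q' x) ->
  subnormal_in Q n N -> subnormal_in Q' n N.
Proof.
move=> eQ; elim=> {n N} [N eN|n H N _ IH nN]; last exact: SubnormalS IH nN.
by constructor=> x; rewrite eN.
Qed.

(** If w (1 + x) w^-1 = c (1 + x) with c different from 1, then w x w^-1 = (c - 1) +
    c x has square zero, which forces (c - 1)^2 x = 0. *)
Lemma weight_of_square_zero w x : w \is a GRing.unit -> x * x = 0 ->
  central (commutator w (1 + x)) -> GRing.comm w x.
Proof.
move=> uw x2 /hF[c ec].
have ux : 1 + x \is a GRing.unit by have [] := square_zero_unit x2.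
have e1 : w * (1 + x) * w^-1 = c%:A * (1 + x).
  by rewrite -ec /commutator mulrVK.
have e2 : w * x * w^-1 = (c - 1)%:A + c%:A * x.
  have -> : w * x * w^-1 = w * (1 + x) * w^-1 - 1.
    by rewrite mulrDr mulr1 mulrDl divrr // addrC addKr.
  by rewrite e1 mulrDr mulr1 scalerBl scale1r addrAC.
have [c1|c1] := eqVneq c 1.
  move: e2; rewrite c1 subrr scale0r add0r scale1r mul1r => e2.
  by rewrite /GRing.comm -{2}e2 mulrVK.
have sq : (w * x * w^-1) * (w * x * w^-1) * x = 0.
  by rewrite mulr_conj // x2 mulr0 !mul0r.
have d0 : c - 1 != 0 by rewrite subr_eq0.
suff -> : x = 0 by exact: commr0.
move: sq; rewrite e2.
have -> : ((c - 1)%:A + c%:A * x) * ((c - 1)%:A + c%:A * x) * x =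
  (c - 1)%:A * (c - 1)%:A * x + (c - 1)%:A * c%:A * (x * x) + c%:A * (x * (c - 1)%:A) * x
   + c%:A * (x * c%:A) * (x * x) by ncring.
rewrite x2 !mulr0 !addr0 -[x * (c - 1)%:A]scalar_central.
have -> : c%:A * ((c - 1)%:A * x) * x = c%:A * (c - 1)%:A * (x * x) by rewrite !mulrA.
rewrite x2 mulr0 addr0 -mulrA => h.
have ud := scalar_unit d0.
by apply: (mulrI ud); apply: (mulrI ud); rewrite h !mulr0.
Qed.

(** Outside the case of division rings, let v be an element that should commute with
    w, and take a local simple artinian subring around w, v and a noncentral a in N.
    Along the chain, every group contains the transvections of this subring by
    [noncentral_transvections]; the scalar l with l^2 - 1 invertible needed there
    exists because F has four elements. Then w commutes with all transvections by
    [weight_of_square_zero], hence with v. *)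
Lemma subnormal_weights_central n N w : subnormal_in unit_elements n N ->
  (exists2 a, N a & ~ central a) -> w \is a GRing.unit ->
  (forall g, N g -> central (commutator w g)) -> central w.
Proof.
move=> sN [a Na na] uw hw.
have [hdiv|/existsNP[r /not_implyP[r0 /negP nr]]] :=
    pselect (forall r : A, r != 0 -> r \is a GRing.unit).
  pose E (x : A) := True; have dE : division_subring E by [].
  have sN' : subnormal_in (nonzero_of E) n N.
    apply: subnormal_in_ext sN => x; rewrite /unit_elements /nonzero_of /E.
    by rewrite (div_unitE hdiv); split=> [|[]].
  move=> y; apply: (subnormal_weight_central hdiv dE sN') => //.
  - by exists a => // ca; apply: na => z; apply: ca.
  - by rewrite -(div_unitE hdiv).
  - by move=> h Nh z _; apply: hw.
apply: contrapT => /existsNP[v nv]; have /existsNP[y ny] := na.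
have [P [e [mc hP PF]]] := local_minimal_corner hA [:: a; a^-1; y; w; v] r0 nr.
have Pa : P a by apply: hP; rewrite !inE eqxx.
have PaV : P a^-1 by apply: hP; rewrite !inE eqxx ?orbT.
have Py : P y by apply: hP; rewrite !inE eqxx ?orbT.
have Pw : P w by apply: hP; rewrite !inE eqxx ?orbT.
have Pv : P v by apply: hP; rewrite !inE eqxx ?orbT.
have [l [l0 l1 lN1]] := avoid_three hF4 0 1 (-1).
have ll : l * l - 1 != 0.
  have -> : l * l - 1 = (l - 1) * (l + 1) by rewrite mulrDr mulr1 mulrBl mul1r addrA addrNK.
  by rewrite mulf_neq0 // ?subr_eq0 // addr_eq0.
have ell : (l%:A * l%:A - 1 : A) = (l * l - 1)%:A.
  by rewrite -scalerAl mul1r scalerA scalerBl scale1r.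
have nca : ~ (forall b, P b -> GRing.comm a b) by move/(_ y Py).
have gU := unit_elements_usg A.
have ind m M : subnormal_in unit_elements m M -> M a ->
    forall p q, column P e p -> row P e q -> q * p = 0 -> M (1 + p * q).
  elim=> {m M} [M eM _|m H M sH IH nM Ma] p q cp rq qp.
    by apply/eM; have [] := square_zero_unit (square_zeroM qp).
  have [gM sMH _] := nM; have gH := subnormal_usg gU sH.
  have hl p' q' x : column P e p' -> row P e q' -> q' * p' = 0 -> M x ->
      M ((1 + p' * q') * x * (1 - p' * q')).
    move=> cp' rq' qp' Mx; have Ht := IH (sMH _ Ma) _ _ cp' rq' qp'.
    have [_ <-] := square_zero_unit (square_zeroM qp').
    exact: normal_inV gH nM Mx Ht.
  have h1 := scalar_unit l0; have h3 : (l%:A * l%:A - 1 : A) \is a GRing.unit.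
    by rewrite ell; exact: scalar_unit.
  have h5 : P (l%:A)^-1 by rewrite scalarV; exact: PF.
  have h6 : P (l%:A * l%:A - 1)^-1 by rewrite ell scalarV; exact: PF.
  exact: (noncentral_transvections mc h1 (scalar_central l) h3 (PF l) h5 h6 gM hl
    Ma Pa PaV nca cp rq qp).
apply: nv; apply: (comm_transvections_central mc Pw) Pv => p q cp rq qp.
apply: weight_of_square_zero => //; first exact: square_zeroM.
by apply: hw; apply: ind sN Na _ _ cp rq qp.
Qed.

End Weights.

(** * Involutions that commute with idempotents *)

Section Involution.
Variables (R : nzRingType) (st : R -> R).
Hypothesis inv : involution st.
Implicit Types x y : R.

Lemma starD x y : st (x + y) = st x + st y. Proof. by case: inv. Qed.
Lemma starM x y : st (x * y) = st y * st x. Proof. by case: inv. Qed.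
Lemma starK x : st (st x) = x. Proof. by case: inv. Qed.
Lemma star0 : st 0 = 0.
Proof. by apply: (addrI (st 0)); rewrite -starD !addr0. Qed.
Lemma starN x : st (- x) = - st x.
Proof. by apply/eqP; rewrite -addr_eq0 -starD addNr star0. Qed.
Lemma starB x y : st (x - y) = st x - st y.
Proof. by rewrite starD starN. Qed.
Lemma star1 : st 1 = 1.
Proof. by have := starM 1 (st 1); rewrite mul1r starK mul1r => <-. Qed.
Lemma starX x n : st (x ^+ n) = st x ^+ n.
Proof. by elim: n => [|n IH]; rewrite ?expr0 ?star1 // exprS starM IH exprSr. Qed.
Lemma star_comm x y : GRing.comm x y -> GRing.comm (st x) (st y).
Proof. by move=> h; rewrite /GRing.comm -!starM h. Qed.
End Involution.

Section InvolutionUnits.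
Variables (R : unitRingType) (st : R -> R).
Hypothesis inv : involution st.
Lemma star_unit x : x \is a GRing.unit -> st x \is a GRing.unit.
Proof.
move=> ux; apply/unitrP; exists (st x^-1).
by rewrite -!(starM inv) divrr // mulVr // (star1 inv).
Qed.
Lemma starV x : x \is a GRing.unit -> st x^-1 = (st x)^-1.
Proof.
move=> ux; apply: (mulrI (star_unit ux)).
by rewrite -(starM inv) mulVr // (star1 inv) divrr // star_unit.
Qed.
End InvolutionUnits.

Section NormalIdempotents.
Variables (F : fieldType) (A : unitAlgType F) (st : A -> A).
Hypothesis hA : almost_locally_simple_artinian A.
Hypothesis inv : involution st.
Hypothesis normal_idem : forall e, e * e = e -> st e * e = e * st e.
Implicit Types (e f u v x y d : A).

Lemma complement_idem e : e * e = e -> (1 - e) * (1 - e) = 1 - e.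
Proof.
move=> ee; transitivity (1 - e - e + e * e); first by ncring.
by rewrite ee subrK.
Qed.

(** Otherwise p A (1 - p) has a nonzero element u. The idempotent p + u commutes
    with its image p + st u, and comparing components gives u = u st u, so that u is
    symmetric. But u is in p A (1 - p) and st u in (1 - p) A p. *)
Lemma symmetric_idem p : p * p = p -> st p = p -> p = 0 \/ p = 1.
Proof.
move=> pp sp.
have pq : p * (1 - p) = 0 by rewrite mulrBr mulr1 pp subrr.
have qp : (1 - p) * p = 0 by rewrite mulrBl mul1r pp subrr.
have [z|h|h] := @locally_prime F A hA p (1 - p); last 2 first.
- by left.
- by right; apply/eqP; rewrite eq_sym -subr_eq0 h.
pose u := p * z * (1 - p); rewrite -/u.
have pu : p * u = u by rewrite /u !mulrA pp.
have up : u * p = 0 by rewrite /u -mulrA qp mulr0.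
have uu : u * u = 0 by rewrite -{2}pu mulrA up mul0r.
have sup : st u * p = st u by rewrite -{1}sp -(starM inv) pu.
have psu : p * st u = 0 by rewrite -{1}sp -(starM inv) up (star0 inv).
have id : (p + u) * (p + u) = p + u by rewrite mulrDl !mulrDr pp pu up uu !addr0.
have := normal_idem id; rewrite (starD inv) sp.
have -> : (p + st u) * (p + u) = p + (u + st u + st u * u).
  by rewrite mulrDl !mulrDr pp pu sup !addrA.
have -> : (p + u) * (p + st u) = p + u * st u.
  by rewrite mulrDl !mulrDr pp psu up addr0 add0r.
move/addrI => e2; have e3 : u = u * st u.
  have := congr1 (fun t => p * t) e2; rewrite /= !mulrDr pu psu addr0.
  by rewrite [p * (st u * u)]mulrA psu mul0r addr0 mulrA pu.
have e4 : st u = u by rewrite e3 (starM inv) (starK inv).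
by rewrite -pu -e4.
Qed.

(** Both e st e and then e + st e are symmetric idempotents, so the former is 0 and
    the latter 1. *)
Lemma star_idem e : e * e = e -> e != 0 -> e != 1 -> st e = 1 - e.
Proof.
move=> ee e0 e1; have ce := normal_idem ee.
have see : st e * st e = st e by rewrite -(starM inv) ee.
have p1 : e * st e = 0.
  have [] // := @symmetric_idem (e * st e).
  - by rewrite !mulrA -[e * st e * e]mulrA ce mulrA ee -mulrA see.
  - by rewrite (starM inv) (starK inv).
  move=> h; case/eqP: e1.
  by rewrite -[e]mulr1 -h mulrA ee.
have p2 : st e * e = 0 by rewrite ce.
have [] // := @symmetric_idem (e + st e).
- by rewrite mulrDl !mulrDr ee p1 p2 see addr0 add0r.
- by rewrite (starD inv) (starK inv) addrC.
- move=> h; case/eqP: e0.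
  by rewrite -ee -{1}[e](addrK (st e)) h sub0r mulNr p2 oppr0.
- by move=> h; rewrite -h addrC addKr.
Qed.

(** If e + f were not 1, then st would take each of e, f and e + f to its
    complement, against additivity. *)
Lemma orthogonal_idem e f : e * e = e -> f * f = f -> e * f = 0 -> f * e = 0 ->
  e != 0 -> f != 0 -> e + f = 1.
Proof.
move=> ee ff ef fe e0 f0; apply/eqP; apply: contraT => ne.
have e1 : e != 1 by apply: contra_neq f0 => h; rewrite -ef h mul1r.
have f1 : f != 1 by apply: contra_neq e0 => h; rewrite -fe h mul1r.
have : st (e + f) = 1 - (e + f).
  apply: star_idem => //; first by rewrite mulrDl !mulrDr ee ef fe ff addr0 add0r.
  by apply: contra_neq e0 => h; rewrite -ee -[X in X * _](addrK f) h sub0r mulNr fe oppr0.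
rewrite (starD inv) !star_idem // => /eqP; rewrite -subr_eq0.
have -> : 1 - e + (1 - f) - (1 - (e + f)) = 1 by ncring.
by rewrite oner_eq0.
Qed.

(** For x in e A (1 - e) the element e + x is an idempotent too, and has the
    complement 1 - e - x. *)
Lemma star_offdiag e x : e * e = e -> e != 0 -> e != 1 ->
  st (e * x * (1 - e)) = - (e * x * (1 - e)).
Proof.
move=> ee e0 e1; set u := e * x * (1 - e).
have eu : e * u = u by rewrite /u !mulrA ee.
have ue : u * e = 0 by rewrite /u -mulrA mulrBl mul1r ee subrr mulr0.
have uu : u * u = 0 by rewrite -{2}eu mulrA ue mul0r.
have id : (e + u) * (e + u) = e + u by rewrite mulrDl !mulrDr ee eu ue uu !addr0.
have n0 : e + u != 0.
  by apply: contra_neq e0 => h; rewrite -ee -{1}[e](addrK u) h sub0r mulNr ue oppr0.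
have n1 : e + u != 1.
  apply: contra_neq e1 => h.
  have : e * (e + u) * e = e by rewrite h mulr1.
  rewrite mulrDr mulrDl ee eu ue ee addr0 => _.
  have : (e + u) * (1 - e) = 1 - e by rewrite h mul1r.
  have -> : (e + u) * (1 - e) = (e - e * e) + (u - u * e) by ncring.
  rewrite ee subrr add0r ue subr0 => h2.
  by have := eu; rewrite h2 mulrBr mulr1 ee subrr => /esym/eqP; rewrite subr_eq0 => /eqP.
have := star_idem id n0 n1; rewrite (starD inv) star_idem // => h.
by apply: (addrI (1 - e)); rewrite h opprD addrA.
Qed.

(** The left ideal of d contains a nonzero idempotent, which can be moved into e A
    e. There is no room in e A e for an idempotent different from e. *)
Lemma corner_division e d : e * e = e -> e != 0 -> e != 1 -> e * d * e = d -> d != 0 ->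
  exists c, e * c * e * d = e.
Proof.
move=> ee e0 e1 ede d0; have [b [bb b0]] := locally_idempotent hA d0.
have de : d * e = d by rewrite -ede -mulrA ee.
have ed : e * d = d by rewrite -ede !mulrA ee.
pose g := b * d; have ge : g * e = g by rewrite /g -mulrA de.
pose f := e * g; have ff : f * f = f.
  by rewrite /f mulrA -[e * g * e]mulrA ge -mulrA bb.
have ef : e * f = f by rewrite /f mulrA ee.
have fe : f * e = f by rewrite /f -mulrA ge.
have f0 : f != 0.
  apply: contra_neq b0 => h; rewrite -/g -[g]bb -/g -{1}ge -mulrA.
  by rewrite -/f h mulr0.
have [efe|nef] := eqVneq f e; first by exists b; rewrite -mulrA ed -mulrA.
case/eqP: e1; rewrite -[e](subrK f) addrC.
apply: orthogonal_idem => //.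
- by rewrite mulrBl !mulrBr ee ef fe ff subrr subr0.
- by rewrite mulrBr fe ff subrr.
- by rewrite mulrBl ef ff subrr.
- by rewrite subr_eq0 eq_sym.
Qed.

(** One-sided inverses are two-sided as in any monoid in which all nonzero elements
    have them. *)
Lemma corner_inverse e d : e * e = e -> e != 0 -> e != 1 -> e * d * e = d -> d != 0 ->
  exists c, [/\ e * c * e = c, c * d = e & d * c = e].
Proof.
move=> ee e0 e1 ede d0; have [c ec] := corner_division ee e0 e1 ede d0.
have [c' ec'] : exists c', c' = e * c * e by eexists.
rewrite -ec' in ec.
have ece : e * c' * e = c' by rewrite ec' !mulrA ee -[LHS]mulrA ee.
have c0 : c' != 0 by apply: contra_neq e0 => h; rewrite -ec h mul0r.
have [b eb] := corner_division ee e0 e1 ece c0.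
have de : d * e = d by rewrite -ede -mulrA ee.
have ed : e * d = d by rewrite -ede !mulrA ee.
exists c'; split=> //; suff -> : d = e * b * e by [].
by rewrite -[LHS]ed -[in LHS]eb -[LHS]mulrA ec -mulrA ee.
Qed.

(** By primeness u = e z (1 - e) can be chosen nonzero, and u w e nonzero in turn;
    the inverse of u w e in the corner makes v. *)
Lemma complementary_units e : e * e = e -> e != 0 -> e != 1 -> exists u v,
  [/\ e * u * (1 - e) = u, (1 - e) * v * e = v, u * v = e & v * u = 1 - e].
Proof.
move=> ee e0 e1.
have e'0 : 1 - e != 0 by rewrite subr_eq0 eq_sym.
have e'e' := complement_idem ee.
have ee' : e * (1 - e) = 0 by rewrite mulrBr mulr1 ee subrr.
have e'e : (1 - e) * e = 0 by rewrite mulrBl mul1r ee subrr.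
have [z /eqP u0] : exists z, e * z * (1 - e) <> 0.
  apply/existsNP => h; case: (@locally_prime F A hA e (1 - e)) => // h'.
    by rewrite h' eqxx in e0.
  by rewrite h' eqxx in e'0.
have [u eu] : exists u, u = e * z * (1 - e) by eexists.
rewrite -eu in u0.
have euE : e * u = u by rewrite eu !mulrA ee.
have ue' : u * (1 - e) = u by rewrite eu -mulrA e'e'.
have [w /eqP w0] : exists w, u * w * e <> 0.
  apply/existsNP => h; case: (@locally_prime F A hA u e) => // h'.
    by rewrite h' eqxx in u0.
  by rewrite h' eqxx in e0.
have [|c [ece _ dc]] := corner_inverse ee e0 e1 _ w0.
  by rewrite -[LHS]mulrA -[_ * e * e]mulrA ee !mulrA euE.
have ec : e * c = c by rewrite -ece !mulrA ee.
have ce : c * e = c by rewrite -ece -mulrA ee.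
exists u, ((1 - e) * w * c).
have uv : u * ((1 - e) * w * c) = e by rewrite !mulrA ue' -dc -[in RHS]mulrA ec.
have [v ev] : exists v, v = (1 - e) * w * c by eexists.
have ve : v * e = v by rewrite ev -[LHS]mulrA ce.
have e'v : (1 - e) * v = v by rewrite ev !mulrA e'e'.
rewrite -ev in uv *; split=> //; first by rewrite euE.
  by rewrite e'v.
suff <- : e + v * u = 1 by rewrite addrC addKr.
apply: orthogonal_idem => //.
- by rewrite mulrA -[v * u * v]mulrA uv ve.
- by rewrite -e'v !mulrA ee' !mul0r.
- by rewrite -ue' -!mulrA e'e !mulr0.
- by apply: contra_neq u0 => h; rewrite -euE -uv -mulrA h mulr0.
Qed.

(** The element b u is off-diagonal like u, and st is -1 on both. *)
Lemma star_corner e u v b : e * e = e -> e != 0 -> e != 1 ->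
  e * u * (1 - e) = u -> v * u = 1 - e -> e * b * e = b -> st b = v * b * u.
Proof.
move=> ee e0 e1 eu vu h; have se := star_idem ee e0 e1.
have be : b * e = b by rewrite -h -mulrA ee.
have eb : e * b = b by rewrite -h !mulrA ee.
have ub : e * (b * u) * (1 - e) = b * u.
  by rewrite -{2}eu !mulrA eb be.
have su : st u = - u by rewrite -[in LHS]eu star_offdiag // eu.
have := star_offdiag (b * u) ee e0 e1; rewrite ub (starM inv) su mulNr => /oppr_inj h2.
have hb : (1 - e) * st b = st b by rewrite -se -(starM inv) be.
by rewrite -[LHS]hb -vu -[LHS]mulrA h2 mulrA.
Qed.

(** On e A e, st agrees with the isomorphism b |-> v b u onto the opposite corner,
    so it both preserves and reverses products. *)
Lemma corner_commutative e c d : e * e = e -> e != 0 -> e != 1 ->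
  e * c * e = c -> e * d * e = d -> c * d = d * c.
Proof.
move=> ee e0 e1 ece ede; have [u [v [eu ev uv vu]]] := complementary_units ee e0 e1.
have se := star_idem ee e0 e1.
have st_corner b : e * b * e = b -> st b = v * b * u by apply: star_corner.
have ecd : e * (c * d) * e = c * d.
  by rewrite -[in RHS]ece -[in RHS]ede -[in LHS]ece -[in LHS]ede !mulrA ee -!mulrA ee.
have := starM inv c d; rewrite !st_corner // => h.
have := congr1 (fun x => u * x * v) h.
have -> : u * (v * (c * d) * u) * v = (u * v) * (c * d) * (u * v) by rewrite !mulrA.
have -> : u * (v * d * u * (v * c * u)) * v = (u * v) * d * (u * v) * c * (u * v) by rewrite !mulrA.
by rewrite uv ecd ede -[RHS]mulrA -[in RHS]ece -[in RHS]mulrA ee ece.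
Qed.

(** Write the Peirce components of x with respect to e and 1 - e in the corner e A
    e, as a matrix with entries a, b, c, d. Then st x has entries d, -b, -c, a, and
    x + st x is the scalar matrix of a + d, which is central since the corner is
    commutative. *)
Lemma split_symplectic : (exists e, [/\ e * e = e, e != 0 & e != 1]) ->
  forall x, central (x + st x).
Proof.
case=> e [ee e0 e1]; have [u [v [eu ev uv vu]]] := complementary_units ee e0 e1.
have se := star_idem ee e0 e1.
have euE : e * u = u by rewrite -[in LHS]eu !mulrA ee eu.
have ve : v * e = v by rewrite -[in LHS]ev -[LHS]mulrA ee ev.
have ev0 : e * v = 0.
  by rewrite -ev !mulrA mulrBr mulr1 ee subrr !mul0r.
have ue0 : u * e = 0.
  by rewrite -eu -!mulrA mulrBl mul1r ee subrr !mulr0.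
have su : st u = - u by rewrite -[in LHS]eu star_offdiag // eu.
have e'0 : 1 - e != 0 by rewrite subr_eq0 eq_sym.
have e'1 : 1 - e != 1 by rewrite -subr_eq0 addrAC subrr add0r oppr_eq0.
have sv : st v = - v.
  have := star_offdiag v (complement_idem ee) e'0 e'1.
  by rewrite subKr ev.
have se' : 1 = e + v * u by rewrite vu addrC subrK.
have st_corner b : e * b * e = b -> st b = v * b * u by apply: star_corner.
pose corner a := e * a * e = a.
have ew w : corner w -> e * w = w by move=> <-; rewrite !mulrA ee.
have we w : corner w -> w * e = w by move=> <-; rewrite -[LHS]mulrA ee.
have peirce x : exists a b c d, [/\ corner a, corner b, corner c, corner d &
    x = a + b * u + v * c + v * d * u].
  exists (e * x * e), (e * (x * v) * e), (e * (u * x) * e), (e * (u * x * v) * e).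
  have c0 z : corner (e * z * e) by rewrite /corner !mulrA ee -[LHS]mulrA ee.
  split=> //.
  have -> : e * (x * v) * e = e * x * v by rewrite -[LHS]mulrA -[x * v * e]mulrA ve mulrA.
  have -> : e * (u * x) * e = u * x * e by rewrite mulrA euE.
  have -> : e * (u * x * v) * e = u * x * v.
    by rewrite !mulrA euE -[LHS]mulrA ve.
  transitivity ((e + v * u) * x * (e + v * u)); first by rewrite -se' mul1r mulr1.
  by ncring.
have sx a b c d : corner a -> corner b -> corner c -> corner d ->
   st (a + b * u + v * c + v * d * u) = d - b * u - v * c + v * a * u.
  move=> ha hb hc hd; rewrite !(starD inv) !(starM inv) su sv !st_corner //.
  transitivity (v * a * u - (u * v) * b * u - v * c * (u * v) + (u * v) * d * (u * v)).
    by ncring.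
  by rewrite uv !ew // -[v * c * e]mulrA !we //; ncring.
move=> x y; have [a [b [c [d [ha hb hc hd ->]]]]] := peirce x.
rewrite sx //; set t := _ + _.
have et : t = (a + d) + v * (a + d) * u by rewrite /t; ncring.
have hz : corner (a + d) by rewrite /corner mulrDr mulrDl ha hd.
rewrite et; move: (a + d) hz => z hz {t et sx a b c d ha hb hc hd x}.
have [a [b [c [d [ha hb hc hd ->]]]]] := peirce y.
have cz w : corner w -> z * w = w * z by move=> hw; apply: corner_commutative hz hw.
have ez : e * z = z by rewrite -hz !mulrA ee.
have ze : z * e = z by rewrite -hz -!mulrA ee.
have zv : z * v = 0 by rewrite -ze -mulrA ev0 mulr0.
have uz : u * z = 0 by rewrite -ez mulrA ue0 mul0r.
have ua w : corner w -> u * w = 0 by move=> <-; rewrite !mulrA ue0 !mul0r.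
have av w : corner w -> w * v = 0 by move=> <-; rewrite -!mulrA ev0 !mulr0.
have uu : u * u = 0 by rewrite -{2}euE mulrA ue0 mul0r.
have vv : v * v = 0 by rewrite -{1}ve -mulrA ev0 mulr0.
have L : (z + v * z * u) * (a + b * u + v * c + v * d * u) =
  z * a + z * b * u + (z * v) * c + (z * v) * d * u
  + v * z * (u * a) + v * z * (u * b) * u + v * (z * (u * v) * c) + v * (z * (u * v) * d) * u.
  by ncring.
have R : (a + b * u + v * c + v * d * u) * (z + v * z * u) =
  a * z + (a * v) * z * u + b * (u * z) + b * (u * v) * z * u + v * (c * z)
  + v * (c * v) * z * u + v * d * (u * z) + v * (d * (u * v) * z) * u by ncring.
rewrite /GRing.comm L R zv uz (ua a) // (ua b) // (av a) // (av c) // uv ze !mul0r !mulr0 !mul0r !addr0.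
by rewrite (we b) // (we d) // !cz.
Qed.
End NormalIdempotents.

(** The elements q_i p_j are the matrix units, and p_i x q_j is the entry (i, j) of
    x up to the factor e. *)
Section MatrixUnits.
Variables (F : fieldType) (A : unitAlgType F) (e : A) (p q : 'I_2 -> A).
Hypothesis e0 : e != 0.
Hypothesis ep : forall i, e * p i = p i.
Hypothesis qe : forall i, q i * e = q i.
Hypothesis pq : forall i j, p i * q j = (i == j)%:R *: e.
Hypothesis qp : \sum_i q i * p i = 1.
Hypothesis hc : forall x, exists a : F, e * x * e = a *: e.

Let pxq x i j : exists a : F, p i * x * q j = a *: e.
Proof.
by have [a ha] := hc (p i * x * q j); exists a; rewrite -ha !mulrA ep -[RHS]mulrA qe.
Qed.

Definition matrix_coef (x : A) : 'M[F]_2 := \matrix_(i, j) sval (cid (pxq x i j)).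

Let coefE x i j : p i * x * q j = matrix_coef x i j *: e.
Proof. by rewrite mxE; case: (cid _). Qed.

Let scale_inj : injective (fun a : F => a *: e).
Proof.
move=> a b /eqP; rewrite -subr_eq0 -scalerBl scaler_eq0 (negPf e0) orbF subr_eq0.
by move/eqP.
Qed.

Let coef_linear : linear matrix_coef.
Proof.
move=> a x y; apply/matrixP=> i j; apply: scale_inj; rewrite /= -coefE mxE mxE.
by rewrite mulrDr mulrDl -scalerAr -scalerAl !coefE scalerA scalerDl.
Qed.

Let coef_mul : monoid_morphism matrix_coef.
Proof.
split; first by apply/matrixP=> i j; apply: scale_inj; rewrite /= -coefE mxE mulr1 pq.
move=> x y; apply/matrixP=> i j; apply: scale_inj; rewrite /= -coefE mxE.
have -> : p i * (x * y) * q j = \sum_k (p i * x * q k) * (p k * y * q j).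
  transitivity (p i * x * 1 * (y * q j)); first by rewrite mulr1 !mulrA.
  by rewrite -qp mulr_sumr mulr_suml; apply: eq_bigr => k _; rewrite !mulrA.
rewrite scaler_suml; apply: eq_bigr => k _.
by rewrite coefE -scalerAl !mulrA ep coefE scalerA.
Qed.

Definition matrix_coef_lrmorphism : {lrmorphism A -> 'M[F]_2} :=
  HB.pack matrix_coef (GRing.isLinear.Build _ _ _ _ _ coef_linear)
    (GRing.isMonoidMorphism.Build _ _ _ coef_mul).

Definition assemble (M : 'M[F]_2) : A := \sum_i \sum_j M i j *: (q i * p j).

Lemma matrix_coefK : cancel matrix_coef assemble.
Proof.
move=> x; rewrite /assemble.
transitivity ((\sum_i q i * p i) * x * (\sum_j q j * p j)); last by rewrite qp mul1r mulr1.
rewrite !mulr_suml; apply: eq_bigr => i _; rewrite mulr_sumr; apply: eq_bigr => j _.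
transitivity (q i * (matrix_coef x i j *: e) * p j).
  by rewrite -scalerAr -scalerAl qe.
by rewrite -coefE !mulrA.
Qed.

Lemma assembleK : cancel assemble matrix_coef.
Proof.
move=> M; apply/matrixP=> i j; apply: scale_inj; rewrite /= -coefE /assemble.
rewrite mulr_sumr mulr_suml (bigD1 i) //= [X in _ + X]big1 => [|k ki]; last first.
  rewrite mulr_sumr mulr_suml big1 // => l _.
  by rewrite -scalerAr !mulrA pq eq_sym (negPf ki) scale0r mul0r scaler0 mul0r.
rewrite addr0 mulr_sumr mulr_suml (bigD1 j) //= big1 => [|k kj]; last first.
  by rewrite -scalerAr -scalerAl -!mulrA pq (negPf kj) scale0r !mulr0 scaler0.
by rewrite addr0 -scalerAr !mulrA pq eqxx scale1r ep -scalerAl pq eqxx scale1r.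
Qed.

Lemma matrix_coef_bij : bijective matrix_coef_lrmorphism.
Proof. by exists assemble; [exact: matrix_coefK|exact: assembleK]. Qed.

End MatrixUnits.

Section SplitCase.
Variables (F : fieldType) (A : unitAlgType F) (st : A -> A).
Hypothesis hF : has_center A.
Hypothesis hA : almost_locally_simple_artinian A.
Hypothesis inv : involution st.
Hypothesis st1 : first_kind st.
Hypothesis normal_idem : forall e, e * e = e -> st e * e = e * st e.

Lemma idempotent_of_nonunit (r : A) : r != 0 -> r \isn't a GRing.unit ->
  exists e : A, [/\ e * e = e, e != 0 & e != 1].
Proof.
by move=> r0 nr; have [P [e [[] ]]] := local_minimal_corner hA [::] r0 nr; exists e.
Qed.

(** By C4 each b in the corner has b + st b in F, and multiplying by e on both sides
    shows that b is in F e. *)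
Lemma split_structure : (exists e : A, [/\ e * e = e, e != 0 & e != 1]) ->
  exists f : {lrmorphism A -> 'M[F]_2}, bijective f /\
    forall x, f (st x) = ordinary_symplectic (f x).
Proof.
move=> he; have C4 := split_symplectic hA inv normal_idem he.
case: he => e [ee e0 e1].
have [u [v [eu ev uv vu]]] := complementary_units hA inv normal_idem ee e0 e1.
have se := star_idem hA inv normal_idem ee e0 e1.
have euE : e * u = u by rewrite -[in LHS]eu !mulrA ee eu.
have ve : v * e = v by rewrite -[in LHS]ev -[LHS]mulrA ee ev.
have ev0 : e * v = 0.
  by rewrite -ev !mulrA mulrBr mulr1 ee subrr !mul0r.
have ue0 : u * e = 0.
  by rewrite -eu -!mulrA mulrBl mul1r ee subrr !mulr0.
have offd := star_offdiag hA inv normal_idem.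
have su : st u = - u by rewrite -[in LHS]eu offd // eu.
have e'0 : 1 - e != 0 by rewrite subr_eq0 eq_sym.
have e'1 : 1 - e != 1 by rewrite -subr_eq0 addrAC subrr add0r oppr_eq0.
have sv : st v = - v.
  by have := offd _ v (complement_idem ee) e'0 e'1; rewrite subKr ev.
have st_corner x : exists a : F, e * x * e = a *: e.
  have [a ha] := (hF (e * x * e + st (e * x * e))).1 (C4 _).
  exists a; have := congr1 (fun t => e * t * e) ha.
  rewrite /= mulrDr mulrDl !(starM inv) se.
  have -> : e * ((1 - e) * (st x * (1 - e))) * e = (e - e * e) * st x * (e - e * e) by ncring.
  rewrite ee subrr mulr0 addr0 -scalerAr mulr1 -scalerAl ee => <-.
  by rewrite !mulrA ee -[RHS]mulrA ee.
pose p (i : 'I_2) := if i == 0 then e else u.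
pose q (i : 'I_2) := if i == 0 then e else v.
have two (P : 'I_2 -> Prop) : P 0 -> P 1 -> forall i, P i.
  move=> P0 P1 [[|[|m]] h] //.
    by have -> : Ordinal h = 0 by exact: val_inj.
  by have -> : Ordinal h = 1 by exact: val_inj.
have ep i : e * p i = p i by rewrite /p; case: ifP.
have qe i : q i * e = q i by rewrite /q; case: ifP.
have pq i j : p i * q j = (i == j)%:R *: e.
  by elim/two: i; elim/two: j; rewrite /p /q /= ?ee ?ev0 ?ue0 ?uv ?scale1r ?scale0r.
have qp : \sum_i q i * p i = 1.
  by rewrite big_ord_recl big_ord1 /p /q /= ee vu addrC subrK.
exists (matrix_coef_lrmorphism e0 ep qe pq qp st_corner); split; first exact: matrix_coef_bij.
move=> x; set M := matrix_coef_lrmorphism _ _ _ _ _ _ x.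
have stZ a y : st (a *: y) = a *: st y.
  by rewrite -mulr_algl (starM inv) (st1 (scalar_central hF a)) -scalar_central // mulr_algl.
suff -> : st x = assemble p q (ordinary_symplectic M) by exact: assembleK.
have -> : x = assemble p q M by rewrite matrix_coefK.
move: M => M; have l1 : lift ord0 ord0 = 1 :> 'I_2 by exact: val_inj.
rewrite /assemble !big_ord_recl !big_ord0 l1 /= !addr0 !(starD inv) !stZ !(starM inv).
rewrite !mxE /p /q /= ee euE ve su sv se mulrNN uv.
rewrite complement_idem // vu mulrBr mulr1 !mulNr ue0 ?oppr0.
rewrite ?mulrN ?mulrBl ?mul1r ?ev0 ?oppr0 ?subr0.
rewrite !addr0 !scaleNr !scalerN [LHS]addrC [X in X + _ = _]addrC [X in _ + X = _]addrC.
by rewrite addrACA.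
Qed.
End SplitCase.

(** * Trace, norm and normality *)

Section Elementary.
Variables (R : nzRingType) (st : R -> R).
Hypothesis inv : involution st.
Implicit Types x y z : R.

Lemma centralD x y : central x -> central y -> central (x + y).
Proof. by move=> cx cy z; apply/commr_sym/commrD; apply/commr_sym. Qed.
Lemma centralN x : central x -> central (- x).
Proof. by move=> cx z; apply/commr_sym/commrN/commr_sym. Qed.
Lemma centralB x y : central x -> central y -> central (x - y).
Proof. by move=> cx cy; apply/centralD/centralN. Qed.
Lemma centralM x y : central x -> central y -> central (x * y).
Proof. by move=> cx cy z; apply/commr_sym/commrM; apply/commr_sym. Qed.
Lemma central1 : central (1 : R).
Proof. by move=> z; apply/commr_sym/commr1. Qed.

Lemma symplectic_comm x : symplectic st -> st x * x = x * st x.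
Proof.
move=> sy; have := sy x x; rewrite /GRing.comm mulrDl mulrDr => /addrI.
by [].
Qed.

(** Up to terms commuting with x, the trace of x y is x y + y x - t y with t = x +
    st x. That this commutes with x says that x^2 - t x commutes with y. *)
Lemma symplectic_norm_central : symplectic st -> forall x, central (x * st x).
Proof.
move=> sy x y; set t := x + st x; have et : st x = t - x by rewrite /t addrC addKr.
have ct : central t := sy x.
have es z : st z = (z + st z) - z by rewrite addrC addKr.
have h : GRing.comm x (x * y + y * x - t * y).
  have := sy (x * y); rewrite (starM inv) et [st y]es => cz.
  have e : x * y + y * x - t * y = (x * y + (y + st y - y) * (t - x))
     - (y + st y) * t + (y + st y) * x + (y * t - t * y) by ncring.
  rewrite e -(ct y) subrr addr0; apply: commrD; first apply: commrB.
  - exact/commr_sym/cz.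
  - by apply: commrM; [exact/commr_sym/sy|exact/commr_sym/ct].
  - by apply: commrM => //; exact/commr_sym/sy.
have h2 : x * (x * y + y * x - t * y) - (x * y + y * x - t * y) * x = 0 by rewrite h subrr.
apply/eqP; rewrite -subr_eq0; apply/eqP; rewrite et.
have -> : x * (t - x) * y - y * (x * (t - x)) =
   t * (y * x) - (y * x) * t - (x * (x * y + y * x - t * y) - (x * y + y * x - t * y) * x).
  by ncring.
by rewrite h2 subr0 (ct (y * x)) subrr.
Qed.

Lemma norm_central_symplectic : (forall x, central (x * st x)) -> symplectic st.
Proof.
move=> h x; have -> : x + st x = (1 + x) * st (1 + x) - 1 - x * st x.
  by rewrite (starD inv) (star1 inv); ncring.
by apply: centralB => //; apply: centralB => //; exact: central1.
Qed.

(** The inner derivation d of an idempotent satisfies d^3 = d. *)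
Lemma derivation_idem e y N : e * e = e -> iter N (inner_der e) y = 0 -> y * e = e * y.
Proof.
move=> ee h; have d3 z : inner_der e (inner_der e (inner_der e z)) = inner_der e z.
  rewrite /inner_der.
  transitivity (z * (e * e * e) - e * e * e * z + (e * e * z * e - e * z * (e * e)) +
    (e * e * z * e - e * z * (e * e)) + (e * e * z * e - e * z * (e * e))); first by ncring.
  by rewrite !ee subrr !addr0.
have odd_iter k : iter k.*2.+1 (inner_der e) y = inner_der e y.
  by elim: k => // k IH; rewrite doubleS 2!iterS IH d3.
have it0 k : iter k (inner_der e) 0 = 0.
  by elim: k => // k IH; rewrite iterS IH /inner_der mul0r mulr0 subrr.
apply/eqP; rewrite -subr_eq0 -/(inner_der e y) -(odd_iter N).
by rewrite -addnn -addSn iterD h it0.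
Qed.

End Elementary.

Section DivisionC1.
Variables (D : unitRingType) (st : D -> D).
Hypothesis hD : GRing.field_axiom D.
Hypothesis inv : involution st.
Hypothesis normal : forall x, GRing.comm (st x) x.
Implicit Types (x y s k : D).

(** Linearise at x + s. *)
Lemma skew_comm_symmetric x s : st s = s -> GRing.comm (x - st x) s.
Proof.
move=> ss; have := normal (x + s); rewrite (starD inv) ss /GRing.comm.
rewrite !mulrDl !mulrDr normal => /eqP; rewrite -subr_eq0 => /eqP h.
apply/eqP; rewrite -subr_eq0; apply/eqP; rewrite -[RHS]oppr0 -[in RHS]h; ncring.
Qed.

(** If 2 is invertible, let k be a nonzero skew element, which exists unless st is
    the identity and D commutative. It commutes with symmetric s, so k s is skew and
    commutes with any symmetric s', which gives k s s' = k s' s. So symmetric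
    elements commute with each other and with skew ones. If 2 = 0, let t = x + st x
    fail to commute with y. For every symmetric s, both t y - y t and (t y - y t) s
    are in the centralizer of the symmetric elements, so these commute again.
    Conjugation by z preserves them, since z s z^-1 is z s st z divided by z st z,
    and [additive_step] shows that t commutes with y. *)
Lemma normal_symplectic : symplectic st.
Proof.
move=> x y; have [two|two] := eqVneq (2%:R : D) 0; last first.
  have u2 : (2%:R : D) \is a GRing.unit := hD two.
  have comm2 (a b : D) : GRing.comm (a + a) b -> GRing.comm a b.
    move=> h; rewrite /GRing.comm; apply: (mulrI u2); rewrite !mulr_natl !mulr2n.
    by rewrite -mulrDl h mulrDr.
  have skew_comm k s : st k = - k -> st s = s -> GRing.comm k s.
    move=> sk ss; apply: comm2; have := skew_comm_symmetric k ss.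
    by rewrite sk opprK.
  have sD z : st (z + st z) = z + st z by rewrite (starD inv) (starK inv) addrC.
  have sB z : st (z - st z) = - (z - st z) by rewrite (starB inv) (starK inv) opprB.
  have [hk|/existsNP[k /not_implyP[sk /eqP k0]]] := pselect (forall k, st k = - k -> k = 0).
    have id z : st z = z by apply/esym/eqP; rewrite -subr_eq0; apply/eqP/hk.
    by rewrite /GRing.comm -{1}[y]id -{1}[x + _]id -(starM inv) id.
  have SS s s' : st s = s -> st s' = s' -> GRing.comm s s'.
    move=> ss ss'; have ks := skew_comm k s sk ss.
    have : GRing.comm (k * s) s'.
      by apply: skew_comm => //; rewrite (starM inv) ss sk mulrN ks.
    have ks' := skew_comm k s' sk ss'.
    rewrite /GRing.comm mulrA -ks' -!mulrA.
    exact: (mulrI (hD k0)).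
  apply/commr_sym/comm2/commr_sym.
  have -> : y + y = (y + st y) + (y - st y) by rewrite addrACA subrr addr0.
  apply: commrD; first exact: SS.
  by apply/commr_sym/skew_comm.
have n2 (z : D) : - z = z.
  apply/eqP; rewrite eq_sym -addr_eq0 -mulr2n -mulr_natl two mul0r //.
have sD z : st (z + st z) = z + st z by rewrite (starD inv) (starK inv) addrC.
have kS z s : st s = s -> GRing.comm (z + st z) s.
  by move=> ss; rewrite -[st z]n2; apply: skew_comm_symmetric.
set t := x + st x; have [//|nty] := pselect (GRing.comm t y); exfalso; apply: (nty).
have st_t : st t = t := sD x.
have key z s : st s = s -> GRing.comm (t * z - z * t) s.
  move=> ss; pose w := z + st z; have sz : st z = w - z by rewrite /w addrC addKr.
  have -> : t * z - z * t = (t * z + st (t * z)) - w * t.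
    by rewrite (starM inv) st_t sz; ncring.
  apply/commr_sym/commrB; first exact/commr_sym/kS.
  by apply: commrM; apply/commr_sym/kS.
have uz : t * y - y * t \is a GRing.unit.
  by apply: hD; rewrite subr_eq0; apply/eqP.
have SS s s' : st s = s -> st s' = s' -> GRing.comm s s'.
  move=> ss ss'; have ts : GRing.comm t s by apply: kS.
  have := key (y * s) s' ss'.
  have -> : t * (y * s) - y * s * t = (t * y - y * t) * s.
    by rewrite mulrBl -!mulrA ts.
  have ks' := key y s' ss'.
  rewrite /GRing.comm mulrA -ks' -!mulrA.
  exact: (mulrI uz).
have conjS z s : z != 0 -> st s = s -> st (z * s * z^-1) = z * s * z^-1.
  move=> z0 ss; have uz' := hD z0; have usz := star_unit inv uz'.
  have sn : st (z * st z) = z * st z by rewrite (starM inv) (starK inv).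
  have un : z * st z \is a GRing.unit by rewrite unitrMl.
  have -> : z * s * z^-1 = (z * s * st z) * (z * st z)^-1.
    by rewrite invrM // !mulrA mulrK.
  have snV : st (z * st z)^-1 = (z * st z)^-1 by rewrite (starV inv) // sn.
  have szs : st (z * s * st z) = z * s * st z.
    by rewrite !(starM inv) (starK inv) ss mulrA.
  by rewrite (starM inv) snV szs; apply: SS.
have [->|y0] := eqVneq y 0; first exact: commr0.
have [y1|y1] := eqVneq (1 + y) 0.
  have -> : y = - 1 by apply/eqP; rewrite -addr_eq0 addrC y1.
  exact: commrN1.
have [] // := @additive_step D hD t t (y * t * y^-1) ((1 + y) * t * (1 + y)^-1) y.
- by apply: SS => //; apply: conjS.
- by apply: SS => //; apply: conjS.
- by rewrite mulrVK // hD.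
- by rewrite mulrVK // hD.
Qed.
End DivisionC1.

(** * Frobenius powers *)

Section FrobeniusPowers.
Variables (D : unitRingType) (p : nat).
Hypothesis hD : GRing.field_axiom D.
Hypothesis pD : p \in [pchar D].
Implicit Types (x y z s t u : D).

Let p_pr : prime p. Proof. exact: pcharf_prime pD. Qed.

Lemma pchar_expD e x y : GRing.comm x y -> (x + y) ^+ (p ^ e) = x ^+ (p ^ e) + y ^+ (p ^ e).
Proof.
move=> c; elim: e => [|e IH]; first by rewrite !expr1.
rewrite expnSr !exprM IH -!(pFrobenius_autE pD) pFrobenius_autD_comm //.
by apply: commrX; apply/commr_sym/commrX/commr_sym.
Qed.

Lemma pchar_expN e x : (- x) ^+ (p ^ e) = - x ^+ (p ^ e).
Proof.
by elim: e => [|e IH]; rewrite ?expr1 // expnSr !exprM IH -!(pFrobenius_autE pD) pFrobenius_autN.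
Qed.

(** Raising to a power of p is additive on commuting elements, and has no kernel. *)
Lemma pchar_exp_eq e x y : GRing.comm x y -> x ^+ (p ^ e) = y ^+ (p ^ e) -> x = y.
Proof.
move=> c /eqP; rewrite -subr_eq0 -pchar_expN -pchar_expD; last exact: commrN.
move=> h; apply/eqP; rewrite -subr_eq0; apply: contraTT h => h.
by rewrite -(div_unitE hD) unitrX // div_unitE.
Qed.

(** Such an x lies in a finite field. Concretely, the p-part of the order can be
    dropped by [pchar_exp_eq], and Euler's theorem applies to the rest. *)
Lemma torsion_pchar_fixed x : torsion x -> exists2 j, (0 < j)%N & x ^+ (p ^ j) = x.
Proof.
case=> n n0 en; pose m := (n`_p^')%N; have e1 : x ^+ m = 1.
  apply: (@pchar_exp_eq (logn p n)); first exact: commr1.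
  by rewrite -exprM expr1n -p_part mulnC partnC.
have cm : coprime p m by exact: (pnat_coprime (pnat_id p_pr) (part_pnat _ n)).
exists (totient m); first by rewrite totient_gt0 part_gt0.
by rewrite -(expr_mod _ e1) (Euler_exp_totient cm) (expr_mod _ e1) expr1.
Qed.

Lemma pchar_fixed_iter x j k : x ^+ (p ^ j) = x -> x ^+ (p ^ (j * k)) = x.
Proof.
move=> e; elim: k => [|k IH]; first by rewrite muln0 expr1.
by rewrite mulnS expnD exprM e.
Qed.

Lemma pchar_fixed_torsion x j : x != 0 -> (0 < j)%N -> x ^+ (p ^ j) = x -> torsion x.
Proof.
move=> x0 j0 e; exists (p ^ j).-1.
  by rewrite -subn1 subn_gt0 -(exp1n j) ltn_exp2r // prime_gt1.
apply: (mulrI (hD x0)); rewrite mulr1 -exprS prednK ?e //.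
by rewrite expn_gt0 prime_gt0.
Qed.

Lemma torsion_pcharX_comm x y e : torsion x -> GRing.comm (x ^+ (p ^ e)) y -> GRing.comm x y.
Proof.
move=> /torsion_pchar_fixed[j j0 ej] c.
rewrite -(@pchar_fixed_iter x j e ej).
have /subnKC <- : (e <= j * e)%N by rewrite leq_pmull.
by rewrite expnD exprM; apply/commr_sym/commrX/commr_sym.
Qed.

(** Otherwise some power q of p fixes x + y and x y. Then the q-th power permutes
    the roots x and y of a quadratic polynomial, so a power of q fixes x. *)
Lemma sum_or_product_nontorsion x y : GRing.comm x y -> x != 0 -> y != 0 -> ~ torsion x ->
  (x + y != 0 /\ ~ torsion (x + y)) \/ (x * y != 0 /\ ~ torsion (x * y)).
Proof.
move=> c x0 y0 nx; apply: contrapT => /not_orP[h1 h2]; apply: nx.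
have fixed z : ~ (z != 0 /\ ~ torsion z) -> exists2 j, (0 < j)%N & z ^+ (p ^ j) = z.
  have [->|z0 h] := eqVneq z 0.
    by exists 1%N; rewrite // expr0n eqn0Ngt expn_gt0 prime_gt0.
  by apply: torsion_pchar_fixed; apply: contrapT => nz; apply: h.
have [[j j0 ej] [k k0 ek]] := (fixed _ h1, fixed _ h2).
pose q := (p ^ (j * k))%N.
have es : (x + y) ^+ q = x + y by apply: pchar_fixed_iter.
have ep : (x * y) ^+ q = x * y by rewrite /q mulnC; apply: pchar_fixed_iter.
have jk0 : (0 < j * k)%N by rewrite muln_gt0 j0.
have cyx := commr_sym c.
have root z : z = x \/ z = y -> z ^+ q = x \/ z ^+ q = y.
  move=> zxy; have cz : GRing.comm z x /\ GRing.comm z y by case: zxy => ->.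
  have [czx czy] := cz.
  have czs : GRing.comm z (x + y) by apply: commrD.
  have czp : GRing.comm z (x * y) by apply: commrM.
  have csp : GRing.comm (x + y) (x * y).
    by apply: commrM; apply/commr_sym/commrD.
  have z0 : z * z - (x + y) * z + x * y = 0.
    case: zxy => ->; last by ncring.
    by rewrite mulrDl opprD addrA subrr add0r cyx addNr.
  have zq0 : z ^+ q * z ^+ q - (x + y) * z ^+ q + x * y = 0.
    have := congr1 (fun t => t ^+ q) z0; rewrite /= expr0n eqn0Ngt expn_gt0 prime_gt0 //=.
    rewrite pchar_expD; last first.
      apply/commr_sym/commrB; first by apply: commrM; apply/commr_sym.
      by apply: commrM; apply/commr_sym.
    rewrite pchar_expD; last first.
      by apply/commrN/commrM => //; apply/commr_sym/commrM; apply/commr_sym.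
    by rewrite pchar_expN !exprMn_comm // es ?(exprMn_comm _ cyx) -?exprMn_comm // ep.
  have e : (z ^+ q - x) * (z ^+ q - y) = 0.
    have -> : (z ^+ q - x) * (z ^+ q - y) = z ^+ q * z ^+ q - (x + y) * z ^+ q + x * y
       + (y * z ^+ q - z ^+ q * y) by ncring.
    by rewrite (commrX q (commr_sym czy)) subrr addr0.
  by case: (div_mulf_eq0 hD e) => /eqP; rewrite subr_eq0 => /eqP; [left|right].
have [ex|ey] := root x (or_introl erefl); first exact: pchar_fixed_torsion jk0 ex.
have eyq : y ^+ q = x.
  by apply: (addrI (x ^+ q)); rewrite -pchar_expD // es ey addrC.
apply: (@pchar_fixed_torsion x (j * k + j * k)) => //; first by rewrite addn_gt0 jk0.
by rewrite expnD exprM ey eyq.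
Qed.

(** The relation t x - x t = 1 in characteristic p. *)
Section Weyl.
Variables t x : D.
Hypothesis tx : t * x = x * t + 1.

Lemma weyl_pow n : t * x ^+ n.+1 = x ^+ n * (t * x + n%:R).
Proof.
elim: n => [|n IH]; first by rewrite expr0 mul1r addr0.
have key : (t * x + n%:R) * x = x * (t * x + n.+1%:R).
  have cn : x * n%:R = n%:R * x := commr_nat x n.
  by rewrite -natr1 !mulrDr cn mulr1 {1}tx !mulrDl mul1r mulrA -!addrA [_ + x]addrC.
by rewrite exprSr mulrA IH -mulrA key mulrA -exprSr.
Qed.

Lemma weyl_comm_pchar : GRing.comm t (x ^+ p).
Proof.
have [k ek] : exists k, p = k.+1 by exists p.-1; rewrite prednK // prime_gt0.
have p0 : k.+1%:R = 0 :> D by rewrite -ek; apply: pcharf0.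
by rewrite /GRing.comm ek weyl_pow tx -addrA nat1r p0 addr0 mulrA -exprSr.
Qed.

(** The product t^n x^n is the rising factorial of t x. *)
Lemma weyl_rising n : (\prod_(k < n) ('X + (k%:R)%:P)).[t * x] = t ^+ n * x ^+ n.
Proof.
elim: n => [|n IH]; first by rewrite big_ord0 hornerC mul1r.
have e : ('X + (n%:R)%:P).[t * x] = t * x + n%:R by rewrite hornerD hornerX hornerC.
rewrite big_ord_recr /= hornerM_comm; last first.
  by rewrite /comm_poly e; apply/commrD; [exact: commr_refl|exact: commr_nat].
by rewrite IH e -mulrA -weyl_pow mulrA -exprSr.
Qed.

End Weyl.

(** The elements of the prime field are the roots of X^p - X. *)
Lemma rising_prod_pchar : \prod_(k < p) ('X + (k%:R)%:P) = 'X^p - 'X :> {poly D}.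
Proof.
have p1 := prime_gt1 p_pr.
have sX : (size (- 'X : {poly D}) < size ('X^p : {poly D}))%N.
  by rewrite size_polyN size_polyX size_polyXn.
pose rs : seq D := [seq - k%:R | k <- iota 0 p].
have := @all_roots_prod_XsubC D ('X^p - 'X) rs.
rewrite lead_coefDl // lead_coefXn scale1r size_polyDl // size_polyXn size_map size_iota.
move=> /(_ erefl) ->; first by
  rewrite big_map -[X in iota 0 X]subn0 -/(index_iota 0 p) big_mkord; apply: eq_bigr => k _; rewrite polyCN opprK.
- apply/allP => _ /mapP[k _ ->]; rewrite /root !hornerE hornerXn.
  by rewrite -(pFrobenius_autE pD) pFrobenius_autN pFrobenius_aut_nat subrr.
- apply: div_uniq_roots hD _ _ _.
    rewrite map_inj_in_uniq ?iota_uniq // => i j.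
    rewrite !mem_iota /= !add0n => ip jp /oppr_inj e.
    wlog ij : i j ip jp e / (i <= j)%N.
      by move=> hw; case/orP: (leq_total i j) => l; [apply: hw|apply/esym/hw].
    have : (j - i)%:R == 0 :> D by rewrite natrB // e subrr.
    rewrite -(dvdn_pcharf pD) => /dvdn_leq; rewrite subn_gt0 => h.
    apply/eqP; rewrite eqn_leq ij /= leqNgt; apply/negP => /h.
    by rewrite leqNgt => /negP; apply; apply: leq_ltn_trans jp; rewrite leq_subr.
  move=> _ _ /mapP[i _ ->] /mapP[j _ ->]; apply/commrN/commr_sym/commrN/commr_sym.
  exact: commr_nat.
Qed.

(** Combine the two expressions of X (X + 1) ... (X + p - 1) at t x. *)
Lemma weyl_pchar t x : t * x = x * t + 1 -> (t * x) ^+ p = t * x + t ^+ p * x ^+ p.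
Proof.
move=> tx; have := weyl_rising tx p.
by rewrite rising_prod_pchar hornerD hornerN hornerX hornerXn => <-; rewrite addrC subrK.
Qed.

Lemma weyl_pcharX t x e : t * x = x * t + 1 ->
  (t * x) ^+ (p ^ e) = \sum_(i < e.+1) t ^+ (p ^ i) * x ^+ (p ^ i).
Proof.
move=> tx; have ctx := weyl_comm_pchar tx.
have cxt : GRing.comm x (t ^+ p).
  have : (- x) * t = t * (- x) + 1 by rewrite mulrN mulNr tx opprD addrNK.
  by move/weyl_comm_pchar => h; rewrite -[x]opprK; apply/commr_sym/commrN/commr_sym.
elim: e => [|e IH]; first by rewrite big_ord1.
rewrite big_ord_recr /= {1}expnS exprM weyl_pchar // pchar_expD; last first.
  apply: commrM.
    by apply/commr_sym/commrM; apply/commr_sym; [exact: commrX|apply/commr_sym].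
  by apply/commr_sym/commrM; apply/commr_sym => //; apply: commrX.
rewrite IH; congr (_ + _); rewrite exprMn_comm -?exprM -?expnS //.
by apply/commr_sym/commrX/commr_sym.
Qed.

End FrobeniusPowers.

(** * Frobenius powers that commute with the image *)

Section InnerDerivation.
Variable R : nzRingType.
Implicit Types x y : R.

Lemma iter_inner_der x y n : iter n (inner_der x) y =
  \sum_(i < n.+1) ((-1) ^+ i * (x ^+ i * y * x ^+ (n - i))) *+ 'C(n, i).
Proof.
elim: n => [|n IH]; first by rewrite big_ord1 /= !mul1r mulr1.
have L : (\sum_(i < n.+1) ((-1) ^+ i * (x ^+ i * y * x ^+ (n - i))) *+ 'C(n, i)) * x
   = \sum_(i < n.+1) ((-1) ^+ i * (x ^+ i * y * x ^+ (n.+1 - i))) *+ 'C(n, i).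
  rewrite mulr_suml; apply: eq_bigr => i _.
  by rewrite mulrnAl -!mulrA -exprSr subSn // -ltnS.
have R' : x * (\sum_(i < n.+1) ((-1) ^+ i * (x ^+ i * y * x ^+ (n - i))) *+ 'C(n, i))
   = - \sum_(i < n.+1) ((-1) ^+ i.+1 * (x ^+ i.+1 * y * x ^+ (n - i))) *+ 'C(n, i).
  rewrite mulr_sumr -sumrN; apply: eq_bigr => i _.
  rewrite mulrnAr -mulNrn exprS mulN1r mulNr opprK exprS !mulrA.
  by rewrite -[x * (-1) ^+ i]/(_ * _) (commr_sign x i).
rewrite iterS IH {1}/inner_der L R' opprK [RHS]big_ord_recl.
under [X in _ = _ + X]eq_bigr => i _ do rewrite lift0 binS mulrnDr subSS.
rewrite big_split /= addrA; congr (_ + _).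
rewrite big_ord_recl subn0 !bin0; congr (_ + _).
by rewrite [RHS]big_ord_recr /= bin_small // mulr0n addr0; apply: eq_bigr => i _; rewrite subSS.
Qed.

(** The binomial coefficients of p vanish in characteristic p. *)
Lemma inner_der_pchar p x y e : p \in [pchar R] ->
  iter (p ^ e) (inner_der x) y = inner_der (x ^+ (p ^ e)) y.
Proof.
move=> pR; have p_pr := pcharf_prime pR.
have base (z w : R) : iter p (inner_der z) w = inner_der (z ^+ p) w.
  rewrite iter_inner_der; move: (pR); case: (p) (p_pr) => // k _ kR.
  rewrite big_ord_recl big_ord_recr /= big1 => [|i _]; last first.
    by rewrite /bump leq0n add1n -mulr_natr (bin_lt_pcharf_0 kR) ?mulr0 //= ltnS.
  rewrite /bump leq0n add1n add0r subn0 subnn bin0 binn !mul1r mulr1 /inner_der.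
  by rewrite -[(-1) ^+ _](pFrobenius_autE kR) pFrobenius_autN pFrobenius_aut1 mulN1r.
elim: e x y => [|e IH] x y //.
rewrite expnS exprM -IH mulnC; elim: (p ^ e)%N => // k IHk.
by rewrite mulSn iterD IHk base iterS.
Qed.

End InnerDerivation.

Section SymmetricNontorsion.
Variables (D : unitRingType) (p : nat) (st : D -> D).
Hypothesis hD : GRing.field_axiom D.
Hypothesis pD : p \in [pchar D].
Hypothesis inv : involution st.

(** The elements x^q and its image commute with x, with st x and with each other, so
    their sum and product do, and both are symmetric. *)
Lemma symmetric_nontorsion x q : (0 < q)%N -> GRing.comm (x ^+ q) (st x) -> x != 0 -> ~ torsion x ->
  exists th, (forall K, division_subring K -> K x -> K (st x) -> K th) /\
   [/\ st th = th, GRing.comm th x, GRing.comm th (st x), th != 0 & ~ torsion th].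
Proof.
move=> q0 cXy x0 nx; set y := st x in cXy *; have sy : st y = x by rewrite /y (starK inv).
have cYx : GRing.comm (y ^+ q) x.
  have := star_comm inv (commr_sym cXy); rewrite sy (starX inv) -/y.
  exact: commr_sym.
have y0 : y != 0 by apply: contra_neq x0 => h; rewrite -sy h (star0 inv).
have cXY : GRing.comm (x ^+ q) (y ^+ q) by apply: commrX.
have X0 : x ^+ q != 0 by rewrite -(div_unitE hD) unitrX // div_unitE.
have Y0 : y ^+ q != 0 by rewrite -(div_unitE hD) unitrX // div_unitE.
have nX : ~ torsion (x ^+ q) by move/(torsion_root q0).
have sX : st (x ^+ q) = y ^+ q by rewrite (starX inv).
have sY : st (y ^+ q) = x ^+ q by rewrite (starX inv) sy.
have cxX z : GRing.comm (z ^+ q) z by apply/commr_sym/commrX.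
have [[h0 h]|[h0 h]] := sum_or_product_nontorsion hD pD cXY X0 Y0 nX.
  exists (x ^+ q + y ^+ q); split; first by move=> K dK Kx Ky; apply: dsrD => //; apply: dsrX.
  split=> //; first by rewrite (starD inv) sX sY addrC.
    by apply/commr_sym/commrD; apply/commr_sym.
  by apply/commr_sym/commrD; apply/commr_sym.
exists (x ^+ q * y ^+ q); split; first by move=> K dK Kx Ky; apply: (dsrM dK); apply: dsrX.
split=> //; first by rewrite (starM inv) sX sY.
  by apply/commr_sym/commrM; apply/commr_sym.
by apply/commr_sym/commrM; apply/commr_sym.
Qed.

End SymmetricNontorsion.

(** The division subring K is all of D for nilpotent inner derivations, and the
    centralizer of a symmetric element for commuting powers. *)
Section FrobeniusNormal.
Variables (D : unitRingType) (p : nat) (st : D -> D) (K : D -> Prop).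
Hypothesis hD : GRing.field_axiom D.
Hypothesis pD : p \in [pchar D].
Hypothesis inv : involution st.
Hypothesis dK : division_subring K.
Hypothesis stK : forall x, K x -> K (st x).
Hypothesis hK : forall w, K w -> exists e, GRing.comm (w ^+ (p ^ e)) (st w).
Implicit Types (x y t w z : D).

Let p_pr : prime p. Proof. exact: pcharf_prime pD. Qed.

Lemma comm_pcharX_leq w z d e : (d <= e)%N -> GRing.comm (w ^+ (p ^ d)) z ->
  GRing.comm (w ^+ (p ^ e)) z.
Proof.
by move=> /subnKC <- c; rewrite expnD exprM; apply/commr_sym/commrX/commr_sym.
Qed.

(** Elements of K in the double centralizer of x and y; whatever is built from x and
    y by ring operations and inverses is one. *)
Let generated x y a := K a /\ forall z, GRing.comm z x -> GRing.comm z y -> GRing.comm z a.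

(** The inner derivation of x is nilpotent on y. If c is its last nonzero iterate at
    y and b the one before, then c commutes with x and c^-1 b is as required. *)
Lemma weyl_partner x y e : K x -> K y -> GRing.comm (x ^+ (p ^ e)) y ->
  ~ GRing.comm x y -> exists2 t, generated x y t & t * x = x * t + 1.
Proof.
move=> Kx Ky ce nc; have gd a : generated x y a -> generated x y (inner_der x a).
  move=> [Ka ha]; split; first by apply: (dsrB dK); apply: (dsrM dK).
  by move=> z zx zy; apply: commrB; apply: commrM => //; apply: ha.
have gi k : generated x y (iter k (inner_der x) y).
  by elim: k => [|k IH]; [split|exact: gd].
have ex : exists k, iter k (inner_der x) y == 0.
  by exists (p ^ e)%N; rewrite inner_der_pchar // /inner_der ce subrr.
case: (ex_minnP ex) => -[|[|k]] /=.
- by move=> /eqP h _; case: nc; rewrite h; exact: commr0.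
- by rewrite subr_eq0 => /eqP h _; case: nc; rewrite /GRing.comm h.
move=> /eqP c0 kmin; pose b := iter k (inner_der x) y.
have gb : generated x y b by apply: gi. have [Kb hb] := gb.
pose c := inner_der x b; have [Kc hc] : generated x y c by apply: gd gb.
have cn0 : c != 0 by apply/negP => /(kmin k.+1); rewrite ltnn.
have cxc : GRing.comm x c^-1.
  apply: commrV; move/eqP: c0; rewrite -/b -/c {1}/inner_der subr_eq0 => /eqP h.
  by rewrite /GRing.comm h.
exists (c^-1 * b).
  split; first by apply: (dsrM dK) => //; apply: (dsrV dK).
  by move=> z zx zy; apply: commrM; [apply/commrV/hc|apply: hb].
apply/eqP; rewrite addrC -subr_eq mulrA cxc -!mulrA -mulrBr -/(inner_der x b) -/c.
by rewrite mulVr // hD.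
Qed.

(** The exponent may be increased, so finitely many elements share one. *)
Lemma uniform_frobenius (w : nat -> D) e0 N : (forall i, K (w i)) -> exists2 e, (e0 <= e)%N &
  forall i, (i < N)%N -> GRing.comm (w i ^+ (p ^ e)) (st (w i)).
Proof.
move=> Kw; elim: N => [|N [e le he]]; first by exists e0.
have [d hd] := hK (Kw N); exists (maxn e d); first by rewrite leq_max le.
move=> i; rewrite ltnS leq_eqVlt => /orP[/eqP->|/he {}hd].
  by apply: comm_pcharX_leq hd; rewrite leq_maxr.
by apply: comm_pcharX_leq hd; rewrite leq_maxl.
Qed.

(** Let x not commute with y = st x, let e be minimal such that x^(p^(e+1)) commutes
    with y, and let d = p^e. Take t from [weyl_partner], and let g range over the
    powers of a symmetric th of infinite order commuting with x and y. By
    [weyl_pcharX], w = (t + g) x has w^(p^E) = c + sum_j x^(p^j) g^(p^j), where c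
    does not involve g, and st w = y st t + y g. The terms with j > e commute with
    st w and can be dropped, so that the commutator of the rest with st w is a
    polynomial of degree d + 1 in g, whatever E is. It vanishes for d + 2 values of
    g with a common E, but its leading coefficient is the commutator of x^d and y.
    *)
Lemma frobenius_normal x : K x -> GRing.comm x (st x).
Proof.
move=> Kx; apply: contrapT => nc; have Ky := stK Kx.
set y := st x in nc Ky; have sy : st y = x by rewrite /y (starK inv).
have ex : exists e, `[< GRing.comm (x ^+ (p ^ e)) y >].
  by have [e he] := hK Kx; exists e; apply/asboolP.
case: (ex_minnP ex) => -[|e] /asboolP ce emin; first by case: nc; rewrite expr1 in ce.
have {emin}nce : ~ GRing.comm (x ^+ (p ^ e)) y.
  by move=> h; have := emin e (asboolT h); rewrite ltnn.
have x0 : x != 0 by apply: contra_not_neq nc => ->; apply/commr_sym/commr0.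
have nx : ~ torsion x by move=> tx; apply: nc; apply: (torsion_pcharX_comm hD pD tx ce).
pose q := (p ^ e.+1)%N; have q0 : (0 < q)%N by rewrite expn_gt0 prime_gt0.
have cXy : GRing.comm (x ^+ q) y by [].
have [th [Kth [sth thx thy th0 nth]]] := symmetric_nontorsion hD pD inv q0 cXy x0 nx.
have {}Kth : K th by apply: Kth.
have [t [Kt ht] tx] := weyl_partner Kx Ky ce nc.
(* the powers of th are distinct as th has infinite order *)
pose g i := th ^+ i; have gx i : GRing.comm (g i) x by apply/commr_sym/commrX/commr_sym.
have gy i : GRing.comm (g i) y by apply/commr_sym/commrX/commr_sym.
have gt i : GRing.comm (g i) t by apply: ht.
have sg i : st (g i) = g i by rewrite /g (starX inv) sth.
have gst i : GRing.comm (g i) (st t) by rewrite -[g i]sg; apply/(star_comm inv).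
have gg i j : GRing.comm (g i) (g j) by apply/commrX/commr_sym/commrX.
have ginj : injective g := powers_inj hD th0 nth.
pose w i := (t + g i) * x; have Kg i : K (g i) by apply: dsrX.
have Kw i : K (w i) by apply: (dsrM dK) => //; apply: (dsrD dK).
pose d := (p ^ e)%N; have [E leE hE] := uniform_frobenius e.+1 d.+2 Kw.
have d0 : (0 < d)%N by rewrite expn_gt0 prime_gt0.
have sw i : st (w i) = y * st t + y * g i.
  by rewrite /w (starM inv) (starD inv) sg -/y mulrDr.
pose c := \sum_(i < E.+1) t ^+ (p ^ i) * x ^+ (p ^ i).
have wE i : w i ^+ (p ^ E) = c + \sum_(j < E.+1) x ^+ (p ^ j) * g i ^+ (p ^ j).
  rewrite weyl_pcharX // ?big_split /=; last first.
    by rewrite mulrDl mulrDr tx (gx i) addrAC.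
  rewrite -big_split; apply: eq_bigr => j _ /=.
  rewrite pchar_expD // ; last exact/commr_sym/gt.
  by rewrite mulrDl; congr (_ + _); apply/commrX/commr_sym/commrX/commr_sym.
pose Q : {poly D} := c%:P + \sum_(j < e.+1) (x ^+ (p ^ j))%:P * 'X^(p ^ j).
pose R : {poly D} := (y * st t)%:P + y%:P * 'X.
have gcomm i z : GRing.comm z (g i) -> GRing.comm (g i) z by apply: commr_sym.
have Rg i : R.[g i] = st (w i).
  by rewrite sw /R hornerD hornerC hornerCM hornerX.
have Qg i : Q.[g i] = c + \sum_(j < e.+1) x ^+ (p ^ j) * g i ^+ (p ^ j).
  rewrite /Q hornerD hornerC horner_sum; congr (_ + _); apply: eq_bigr => j _.
  by rewrite hornerCM hornerXn.
have cR i : comm_poly R (g i).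
  rewrite /comm_poly Rg sw; apply: commrD; apply: commrM => //.
have cc i : GRing.comm (g i) c.
  by apply: commr_sum => j _; apply: commrM; apply: commrX.
have cQ i : comm_poly Q (g i).
  rewrite /comm_poly Qg; apply: commrD => //; apply: commr_sum => j _.
  by apply: commrM; apply: commrX.
have cxm m : (e < m)%N -> GRing.comm (x ^+ (p ^ m)) y.
  by move=> le; apply: comm_pcharX_leq ce.
have cQR i : (i < d.+2)%N -> GRing.comm Q.[g i] R.[g i].
  move=> /hE; rewrite wE -(subnKC leE) -addnS big_split_ord /= addrA -Qg -Rg.
  set b := \sum_(_ < _.+1) _ => h.
  have cb : GRing.comm b R.[g i].
    apply/commr_sym/commr_sum => k _; rewrite Rg sw; set m := (_ + _)%N.
    have lm : (e < m)%N by rewrite /m addSn ltnS leq_addr.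
    have cxt : GRing.comm (x ^+ (p ^ m)) (st t).
      rewrite -[x ^+ _](starK inv); apply/(star_comm inv)/ht; rewrite (starX inv) -/y.
        by have := star_comm inv (commr_sym (cxm m lm)); rewrite sy (starX inv) => /commr_sym.
      by apply/commr_sym/commrX.
    apply/commr_sym/commrD; apply: commrM.
    - by apply/commr_sym/commrM; [exact/commr_sym/cxm|exact/commrX/commr_sym].
    - by apply/commr_sym/commrM; [exact/commr_sym|exact/commrX/commr_sym].
    - by apply/commr_sym/commrM; [exact/commr_sym/cxm|exact/commrX/commr_sym].
    - by apply/commr_sym/commrM; [exact/commrX|exact/commrX].
  have -> : Q.[g i] = (Q.[g i] + b) - b by rewrite addrK.
  by apply/commr_sym/commrB; apply/commr_sym.
have szQ : (size Q <= d.+1)%N.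
  apply: (leq_trans (size_polyD _ _)); rewrite geq_max size_polyC.
  apply/andP; split; first by case: (c != 0).
  apply: (leq_trans (size_sum _ _ _)); apply/bigmax_leqP => j _.
  apply: (leq_trans (size_polyMleq _ _)); rewrite size_polyXn addnS /=.
  rewrite size_polyC; have lj : (p ^ j <= d)%N by rewrite leq_exp2l ?prime_gt1 // -ltnS.
  by case: (_ != 0); rewrite ?add1n ?add0n ?ltnS // (leq_trans lj).
have szR : (size R <= 2)%N.
  apply: (leq_trans (size_polyD _ _)); rewrite geq_max size_polyC.
  apply/andP; split; first by case: (_ != 0).
  apply: (leq_trans (size_polyMleq _ _)); rewrite size_polyX addnS /= size_polyC.
  by case: (_ != 0).
have P0 : Q * R - R * Q = 0.
  apply: (poly_infinite_roots hD ginj gg) => i li.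
  rewrite hornerD hornerN !hornerM_comm // cQR ?subrr //.
  apply: (leq_trans li); apply: (leq_trans (size_polyD _ _)); rewrite geq_max size_polyN.
  have h1 : ((size Q + size R).-1 <= d.+2)%N.
    by have := leq_add szQ szR; rewrite addn2; case: (_ + _)%N.
  apply/andP; split; apply: (leq_trans (size_polyMleq _ _)) => //.
  by rewrite addnC.
have Qd : Q`_d = x ^+ (p ^ e).
  rewrite coefD coefC eqn0Ngt d0 add0r coef_sum big_ord_recr /= big1 => [|j _].
    by rewrite add0r coefCM coefXn eqxx mulr1.
  by rewrite coefCM coefXn eqn_exp2l ?prime_gt1 // gtn_eqF // mulr0.
have QS : Q`_d.+1 = 0 by rewrite nth_default.
have P1 : Q * (y * st t)%:P + Q * y%:P * 'X - ((y * st t)%:P * Q + y%:P * (Q * 'X)) = 0.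
  by clearbody Q; rewrite -[RHS]P0 /R mulrDr mulrDl -!mulrA -(commr_polyX Q).
apply: nce; have := congr1 (fun P : {poly D} => P`_d.+1) P1.
rewrite /= coef0 coefB !coefD coefMC !coefCM !coefMX /= coefMC QS Qd mul0r mulr0 !add0r.
by move/eqP; rewrite subr_eq0 => /eqP.
Qed.

End FrobeniusNormal.

(** * Nilpotent inner derivations *)

Section LeibnizTop.
Variable R : nzRingType.
Implicit Types (x a b : R).

Lemma iter_inner_derD x n a b : iter n (inner_der x) (a + b) =
  iter n (inner_der x) a + iter n (inner_der x) b.
Proof.
by elim: n => // n IH; rewrite !iterS IH /inner_der; ncring.
Qed.

Lemma iter_inner_der_mulr x n a b : inner_der x a = 0 ->
  iter n (inner_der x) (a * b) = a * iter n (inner_der x) b.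
Proof.
move=> h; elim: n => // n IH; rewrite !iterS IH /inner_der.
have -> : x * (a * iter n (inner_der x) b) = a * x * iter n (inner_der x) b - inner_der x a * iter n (inner_der x) b.
  by rewrite /inner_der; ncring.
by rewrite h mul0r subr0; ncring.
Qed.

Lemma iter_inner_der_mull x n a b : inner_der x b = 0 ->
  iter n (inner_der x) (a * b) = iter n (inner_der x) a * b.
Proof.
move=> h; elim: n => // n IH; rewrite !iterS IH /inner_der.
have -> : iter n (inner_der x) a * b * x = iter n (inner_der x) a * inner_der x b + iter n (inner_der x) a * x * b.
  by rewrite /inner_der; ncring.
by rewrite h mulr0 add0r; ncring.
Qed.

(** Only one term of Leibniz's formula survives. *)
Lemma leibniz_top x m l a b : iter m.+1 (inner_der x) a = 0 -> iter l.+1 (inner_der x) b = 0 ->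
  iter (m + l) (inner_der x) (a * b) =
    (iter m (inner_der x) a * iter l (inner_der x) b) *+ 'C(m + l, m).
Proof.
elim: m l a b => [|m IHm] l a b.
  by rewrite bin0 mulr1n => h _; apply: iter_inner_der_mulr.
elim: l a b => [|l IHl] a b ha hb.
  by rewrite addn0 binn mulr1n; apply: iter_inner_der_mull.
rewrite addSn iterSr.
have -> : inner_der x (a * b) = inner_der x a * b + a * inner_der x b.
  by rewrite /inner_der; ncring.
rewrite iter_inner_derD IHm; [|by rewrite -iterSr|by []].
rewrite -[X in _ + X = _]/(iter _ _ _) -addSnnS IHl; [|by []|by rewrite -iterSr].
by rewrite -!iterSr (binS (m.+1 + l)%N m) [RHS]mulrnDr addrC.
Qed.

End LeibnizTop.

Section EngelNormal.
Variables (D : unitRingType) (st : D -> D).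
Hypothesis hD : GRing.field_axiom D.
Hypothesis inv : involution st.
Hypothesis engel : forall x, exists N : nat, iter N (inner_der x) (st x) = 0.
Implicit Types (x y : D).

(** The inner derivation of x^-1 takes z to - x^-1 d(z) x^-1, where d is that of x.
    *)
Lemma inner_derV x n y : x \is a GRing.unit -> exists2 u, u \is a GRing.unit &
  exists2 v, v \is a GRing.unit & iter n (inner_der x^-1) y = u * iter n (inner_der x) y * v.
Proof.
move=> ux; suff e : iter n (inner_der x^-1) y =
    ((-1) ^+ n * x^-1 ^+ n) * iter n (inner_der x) y * x^-1 ^+ n.
  exists ((-1) ^+ n * x^-1 ^+ n).
    by rewrite unitrMl ?unitrX ?unitrN1 ?unitrV.
  by exists (x^-1 ^+ n); rewrite ?unitrX ?unitrV.
elim: n => [|n IH]; first by rewrite !expr0 !mul1r mulr1.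
rewrite !iterS IH; set w := iter n _ y; rewrite /inner_der.
have [r er] : exists r, r = (-1) ^+ n * x^-1 ^+ n by eexists.
have cr : x^-1 * r = r * x^-1.
  by rewrite er; apply: commrM; [exact: commr_sign|exact: commrX].
have -> : (-1) ^+ n.+1 * x^-1 ^+ n.+1 = - (r * x^-1).
  by rewrite er exprS exprSr mulN1r mulNr mulrA.
rewrite -er exprS; set s := x^-1 ^+ n.
have cs : s * x^-1 = x^-1 * s by apply/commr_sym/commrX.
transitivity (r * w * (s * x^-1) - (x^-1 * r) * w * s); first by ncring.
rewrite cs cr; transitivity (r * w * (x^-1 * s) - r * x^-1 * w * (x * x^-1) * s).
  by rewrite mulrV // mulr1.
transitivity (r * (x^-1 * x) * w * (x^-1 * s) - r * x^-1 * w * (x * x^-1) * s).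
  by rewrite mulVr // mulr1.
by ncring.
Qed.

(** Let m and l be the largest orders at which the derivation d of x does not kill y
    = st x and y^-1. Then d^(m + l) of y y^-1 is a nonzero multiple of a product of
    nonzero elements, so m + l = 0. That d is nilpotent on y^-1 is the hypothesis
    for x^-1. *)
Lemma engel_normal : (forall n, (0 < n)%N -> n%:R != 0 :> D) ->
  forall x, GRing.comm (st x) x.
Proof.
move=> ch0 x; have [->|x0] := eqVneq x 0; first exact: commr0.
have ux := hD x0; have uy := star_unit inv ux.
have [N hN] := engel x; have [M hM] := engel x^-1.
have hM' : iter M (inner_der x) (st x)^-1 = 0.
  have [u uu [v uv e]] := inner_derV M (st x)^-1 ux.
  move: hM; rewrite (starV inv) // e => h; apply: (mulrI uu); apply: (mulIr uv).
  by rewrite h mulr0 mul0r.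
have top a k : a != 0 -> iter k (inner_der x) a = 0 -> exists2 m,
    iter m (inner_der x) a != 0 & iter m.+1 (inner_der x) a = 0.
  elim: k => [|k IH] a0 h; first by move: h => /= h; rewrite h eqxx in a0.
  have [h'|h'] := eqVneq (iter k (inner_der x) a) 0; first exact: IH.
  by exists k.
have y0 : st x != 0 by rewrite -(div_unitE hD).
have yV0 : (st x)^-1 != 0 by rewrite invr_eq0.
have [m m0 mS] := top _ _ y0 hN; have [l l0 lS] := top _ _ yV0 hM'.
have := leibniz_top mS lS; rewrite divrr // => h.
case: m m0 mS h => [|m] m0 mS h.
  by apply/eqP; rewrite -subr_eq0; apply/eqP.
have z k : iter k.+1 (inner_der x) 1 = 0.
  elim: k => [|k IH]; first by rewrite /= /inner_der mul1r mulr1 subrr.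
  by rewrite iterS IH /inner_der mul0r mulr0 subrr.
move: h; rewrite addSn z -mulr_natr => /esym/(div_mulf_eq0 hD)[/(div_mulf_eq0 hD)[]|] /eqP.
- by rewrite (negPf m0).
- by rewrite (negPf l0).
- by rewrite (negPf (ch0 _ _)) // bin_gt0 -addSn leq_addr.
Qed.

End EngelNormal.

Section EngelNormalAll.
Variables (D : unitRingType) (st : D -> D).
Hypothesis hD : GRing.field_axiom D.
Hypothesis inv : involution st.
Hypothesis engel : forall x, exists N : nat, iter N (inner_der x) (st x) = 0.

(** In characteristic p, the p^N-th iterate of the derivation of w is the derivation
    of w^(p^N), so a p-power of w commutes with st w. *)
Lemma engel_division_normal x : GRing.comm (st x) x.
Proof.
have [[p pD]|ch0] := pchar_cases hD; last exact: engel_normal.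
apply/commr_sym; apply: (@frobenius_normal D p st (fun _ => True)) => // w _.
have [N hN] := engel w; exists N.
have p1 : (1 < p)%N by apply/prime_gt1/(pcharf_prime pD).
suff h : inner_der (w ^+ (p ^ N)) (st w) = 0.
  by apply/esym/eqP; rewrite -subr_eq0; apply/eqP.
rewrite -(inner_der_pchar _ _ _ pD).
have /subnK <- : (N <= p ^ N)%N by apply/ltnW/ltn_expl.
rewrite iterD hN; elim: (_ - _)%N => // k IH.
by rewrite iterS IH /inner_der mul0r mulr0 subrr.
Qed.
End EngelNormalAll.

(** * The determinant trick for bimodules *)

Section Determinants.
Variables (C : comNzRingType) (R : nzRingType) (ev : {rmorphism C -> R}).

Definition lin_span (I : finType) (v : I -> R) (u : R) :=
  exists r : I -> C, u = \sum_i ev (r i) * v i.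

Section LinSpan.
Variables (I : finType) (v : I -> R).

Lemma lin_span0 : lin_span v 0.
Proof. by exists (fun _ => 0); rewrite big1 // => i _; rewrite rmorph0 mul0r. Qed.

Lemma lin_spanD u u' : lin_span v u -> lin_span v u' -> lin_span v (u + u').
Proof.
move=> [r ->] [r' ->]; exists (fun i => r i + r' i); rewrite -big_split.
by apply: eq_bigr => i _; rewrite rmorphD mulrDl.
Qed.

Lemma lin_spanZ c u : lin_span v u -> lin_span v (ev c * u).
Proof.
move=> [r ->]; exists (fun i => c * r i); rewrite mulr_sumr.
by apply: eq_bigr => i _; rewrite rmorphM mulrA.
Qed.

Lemma lin_span_gen i : lin_span v (v i).
Proof.
exists (fun j => (j == i)%:R); rewrite (bigD1 i) //= eqxx rmorph1 mul1r big1 ?addr0 //.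
by move=> j ji; rewrite (negPf ji) rmorph0 mul0r.
Qed.

Lemma lin_span_sum J (s : seq J) (u : J -> R) : (forall j, lin_span v (u j)) ->
  lin_span v (\sum_(j <- s) u j).
Proof.
move=> h; elim/big_ind: _ => [||j _]; [exact: lin_span0|exact: lin_spanD|exact: h].
Qed.

End LinSpan.

(** Multiply by the adjugate matrix. *)
Lemma det_kill n (A : 'M[C]_n) (v : 'I_n -> R) :
  (forall k, \sum_l ev (A k l) * v l = 0) -> forall i, ev (\det A) * v i = 0.
Proof.
move=> h i; transitivity (\sum_l ev ((\adj A *m A) i l) * v l).
  rewrite mul_adj_mx (bigD1 i) //= mxE eqxx mulr1n big1 ?addr0 // => l li.
  by rewrite mxE eq_sym (negPf li) mulr0n rmorph0 mul0r.
transitivity (\sum_k ev (\adj A i k) * \sum_l ev (A k l) * v l).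
  under [RHS]eq_bigr => k _ do rewrite mulr_sumr.
  rewrite exchange_big /=; apply: eq_bigr => l _.
  rewrite mxE rmorph_sum mulr_suml; apply: eq_bigr => k _.
  by rewrite rmorphM mulrA.
by rewrite big1 // => k _; rewrite h mulr0.
Qed.

(** Both sides agree at a = 0, and the determinant is a polynomial in a. *)
Lemma det_mod n (B : 'M[C]_n) (d a : C) : exists c, \det (d%:M - a *: B) = d ^+ n + a * c.
Proof.
pose P := \det (map_mx polyC d%:M - 'X *: map_mx polyC B).
have PE b : P.[b] = \det (d%:M - b *: B).
  rewrite -[LHS]/(horner_eval b P) -det_map_mx; congr (\det _).
  apply/matrixP => i j; rewrite !mxE /= /horner_eval hornerD hornerN hornerM hornerX.
  by rewrite !hornerC.
have h (Q : {poly C}) : exists c, Q.[a] = Q.[0] + a * c.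
  elim/poly_ind: Q => [|Q c _]; first by exists 0; rewrite !horner0 mulr0 addr0.
  by exists Q.[a]; rewrite !hornerMXaddC mulr0 add0r addrC mulrC.
have [c hc] := h P; exists c; rewrite -PE hc PE scale0r subr0 det_scalar.
by [].
Qed.

Lemma determinant_trick (I : finType) (v u : I -> R) d a :
  (forall i, lin_span v (u i)) -> (forall i, ev d * v i = ev a * u i) ->
  exists k c, forall i, ev (d ^+ k + a * c) * v i = 0.
Proof.
move=> /choice[B hB] e; pose n := #|I|.
pose B' : 'M[C]_n := \matrix_(k, l) B (enum_val k) (enum_val l).
pose A : 'M[C]_n := d%:M - a *: B'; have [c hc] := det_mod B' d a.
exists n, c => i; rewrite -hc -[i]enum_rankK.
suff h k : \sum_l ev (A k l) * v (enum_val l) = 0 by exact: (@det_kill n A (fun k => v (enum_val k)) h (enum_rank i)).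
transitivity (ev d * v (enum_val k) - ev a * u (enum_val k)); last by rewrite e subrr.
rewrite hB [in RHS](reindex_onto enum_val enum_rank) /= => [|j _]; last exact: enum_rankK.
rewrite [in RHS](eq_bigl xpredT) => [|l]; last by rewrite enum_valK eqxx.
rewrite mulr_sumr.
transitivity (\sum_l (ev (d *+ (k == l)) * v (enum_val l) -
   ev a * (ev (B (enum_val k) (enum_val l)) * v (enum_val l)))).
  by apply: eq_bigr => l _; rewrite !mxE rmorphB mulrBl rmorphM mulrA.
rewrite big_split /= sumrN; congr (_ - _).
rewrite (bigD1 k) //= eqxx mulr1n big1 ?addr0 // => l lk.
by rewrite eq_sym (negPf lk) mulr0n rmorph0 mul0r.
Qed.

Section Nakayama.
Variables (z y1 : R) (M : nat).
Hypothesis evz : forall c, GRing.comm (ev c) z.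
Hypothesis evy : forall c, GRing.comm (ev c) y1.
Hypothesis intz : lin_span (fun i : 'I_M => z ^+ i) (z ^+ M).

Let bi (p : 'I_M * 'I_M) := z ^+ p.1 * y1 * z ^+ p.2.

Let span_powers n : lin_span (fun i : 'I_M => z ^+ i) (z ^+ n).
Proof.
have step u : lin_span (fun i : 'I_M => z ^+ i) u -> lin_span (fun i : 'I_M => z ^+ i) (z * u).
  move=> [r ->]; rewrite mulr_sumr; apply: lin_span_sum => i.
  rewrite mulrA -evz -mulrA -exprS; apply: lin_spanZ.
  have := ltn_ord i; rewrite leq_eqVlt => /orP[/eqP->|h]; first exact: intz.
  exact: (lin_span_gen (fun i : 'I_M => z ^+ i) (Ordinal h)).
elim: n => [|n IH]; last by rewrite exprS; apply: step.
have M0 : (0 < M)%N.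
  case: M intz => // -[r]; rewrite big_ord0 expr0 => /eqP.
  by rewrite oner_eq0.
exact: (lin_span_gen (fun i : 'I_M => z ^+ i) (Ordinal M0)).
Qed.

Let span_bi a b : lin_span bi (z ^+ a * y1 * z ^+ b).
Proof.
have [r hr] := span_powers a; have [s hs] := span_powers b.
exists (fun p => r p.1 * s p.2); rewrite hr hs -mulrA mulr_suml.
transitivity (\sum_i \sum_j ev (r i * s j) * (z ^+ i * y1 * z ^+ j)); last first.
  by rewrite pair_big.
apply: eq_bigr => i _; rewrite mulr_sumr mulr_sumr; apply: eq_bigr => j _.
rewrite rmorphM !mulrA -[ev (r i) * z ^+ i * y1 * ev (s j)]mulrA -evy.
by rewrite -!mulrA; congr (_ * _); rewrite !mulrA -(commrX i (evz (s j))).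
Qed.

(** The bimodule is spanned over C by finitely many z^i y1 z^j because z is
    integral, and multiplication by d sends it into its multiple by a. *)
Lemma nakayama (T : seq (C * (nat * nat))) d a :
  ev d * y1 = ev a * \sum_(t <- T) ev t.1 * (z ^+ t.2.1 * y1 * z ^+ t.2.2) ->
  exists k c, ev (d ^+ k + a * c) * y1 = 0.
Proof.
move=> e; pose u (p : 'I_M * 'I_M) :=
  \sum_(t <- T) ev t.1 * (z ^+ (p.1 + t.2.1) * y1 * z ^+ (t.2.2 + p.2)).
have [||k [c h]] := @determinant_trick _ bi u d a.
- by move=> p; apply: lin_span_sum => t; apply/lin_spanZ/span_bi.
- move=> p; rewrite /bi mulrA mulrA (commrX p.1 (evz d)) -[_ * ev d * y1]mulrA e.
  rewrite !mulrA -(commrX p.1 (evz a)) -!mulrA; congr (_ * _).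
  rewrite mulr_suml mulr_sumr; apply: eq_bigr => t _.
  have := commrX p.1 (evz t.1); rewrite /GRing.comm => c.
  by rewrite !exprD !mulrA c.
exists k, c; have [M0|M0] := posnP M.
  move: intz => [r]; rewrite big1 => [|i _]; last by case: i => m lm; exfalso; move: lm; rewrite M0.
  rewrite M0 expr0 => /eqP.
  by rewrite oner_eq0.
by have := h (Ordinal M0, Ordinal M0); rewrite /bi /= !expr0 mul1r mulr1.
Qed.

End Nakayama.
End Determinants.

Section PowerNakayama.
Variables (D : unitRingType) (C0 : idomainType) (ev0 : {rmorphism C0 -> D}).
Hypothesis hD : GRing.field_axiom D.
Hypothesis inj0 : injective ev0.
Variables (w : D) (N : nat).
Hypothesis ev0w : forall c, GRing.comm (ev0 c) w.
Hypothesis N0 : (0 < N)%N.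

Let ev_eq0 c : ev0 c = 0 -> c = 0.
Proof. by move=> h; apply: inj0; rewrite h rmorph0. Qed.

Fact commr_ev n : commr_rmorph ev0 (w ^+ n).
Proof. by move=> c; apply/commr_sym/commrX. Qed.

(** The ring C0 is a domain of scalars, a is an element whose multiples contain no
    power of d, and the relation says that d kills y1 modulo a in the bimodule
    generated by y1. If w is algebraic over C0, a multiple of w is integral over C0.
    Otherwise w^N is transcendental over C0, and w is integral over the polynomial
    ring C0[w^N], where a keeps its property. *)
Lemma power_nakayama : exists2 c0 : C0, c0 != 0 &
  forall (y1 : D) (d a : C0) (T : seq (C0 * (nat * nat))),
  (forall c, GRing.comm (ev0 c) y1) -> GRing.comm (w ^+ N) y1 ->
  (forall k c, d ^+ k + a * c != 0) ->
  ev0 d * y1 = ev0 a * \sum_(t <- T) ev0 t.1 *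
      ((ev0 c0 * w) ^+ t.2.1 * y1 * (ev0 c0 * w) ^+ t.2.2) ->
  y1 = 0.
Proof.
have [[P P0 Pw]|transc] :=
    pselect (exists2 P : {poly C0}, P != 0 & (map_poly ev0 P).[w] = 0).
  (* c^m P, for P of degree m + 1 with leading coefficient c, is monic in c w *)
  pose c := lead_coef P; have c0 : c != 0 by rewrite lead_coef_eq0.
  exists c => // y1 d a T evy _ nz e.
  have [m em] : exists m, size P = m.+2.
    case eP: (size P) => [|[|m]]; last by exists m.
      by move/eqP: eP; rewrite size_poly_eq0 (negPf P0).
    move/eqP: eP => /size_poly1P[b b0 eb]; move: Pw; rewrite eb map_polyC hornerC.
    by move/ev_eq0/eqP; rewrite (negPf b0).
  set z := ev0 c * w in e; have evz b : GRing.comm (ev0 b) z.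
    by apply: commrM => //; rewrite /GRing.comm -!rmorphM mulrC.
  have zX i : z ^+ i = ev0 (c ^+ i) * w ^+ i by rewrite exprMn_comm // rmorphXn.
  have intz : lin_span ev0 (fun i : 'I_m.+1 => z ^+ i) (z ^+ m.+1).
    exists (fun i : 'I_m.+1 => - (P`_i * c ^+ (m - i))).
    move: Pw; rewrite (horner_coef_wide _ (n := m.+2)); last first.
      by rewrite -em size_poly.
    rewrite big_ord_recr /= coef_map /= => /eqP.
    have -> : P`_m.+1 = c by rewrite /c lead_coefE em.
    rewrite addrC addr_eq0 => /eqP h.
    rewrite zX exprSr rmorphM -mulrA h mulrN mulr_sumr -sumrN; apply: eq_bigr => i _.
    rewrite coef_map /= zX rmorphN mulNr; congr (- _).
    rewrite !mulrA -!rmorphM; congr (ev0 _ * _).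
    by rewrite -[RHS]mulrA -exprD subnK 1?mulrC // -ltnS.
  have [k [b h]] := nakayama evz evy intz e.
  by case: (div_mulf_eq0 hD h) => // /ev_eq0/eqP; rewrite (negPf (nz _ _)).
exists 1 => [|y1 d a T evy ky nz]; first exact: oner_neq0.
rewrite rmorph1 mul1r => e; pose ev : {rmorphism {poly C0} -> D} := horner_morph (commr_ev N).
have evC b : ev b%:P = ev0 b by exact: horner_morphC.
have evX : ev 'X = w ^+ N by exact: horner_morphX.
have comm_ev (v : D) : (forall c, GRing.comm (ev0 c) v) -> GRing.comm (w ^+ N) v ->
    forall Q, GRing.comm (ev Q) v.
  move=> h1 h2 Q; apply/commr_sym; rewrite /= /horner_morph horner_coef.
  apply: commr_sum => i _; apply: commrM; first by rewrite coef_map; apply/commr_sym/h1.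
  exact/commrX/commr_sym.
have ev_inj Q : ev Q = 0 -> Q = 0.
  move=> h; apply/eqP; rewrite -(@comp_poly_eq0 _ Q 'X^N) ?size_polyXn //.
  apply: contraT => Q0; case: transc; exists (Q \Po 'X^N) => //.
  have cw : commr_rmorph ev0 w by move=> c; apply/commr_sym.
  rewrite -h -[LHS]/(horner_morph cw _) comp_polyE rmorph_sum /=.
  rewrite /horner_morph (@horner_coef_wide _ (size Q)) ?size_poly //.
  apply: eq_bigr => i _; rewrite -mul_polyC -[LHS]/(horner_morph cw _) rmorphM /=.
  by rewrite horner_morphC -exprM rmorphXn /= horner_morphX exprM coef_map.
have evw Q : GRing.comm (ev Q) w by apply: comm_ev => //; apply/commr_sym/commrX.
have [|||k [b h]] := @nakayama _ _ ev w y1 N evw _ _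
    [seq (t.1%:P, t.2) | t <- T] d%:P a%:P.
- exact: comm_ev.
- rewrite -[w ^+ N]mulr1 -evX -(expr0 w); apply: lin_spanZ.
  exact: (lin_span_gen _ (fun i : 'I_N => w ^+ i) (Ordinal N0)).
- by rewrite !evC e big_map; congr (_ * _); apply: eq_bigr => t _; rewrite evC.
case: (div_mulf_eq0 hD h) => // /ev_inj h0.
have := congr1 (fun P : {poly C0} => P`_0) h0.
rewrite coefD coefCM coef0 -rmorphXn coefC /= => /eqP.
by rewrite (negPf (nz _ _)).
Qed.

End PowerNakayama.

(** * Powers that commute with the image: characteristic zero *)

Section PolynomialCommutators.
Variables (C0 : comNzRingType) (R : nzRingType) (ev0 : {rmorphism C0 -> R}) (z y : R).
Hypothesis ev0y : forall c, GRing.comm (ev0 c) y.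

(** The derivation of y takes any polynomial in z into the bimodule generated by z y
    - y z. *)
Lemma polynomial_commutator (Q : {poly C0}) : exists T : seq (C0 * (nat * nat)),
  (map_poly ev0 Q).[z] * y - y * (map_poly ev0 Q).[z] =
  \sum_(t <- T) ev0 t.1 * (z ^+ t.2.1 * (z * y - y * z) * z ^+ t.2.2).
Proof.
elim/poly_ind: Q => [|Q c [T hT]].
  by exists [::]; rewrite rmorph0 horner0 big_nil mul0r mulr0 subrr.
exists ([seq (Q`_i, (i, 0)) | i <- iota 0 (size Q)] ++ [seq (t.1, (t.2.1, t.2.2.+1)) | t <- T]).
rewrite big_cat !big_map /= rmorphD rmorphM /= map_polyX map_polyC hornerMXaddC /=.
set q := _.[z] in hT *; transitivity (q * (z * y - y * z) + (q * y - y * q) * z).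
  have := ev0y c; rewrite /GRing.comm => cy; rewrite mulrDl mulrDr cy.
  by rewrite opprD addrACA subrr addr0; ncring.
congr (_ + _).
  rewrite /q (@horner_coef_wide _ (size Q)) ?size_poly // mulr_suml.
  rewrite -[X in iota 0 X]subn0 -/(index_iota 0 _) big_mkord.
  by apply: eq_bigr => i _; rewrite coef_map mulr1 !mulrA.
rewrite hT mulr_suml; apply: eq_bigr => t _.
by rewrite exprSr !mulrA.
Qed.

End PolynomialCommutators.

Section CharZero.
Variables (D : unitRingType) (st : D -> D).
Hypothesis hD : GRing.field_axiom D.
Hypothesis inv : involution st.
Hypothesis st1 : first_kind st.
Hypothesis power : forall x, exists N : nat, (0 < N)%N /\ GRing.comm (st x) (x ^+ N).
Hypothesis ch0 : forall n, (0 < n)%N -> n%:R != 0 :> D.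

(** Cubing 1 + 3^s U multiplies U by 3 up to higher powers of 3, and the part of n
    prime to 3 contributes the factor m. *)
Lemma cube_expansion n : (0 < n)%N -> exists s m (H : {poly int}), ~~ (3 %| m)%N /\
  (1 + 3%:R * 'X) ^+ n = 1 + 3%:R ^+ s.+1 * (m%:R * 'X + 3%:R * H).
Proof.
move=> n0; pose m := (n`_3^')%N.
have nE : n = (m * 3 ^ logn 3 n)%N by rewrite -p_part mulnC partnC.
have m3 : ~~ (3 %| m)%N.
  by have := part_pnat (3^')%N n; rewrite p'natE.
have base k : exists H : {poly int},
    (1 + 3%:R * 'X) ^+ k = 1 + 3%:R * (k%:R * 'X + 3%:R * H).
  elim: k => [|k [H e]]; first by exists 0; rewrite expr0 mul0r mulr0 addr0 mulr0 addr0.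
  exists (H + 'X * (k%:R * 'X + 3%:R * H)); rewrite exprSr e -natr1; ring.
have ind s : exists H : {poly int}, (1 + 3%:R * 'X) ^+ (m * 3 ^ s)%N =
     1 + 3%:R ^+ s.+1 * (m%:R * 'X + 3%:R * H).
  elim: s => [|s [H e]]; first by rewrite muln1 expr1; apply: base.
  (* with A = 3^(s+1) and U = m X + 3 H,
     (1 + A U)^3 = 1 + 3 A (U + 3 (3^s U^2 + 3^(2s) U^3)) *)
  exists (H + 3%:R ^+ s * (m%:R * 'X + 3%:R * H) ^+ 2 +
     (3%:R ^+ s) ^+ 2 * (m%:R * 'X + 3%:R * H) ^+ 3).
  rewrite expnSr mulnA exprM e !(exprS _ s.+1) !(exprS _ s); ring.
by have [H e] := ind (logn 3 n); exists (logn 3 n), m, H; rewrite {1}nE.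
Qed.

Lemma intr_inj0 : injective (intr : int -> D).
Proof.
suff h c : c%:~R = 0 :> D -> c = 0.
  by move=> a b e; apply/eqP; rewrite -subr_eq0; apply/eqP/h; rewrite rmorphB /= e subrr.
case: c => [[|n]|n] //; first by move/eqP; rewrite -pmulrn (negPf (ch0 _)).
by rewrite NegzE rmorphN /= -pmulrn => /eqP; rewrite oppr_eq0 (negPf (ch0 _)).
Qed.

(** Expand a power of 1 + 3 z that commutes with st z by [cube_expansion] and divide
    by the power of 3; then apply [power_nakayama] over the integers, with a = -3
    and d = m. *)
Lemma power_normal_char0 w : GRing.comm (st w) w.
Proof.
have [N [N0 hN]] := power w; set y := st w in hN *.
pose ev0 : {rmorphism int -> D} := intr.
have evC (c : int) (v : D) : GRing.comm (ev0 c) v by apply/commr_sym/commr_int.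
have [c c0 key] := power_nakayama hD intr_inj0 (fun c => evC c w) N0.
pose z := ev0 c * w; have sz : st z = ev0 c * y.
  by rewrite (starM inv) (st1 (evC c)) -/y -evC.
have uc : ev0 c \is a GRing.unit.
  by apply: hD; apply: contra_neq c0 => h; apply: intr_inj0; rewrite h.
have u3 : (3%:R : D) \is a GRing.unit by apply/hD/ch0.
have [n [n0 hn]] := power (1 + 3%:R * z).
have [s [m [H [m3 e]]]] := cube_expansion n0.
have comm3 (v : D) : GRing.comm 3%:R v by apply/commr_sym/commr_nat.
have yc v : GRing.comm (1 + 3%:R * st z) v -> GRing.comm v y.
  move=> h; have -> : y = (ev0 c)^-1 * (3%:R^-1 * (1 + 3%:R * st z - 1)).
    by rewrite addrC addKr mulKr // sz mulKr.
  apply: commrM; first by apply/commrV/commr_sym/evC.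
  apply: commrM; first by apply/commrV/commr_sym/comm3.
  by apply: commrB; [exact/commr_sym|exact: commr1].
have e3 : st (1 + 3%:R * z) = 1 + 3%:R * st z.
  by rewrite (starD inv) (star1 inv) (starM inv) (st1 (comm3)) -comm3.
rewrite e3 in hn; have {}hn := yc _ hn.
have e' : (1 + 3%:R * z) ^+ n = 1 + 3%:R ^+ s.+1 * (m%:R * z + 3%:R * coef_ev z H).
  have := congr1 (coef_ev z) e.
  by rewrite !(rmorphD, rmorphM, rmorphXn, rmorph1, rmorph_nat) /= coef_evX.
have hc : GRing.comm (m%:R * z + 3%:R * coef_ev z H) y.
  have u3s : 3%:R ^+ s.+1 \is a @GRing.unit D by rewrite unitrX.
  have -> : m%:R * z + 3%:R * coef_ev z H = (3%:R ^+ s.+1)^-1 * ((1 + 3%:R * z) ^+ n - 1).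
    by rewrite e' addrAC subrr add0r mulKr.
  apply/commr_sym/commrM; first by apply/commrV/commrX/commr_sym/comm3.
  by apply: commrB; [exact/commr_sym|exact: commr1].
have [T hT] := @polynomial_commutator _ _ ev0 z y (fun c => evC c y) H.
suff y1 : z * y - y * z = 0.
  apply/commr_sym; apply: (mulrI uc); rewrite mulrA [ev0 c * (y * w)]mulrA (evC c y) -[y * _ * w]mulrA.
  by apply/eqP; rewrite -subr_eq0; apply/eqP.
apply: (key _ m%:R (- 3%:R) T).
- by move=> b; apply: evC.
- have wN : GRing.comm (w ^+ N) z.
    apply: commrM; first exact/commr_sym/evC.
    by apply/commr_sym/commrX.
  by apply: commrB; apply: commrM => //; apply: commr_sym.
- move=> k b; apply: contra m3; rewrite addr_eq0 mulNr opprK => /eqP h.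
  have : (3 %| m ^ k)%N.
    by apply/dvdnP; exists `|b|%N; have := congr1 (fun i : int => `|i|%N) h; rewrite -natrX; lia.
  by rewrite Euclid_dvdX // => /andP[].
- rewrite -/z rmorphN !rmorph_nat -hT mulNr -[map_poly _ _]/(map_poly intr H).
  rewrite -[_.[z]]/(coef_ev z H); apply/eqP; rewrite -addr_eq0; apply/eqP.
  move/eqP: hc; rewrite -subr_eq0 => /eqP hc; rewrite -[RHS]hc.
  move: (coef_ev z H) (m%:R : D) (commr_nat y m) (comm3 y) => h r; rewrite /GRing.comm => cr c3.
  transitivity (r * z * y + 3%:R * h * y - (y * r) * z - (y * 3%:R) * h); last by ncring.
  by rewrite cr -c3; move: (3%:R : D) => q; ncring.
Qed.

End CharZero.

(** * Powers that commute with the image: elements of finite order *)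

Section RightRoots.
Variables (D : unitRingType) (x : D).
Hypothesis hD : GRing.field_axiom D.
Implicit Types (P Q : {poly D}) (v c : D).

(** D is a module over D[X], with D acting on the left and X by right multiplication
    with x. A factor X - c acts as v |-> v x - c v. *)
Definition bimodule_act P v := \sum_(i < size P) P`_i * v * x ^+ i.

Lemma bimodule_act_wide n P v : (size P <= n)%N ->
  bimodule_act P v = \sum_(i < n) P`_i * v * x ^+ i.
Proof.
move=> sn; rewrite /bimodule_act (big_ord_widen n (fun i => P`_i * v * x ^+ i)) //.
rewrite big_mkcond /=; apply: eq_bigr => i _; case: ltnP => // h.
by rewrite nth_default // !mul0r.
Qed.

Lemma bimodule_act_factor P c v :
  bimodule_act (P * ('X - c%:P)) v = bimodule_act P (v * x - c * v).
Proof.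
have s1 : (size (P * ('X - c%:P))%R <= (size P).+1)%N.
  by apply: (leq_trans (size_polyMleq _ _)); rewrite size_XsubC addn2.
rewrite (bimodule_act_wide _ s1) mulrBr.
under eq_bigr => i _ do rewrite coefB coefMX coefMC mulrBl mulrBl.
rewrite big_split /= sumrN big_ord_recl /= !mul0r add0r big_ord_recr /=.
rewrite [P`_(size P)]nth_default // !mul0r addr0 -sumrB; apply: eq_bigr => i _.
by rewrite mulrBr mulrBl exprS !mulrA.
Qed.

(** Apply the factors one after the other and stop before the first zero. *)
Lemma bimodule_root (s : seq D) v : v != 0 ->
  bimodule_act (\prod_(c <- s) ('X - c%:P)) v = 0 ->
  exists2 c, c \in s & exists2 u, u != 0 & u * x = c * u.
Proof.
elim/last_ind: s v => [|s c IH] v v0.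
  rewrite big_nil /bimodule_act size_poly1 big_ord1 coef1 /= expr0 mul1r mulr1.
  by move=> h; rewrite h eqxx in v0.
rewrite -cats1 big_cat big_seq1 /= bimodule_act_factor.
have [/eqP|n0 /(IH _ n0)[b bs hb]] := eqVneq (v * x - c * v) 0.
  rewrite subr_eq0 => /eqP e _; exists c; last by exists v.
  by rewrite mem_cat inE eqxx orbT.
by exists b => //; rewrite mem_cat bs.
Qed.

(** Let n be the order of x. Then X^n - 1 kills y and is the product of the X - x^i.
    With the factor X - x applied first, to y, [bimodule_root] gives an element u
    that satisfies u x = x^j u with x^j different from x. *)
Lemma torsion_conjugate_power y : torsion x -> ~ GRing.comm y x ->
  exists u j, [/\ u != 0, u * x = x ^+ j * u & ~ GRing.comm u x].
Proof.
move=> [n0 n00 en0] nc.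
have ex : exists n, (0 < n)%N && (x ^+ n == 1) by exists n0; rewrite n00 en0 eqxx.
case: (ex_minnP ex) => n /andP[n_gt0 /eqP en] nmin.
have x_unit : x \is a GRing.unit.
  by apply: hD; apply: contra_not_neq nc => ->; apply: commr0.
(* all powers of x, with x itself last because the last factor acts first *)
pose rs := [seq x ^+ i | i <- rcons (iota 2 n.-1) 1%N].
have urs : uniq rs.
  rewrite map_inj_in_uniq ?rcons_uniq ?iota_uniq ?mem_iota // => i j.
  have range k : k \in rcons (iota 2 n.-1) 1%N -> (0 < k <= n)%N.
    rewrite mem_rcons inE mem_iota => /orP[/eqP->//|/andP[k2]].
    by rewrite add2n prednK // ltnS => ->; rewrite (ltnW k2).
  move=> /range/andP[i0 iN] /range/andP[j0 jN].
  wlog ij : i j i0 iN j0 jN / (i <= j)%N.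
    by move=> hw e; case/orP: (leq_total i j) => l; [apply: hw|apply/esym/hw].
  move=> e; apply/eqP; rewrite eqn_leq ij leqNgt; apply/negP => lt.
  have : (n <= j - i)%N.
    apply: nmin; rewrite subn_gt0 lt /=; apply/eqP; apply: (mulrI (unitrX i x_unit)).
    by rewrite mulr1 -exprD subnKC.
  rewrite leqNgt => /negP; apply; apply: leq_trans jN; rewrite ltn_subrL i0.
  exact: leq_trans lt.
have e : 'X^n - 1 = \prod_(c <- rs) ('X - c%:P) :> {poly D}.
  have := @all_roots_prod_XsubC D ('X^n - 1) rs.
  have sN : (size (- 1 : {poly D})%R < size ('X^n : {poly D}))%N.
    by rewrite size_polyN size_poly1 size_polyXn.
  rewrite lead_coefDl // lead_coefXn scale1r size_polyDl // size_polyXn; apply.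
  - by rewrite size_map size_rcons size_iota prednK.
  - apply/allP => _ /mapP[k _ ->].
    by rewrite /root hornerD hornerN hornerXn hornerC exprAC en expr1n subrr.
  - apply: (div_uniq_roots hD urs) => _ _ /mapP[i _ ->] /mapP[j _ ->].
    by apply/commrX/commr_sym/commrX.
have y0 : y * x - x * y != 0 by rewrite subr_eq0; apply/eqP.
have : bimodule_act ('X^n - 1) y = 0.
  rewrite (@bimodule_act_wide n.+1); last first.
    by rewrite size_polyDl size_polyXn ?size_polyN ?size_poly1.
  case: n n_gt0 en {nmin rs urs e} => // n _ en.
  rewrite big_ord_recl big_ord_recr /= big1 => [|i _].
    have -> : ('X^(n.+1) - 1 : {poly D})`_0 = - 1 by rewrite coefB coefXn coef1 sub0r.
    have -> : ('X^(n.+1) - 1 : {poly D})`_(bump 0 n) = 1.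
      by rewrite coefB coefXn coef1 /bump leq0n add1n eqxx subr0.
    by rewrite /bump leq0n add1n en add0r expr0 !mulr1 mulN1r mul1r addNr.
  rewrite coefB coefXn coef1 /= /bump /= !add1n eqSS ltn_eqF ?subr0 ?mul0r //.
rewrite e /rs map_rcons -cats1 big_cat big_seq1 /= bimodule_act_factor expr1.
move/(bimodule_root y0) => [c /mapP[j js ->] [u u0 eu]]; exists u, j; split=> //.
move=> cu; have : x ^+ j = x.
  by apply: (mulIr (hD u0)); rewrite -eu cu.
move=> ej; move: urs; rewrite /rs map_rcons rcons_uniq expr1 => /andP[/negP + _]; apply.
by apply/mapP; exists j.
Qed.

End RightRoots.

Section NonnormalTorsion.
Variables (D : unitRingType) (p : nat) (st : D -> D).
Hypothesis hD : GRing.field_axiom D.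
Hypothesis pD : p \in [pchar D].
Hypothesis inv : involution st.
Hypothesis st1 : first_kind st.
Hypothesis scalars : exists s : seq D, [/\ uniq s, size s = 3%N & forall a, a \in s -> a != 0 /\ central a].
Implicit Types (x y r a u : D).

(** The commutator of x + a r with its image is a polynomial of degree at most 2 in
    the central element a, with nonzero constant coefficient, so it has at most two
    roots. *)
Lemma nonnormal_perturb x r : ~ GRing.comm (st x) x ->
  exists a, [/\ a != 0, central a & ~ GRing.comm (st (x + a * r)) (x + a * r)].
Proof.
move=> nc; have [s [us ss hs]] := scalars; apply: contrapT => h.
pose cm u v := u * v - v * u; set y := st x.
pose P : {poly D} := (cm x y)%:P + (cm x (st r) + cm r y)%:P * 'X + (cm r (st r))%:P * 'X^2.
have P0 : P != 0.
  apply/eqP => /(congr1 (fun P : {poly D} => P`_0)).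
  rewrite /P !coefD coefC !coefCM coefX coefXn /= !mulr0 !addr0 coef0 => /eqP.
  by rewrite subr_eq0 => /eqP e; apply: nc.
have sP : (size P <= 3)%N.
  apply/leq_sizeP => j; rewrite /P !coefD coefC !coefCM coefX coefXn.
  by case: j => [|[|[|j]]] //= _; rewrite !mulr0 !addr0.
have : (size s < size P)%N.
  apply: (max_ring_poly_roots P0); last first.
    apply: (div_uniq_roots hD us) => a b /hs[_ ca] _; exact: ca.
  apply/allP => a sa; have [a0 ca] := hs _ sa.
  have : GRing.comm (st (x + a * r)) (x + a * r).
    by apply: contrapT => nb; apply: h; exists a.
  rewrite (starD inv) (starM inv) (st1 ca) -/y => e.
  have e2 : (x + a * r) * (y + st r * a) - (y + st r * a) * (x + a * r) = 0 by rewrite e subrr.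
  rewrite /root /P !hornerD hornerC !hornerCM hornerX hornerXn; apply/eqP.
  rewrite -[RHS]e2 expr2 /cm.
  have cx : a * x = x * a := ca x; have cy : a * y = y * a := ca y.
  have cr : a * r = r * a := ca r; have cs' : a * st r = st r * a := ca (st r).
  rewrite cr; transitivity (x * y - y * x + x * st r * a + r * (a * y) + r * (a * st r) * a
    - y * r * a - st r * (a * x) - st r * (a * r) * a); last by ncring.
  by rewrite cx cy cr cs'; ncring.
by rewrite ss ltnNge sP.
Qed.

(** Suppose all elements not commuting with their image have finite order, and x is
    one. Then so is x + a r for some central a, for every r commuting with x, so a r
    is a sum of commuting elements of finite order: all nonzero elements of the
    centralizer of x have finite order. In particular u from
    [torsion_conjugate_power] has, as a power of it commutes with x, and then u
    commutes with x by [torsion_power_comm]. *)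
Lemma nonnormal_nontorsion x : ~ GRing.comm (st x) x ->
  exists2 b, ~ GRing.comm (st b) b & ~ torsion b.
Proof.
move=> nx; apply: contrapT => h.
have tb b : ~ GRing.comm (st b) b -> torsion b.
  by move=> nb; apply: contrapT => tb; apply: h; exists b.
have tx := tb x nx.
have tN1 : torsion (-1 : D) by exists 2%N; rewrite ?sqrrN ?expr1n.
have tc a : a != 0 -> central a -> torsion a.
  move=> a0 ca; have ua := hD a0.
  have tax : torsion (a * x).
    apply: tb; rewrite (starM inv) (st1 ca) -ca => c; apply: nx.
    apply: (mulrI ua); apply: (mulrI ua).
    have := c; rewrite /GRing.comm -!mulrA (mulrA (st x) a) -(ca (st x)) (mulrA x a) -(ca x).
    by rewrite -!mulrA.
  rewrite -[a](mulrK (hD (torsion_neq0 tx))); apply: torsionM => //; last exact: torsionV.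
  by apply/commrV/commr_sym/commrM; [exact/commr_sym/ca|exact: commr_refl].
have tC r : r != 0 -> GRing.comm r x -> torsion r.
  move=> r0 crx; have [a [a0 ca /tb tr]] := nonnormal_perturb r nx.
  have ua := hD a0; have car : GRing.comm (a * r) x.
    by apply/commr_sym/commrM; [exact/commr_sym/ca|exact/commr_sym].
  have tar : torsion (a * r).
    have -> : a * r = (x + a * r) + (- x) by rewrite addrC addKr.
    apply: (torsionD hD pD) => //.
    - by apply/commrN/commr_sym/commrD => //; apply/commr_sym.
    - by rewrite -mulN1r; apply: torsionM => //; apply/commr_sym/commrN1.
    - by rewrite addrC addKr; apply: (div_mulf_neq0 hD).
  rewrite -[r](mulKr ua); apply: torsionM => //; last exact/torsionV/tc.
  by apply/commr_sym/commrV/commr_sym/ca.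
have [u [j [u0 eu nu]]] := torsion_conjugate_power hD tx nx.
apply: nu; apply: (torsion_power_comm hD pD tx _ eu).
have uu := hD u0.
have conjX k : u ^+ k * x = x ^+ (j ^ k) * u ^+ k.
  have uX m : u * x ^+ m = x ^+ (j * m) * u.
    elim: m => [|m IH]; first by rewrite muln0 !expr0 mul1r mulr1.
    by rewrite exprSr mulrA IH -mulrA eu mulrA -exprD mulnS addnC.
  elim: k => [|k IH]; first by rewrite expr0 mul1r mulr1 expr1.
  by rewrite exprS -mulrA IH mulrA uX expnS mulrA.
have [n n0 en] := tx.
pose f k := x ^+ (j ^ k).
(* two powers of u conjugate x to the same power of x, so their quotient commutes with x *)
have nuq : ~~ uniq (mkseq f n.+1).
  have /uniq_leq_size hs : {subset mkseq f n.+1 <= mkseq (fun i => x ^+ i) n}.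
    move=> _ /mapP[k _ ->]; rewrite /f -(expr_mod _ en).
    by apply: map_f; rewrite mem_iota /= ltn_mod.
  by apply/negP => /hs; rewrite !size_mkseq ltnn.
have [k [l [lt e]]] : exists k l, (k < l)%N /\ f k = f l.
  apply: contrapT => hn; move/negP: nuq; apply.
  apply/mkseq_uniqP => k l _ _ e; apply/eqP; apply: contraT; rewrite neq_ltn => /orP[lt|lt].
    by case: hn; exists k, l.
  by case: hn; exists l, k.
have l0 : (0 < l - k)%N by rewrite subn_gt0.
apply: (torsion_root l0); apply: tC; first by rewrite -(div_unitE hD) unitrX.
apply: (mulrI (unitrX k uu)); rewrite mulrA -exprD subnKC ?(ltnW lt) // conjX -/(f l) -e.
by rewrite mulrA conjX -/(f k) -mulrA -exprD subnKC // ltnW.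
Qed.

End NonnormalTorsion.

(** * Powers that commute with the image: positive characteristic *)

Section TranscendentalEvaluation.
Variables (D : unitRingType) (p : nat) (pD : p \in [pchar D]) (th : D).

(** Evaluation at th of polynomials over the prime field, of which D is an algebra.
    *)
Definition prime_alg_ev : {poly 'F_p} -> D := horner_alg (th : pPrimeCharType pD).

Lemma prime_alg_ev_morph : (zmod_morphism prime_alg_ev) * (monoid_morphism prime_alg_ev).
Proof.
split; first by move=> P Q; exact: (rmorphB (horner_alg (th : pPrimeCharType pD))).
split; first exact: (rmorph1 (horner_alg (th : pPrimeCharType pD))).
by move=> P Q; exact: (rmorphM (horner_alg (th : pPrimeCharType pD))).
Qed.

HB.instance Definition _ := GRing.isZmodMorphism.Build _ _ prime_alg_ev prime_alg_ev_morph.1.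
HB.instance Definition _ := GRing.isMonoidMorphism.Build _ _ prime_alg_ev prime_alg_ev_morph.2.

Lemma prime_alg_evX : prime_alg_ev 'X = th.
Proof. exact: (horner_algX (th : pPrimeCharType pD)). Qed.

Lemma prime_alg_ev_const (a : 'F_p) : central (prime_alg_ev a%:P).
Proof.
rewrite /prime_alg_ev horner_algC => v.
exact: (etrans (mulr_algl a (v : pPrimeCharType pD)) (esym (mulr_algr a (v : pPrimeCharType pD)))).
Qed.

Lemma prime_alg_ev_comm v : GRing.comm th v -> forall P, GRing.comm (prime_alg_ev P) v.
Proof.
move=> c; elim/poly_ind => [|P a IH].
  by rewrite rmorph0; apply/commr_sym/commr0.
rewrite rmorphD rmorphM /= prime_alg_evX; apply/commr_sym/commrD.
  by apply: commrM; apply/commr_sym.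
exact/commr_sym/prime_alg_ev_const.
Qed.

(** If P vanishes at th, the powers of th are values at th of the finitely many
    polynomials of smaller size. *)
Lemma prime_alg_ev_inj : GRing.field_axiom D -> th != 0 -> ~ torsion th ->
  injective prime_alg_ev.
Proof.
move=> hD th0 nth P Q e; apply/eqP; rewrite -subr_eq0; apply: contraT => R0.
case: nth; have : prime_alg_ev (P - Q) = 0 by rewrite rmorphB /= e subrr.
move: (P - Q) R0 => R R0 eR.
pose s := [seq prime_alg_ev (rVpoly v) | v : 'rV['F_p]_(size R)].
apply: (torsion_powers hD (s := s) th0) => n.
have -> : th ^+ n = prime_alg_ev ('X^n %% R).
  by rewrite -[in LHS]prime_alg_evX -rmorphXn /= {1}(divp_eq 'X^n R) rmorphD rmorphM /= eR mulr0 add0r.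
have sz : (size ('X^n %% R)%R <= size R)%N by apply/ltnW; rewrite ltn_modp.
by rewrite -(poly_rV_K sz); apply: image_f.
Qed.

End TranscendentalEvaluation.

Lemma one_plus_pow (C : comNzRingType) (a : C) m : exists G : {poly C},
  (1 + a%:P * 'X) ^+ m = 1 + a%:P * (m%:R * 'X + a%:P * G).
Proof.
elim: m => [|m [G e]]; first by exists 0; rewrite expr0 mul0r mulr0 addr0 mulr0 addr0.
exists (G + 'X * (m%:R * 'X + a%:P * G)); rewrite exprSr e -natr1; ring.
Qed.

Section PowerFrobenius.
Variables (D : unitRingType) (p : nat) (st : D -> D).
Hypothesis hD : GRing.field_axiom D.
Hypothesis pD : p \in [pchar D].
Hypothesis inv : involution st.
Hypothesis st1 : first_kind st.
Hypothesis power : forall x, exists N : nat, (0 < N)%N /\ GRing.comm (st x) (x ^+ N).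
Variable th : D.
Hypothesis th0 : th != 0.
Hypothesis nth : ~ torsion th.
Hypothesis sth : st th = th.

Let p_pr : prime p. Proof. exact: pcharf_prime pD. Qed.
Let ev0 : {rmorphism {poly 'F_p} -> D} := prime_alg_ev pD th.

Lemma star_prime_alg_ev P : st (ev0 P) = ev0 P.
Proof.
elim/poly_ind: P => [|P a IH]; first by rewrite rmorph0 (star0 inv).
have cP : GRing.comm (ev0 P) th by apply: prime_alg_ev_comm; apply: commr_refl.
rewrite rmorphD rmorphM /= prime_alg_evX (starD inv) (starM inv) sth.
by rewrite (st1 (prime_alg_ev_const pD th a)) -/ev0 [st _]IH cP.
Qed.

(** Let n = p^e m, with m prime to p, be such that the n-th power of 1 + th z
    commutes with st z. It is the m-th power of 1 + th^q Z with q = p^e and Z = z^q,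
    and its expansion gives m [Z, st z] as a multiple of th^q in the bimodule
    generated by [Z, st z]. Apply [power_nakayama] over polynomials in th. *)
Lemma power_frobenius w : GRing.comm th w -> exists e, GRing.comm (w ^+ (p ^ e)) (st w).
Proof.
move=> tw; set y := st w.
have ty : GRing.comm th y by rewrite -sth; apply: (star_comm inv).
have [N [N0 hN]] := power w; rewrite -/y in hN.
have evw P : GRing.comm (ev0 P) w by apply: prime_alg_ev_comm.
have evy P : GRing.comm (ev0 P) y by apply: prime_alg_ev_comm.
have evt P : GRing.comm (ev0 P) th by apply: prime_alg_ev_comm; apply: commr_refl.
have inj : injective ev0 := prime_alg_ev_inj hD th0 nth.
have [c c0 key] := power_nakayama hD inj evw N0.
have uc : ev0 c \is a GRing.unit.
  by apply: hD; apply: contra_neq c0 => h; apply: inj; rewrite h rmorph0.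
have ut := hD th0; pose z := ev0 c * w.
have tz : GRing.comm th z by apply: commrM => //; apply/commr_sym.
have sz : st z = ev0 c * y by rewrite (starM inv) star_prime_alg_ev -/y -evy.
have [n [n0 hn]] := power (1 + th * z).
pose e := logn p n; pose m := (n`_p^')%N; pose q := (p ^ e)%N.
have nE : n = (q * m)%N by rewrite /q /e -p_part partnC.
have pm : ~~ (p %| m)%N by rewrite -p'natE //; apply: part_pnat.
exists e; rewrite -/q.
pose Z := z ^+ q; pose Th := th ^+ q.
have ez : (1 + th * z) ^+ n = (1 + Th * Z) ^+ m.
  rewrite nE exprM (pchar_expD pD); last exact/commr_sym/commr1.
  by rewrite expr1n exprMn_comm.
have hy : GRing.comm y ((1 + Th * Z) ^+ m).
  rewrite -ez; have -> : y = (ev0 c)^-1 * (th^-1 * (st (1 + th * z) - 1)).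
    have -> : st (1 + th * z) = 1 + th * (ev0 c * y).
      rewrite (starD inv) (star1 inv) (starM inv) sth sz; congr (1 + _).
      by apply/esym/commrM => //; apply/commr_sym.
    by rewrite [1 + _ - 1]addrAC subrr add0r !mulKr.
  have ct : GRing.comm (1 + th * z) th.
    by apply/commr_sym/commrD; [exact: commr1|apply: commrM].
  have cc : GRing.comm (1 + th * z) (ev0 c).
    apply/commr_sym/commrD; [exact: commr1|apply: commrM => //].
    by apply: commrM => //; exact: commr_refl.
  apply/commr_sym/commrM; first by apply/commrV/commr_sym/commrX/commr_sym.
  apply: commrM; first by apply/commrV/commr_sym/commrX/commr_sym.
  by apply: commrB; [exact/commr_sym|exact: commr1].
have [G hG] := one_plus_pow ('X^q : {poly 'F_p}) m.
have cZ : commr_rmorph ev0 Z.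
  by move=> P; apply/commr_sym/commrX; apply: commrM => //; rewrite /GRing.comm -!rmorphM mulrC.
have evT : ev0 'X^q = Th by rewrite rmorphXn /= prime_alg_evX.
pose h := (map_poly ev0 G).[Z].
have eZ : (1 + Th * Z) ^+ m = 1 + Th * (m%:R * Z + Th * h).
  have := congr1 (horner_morph cZ) hG.
  rewrite !(rmorphD, rmorphM, rmorphXn, rmorph1, rmorph_nat) /= horner_morphX horner_morphC.
  by have -> : ev0 'X = th by exact: prime_alg_evX.
have uT : Th \is a GRing.unit by rewrite unitrX.
have cT v : GRing.comm th v -> GRing.comm Th v by move=> c'; apply/commr_sym/commrX/commr_sym.
have hc : GRing.comm y (m%:R * Z + Th * h).
  have -> : m%:R * Z + Th * h = Th^-1 * ((1 + Th * Z) ^+ m - 1).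
    by rewrite eZ [1 + _ - 1]addrAC subrr add0r mulKr.
  apply: commrM; first by apply/commrV/commr_sym/cT.
  by apply: commrB => //; exact: commr1.
have [T hT] := @polynomial_commutator _ _ ev0 Z y evy G.
have y1 : Z * y - y * Z = 0.
  apply: (key _ (m%:R) (- 'X^q) [seq (t.1, (q * t.2.1, q * t.2.2)%N) | t <- T]).
  - by move=> P; apply: commrB; apply: commrM => //; apply/commr_sym/cZ.
  - have wN : GRing.comm (w ^+ N) Z.
      apply: commrX; apply: commrM; first exact/commr_sym/commrX/evw.
      by apply/commr_sym/commrX.
    by apply: commrB; apply: commrM => //; apply: commr_sym.
  - move=> k P; apply/eqP => /(congr1 (fun Q : {poly 'F_p} => Q`_0)).
    rewrite coefD mulNr coefN coefXnM expn_gt0 prime_gt0 //= subr0 coef0.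
    rewrite -natrX -polyC_natr coefC /= => /eqP.
    rewrite -(dvdn_pcharf (pchar_Fp p_pr)) Euclid_dvdX // => /andP[pm' _].
    by rewrite pm' in pm.
  - rewrite rmorphN rmorph_nat evT big_map.
    under eq_bigr => t _ do rewrite /= -/z !exprM.
    rewrite -/Z -hT -/h; move/eqP: hc; rewrite -subr_eq0 => /eqP hc.
    have ct : Th * y = y * Th := cT _ ty; have cm : y * m%:R = m%:R * y := commr_nat y m.
    apply/eqP; rewrite -subr_eq0; apply/eqP; rewrite -[RHS]oppr0 -[in RHS]hc.
    transitivity (m%:R * Z * y - m%:R * y * Z + Th * h * y - (Th * y) * h); first by ncring.
    by rewrite ct -cm; ncring.
have {y1} zy : GRing.comm Z y by apply/eqP; rewrite -subr_eq0; apply/eqP.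
have -> : w ^+ q = (ev0 c ^+ q)^-1 * Z.
  by rewrite /Z /z exprMn_comm // mulKr // unitrX.
apply/commr_sym/commrM; last exact/commr_sym.
by apply/commrV/commrX/commr_sym.
Qed.

End PowerFrobenius.

Section PowerNormal.
Variables (D : unitRingType) (st : D -> D).
Hypothesis hD : GRing.field_axiom D.
Hypothesis inv : involution st.
Hypothesis st1 : first_kind st.
Hypothesis scalars : exists s : seq D, [/\ uniq s, size s = 3%N & forall a, a \in s -> a != 0 /\ central a].
Hypothesis power : forall x, exists N : nat, (0 < N)%N /\ GRing.comm (st x) (x ^+ N).

(** In characteristic p, take a symmetric th of infinite order that commutes with x
    and st x, and apply [frobenius_normal] to the centralizer of th. *)
Lemma power_division_normal x : GRing.comm (st x) x.
Proof.
have [[p pD]|ch0] := pchar_cases hD; last exact: power_normal_char0.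
apply: contrapT => /(nonnormal_nontorsion hD pD inv st1 scalars)[{}x nc nx]; apply: nc.
have [->|x0] := eqVneq x 0; first exact: commr0.
have [N [N0 hN]] := power x.
have [th [_ [sth thx thy th0 nth]]] :=
  symmetric_nontorsion hD pD inv N0 (commr_sym hN) x0 nx.
have dT : division_subring (fun _ : D => True) by [].
pose K := centralizer_in (fun _ : D => True) th.
have dK : division_subring K := centralizer_dsr th dT.
apply/commr_sym; apply: (@frobenius_normal D p st K) => //.
- by move=> v [_ c]; split=> //; rewrite -sth; apply: (star_comm inv).
- by move=> w [_ cw]; apply: (power_frobenius hD pD inv st1 power th0 nth sth).
Qed.

End PowerNormal.

(** * Trace and norm on subnormal subgroups *)

Lemma normal_subgroup_in (R : unitRingType) (N H : {pred R}) :
  {subset H <= GRing.unit} -> normal_subgroup N H ->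
  normal_in (fun x => x \in N) (fun x => x \in H).
Proof.
move=> uH [sNH [N1 Nd] hn]; split=> //.
split=> // [x y Nx Ny|x Nx|x /sNH/uH//]; last by rewrite -[x^-1]mul1r; apply: Nd.
by rewrite -[y]invrK; apply: (Nd _ _ Nx); rewrite -[y^-1]mul1r; apply: Nd.
Qed.

Lemma subnormal_in_units_chain (R : unitRingType) (H : nat -> {pred R}) n :
  H 0%N =i GRing.unit -> (forall i, (i < n)%N -> normal_subgroup (H i.+1) (H i)) ->
  forall i, (i <= n)%N -> subnormal_in (@unit_elements R) i (fun x => x \in H i).
Proof.
move=> H0 HS; elim=> [|i IH] le; first by constructor=> x; rewrite H0.
have sN := IH (ltnW le); apply: (SubnormalS sN); apply: normal_subgroup_in (HS _ le).
exact: usgU (subnormal_usg (unit_elements_usg R) sN).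
Qed.

Section GroupConditions.
Variables (F : fieldType) (A : unitAlgType F) (st : A -> A).
Hypothesis hF : has_center A.
Hypothesis hA : almost_locally_simple_artinian A.
Hypothesis hF4 : exists s : seq F, uniq s /\ size s = 4%N.
Hypothesis inv : involution st.
Hypothesis st1 : first_kind st.
Implicit Types (x y g h : A) (N H : A -> Prop).

Lemma central_unit (c : A) : central c -> c != 0 -> c \is a GRing.unit.
Proof.
move=> /hF[a ->] c0; apply: (scalar_unit A); apply: contra_neq c0 => ->.
by rewrite scale0r.
Qed.

Lemma centralV (c : A) : central c -> central c^-1.
Proof. by move=> cc y; apply/commr_sym/commrV/commr_sym. Qed.

(** For h in N let s = h st h. As s g = g s + c st h with c a difference of traces,
    s g s^-1 = g + c h^-1. If c is not 0, compare with the same formula for g h: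
    since s commutes with h, the scalar for g h is c h. So h is central, and then s
    commutes with g after all. *)
Lemma trace_norm_central n N : subnormal_in (@unit_elements A) n N ->
  (exists2 a, N a & ~ central a) -> (forall x, N x -> central (x + st x)) ->
  forall x, N x -> central (x * st x).
Proof.
move=> sN nc ht h Nh; have gN := subnormal_usg (unit_elements_usg A) sN.
have uh := usgU gN Nh; have ush := star_unit inv uh.
have ht' x : st x = (x + st x) - x by rewrite addrC addKr.
have chs : GRing.comm h (st h).
  rewrite (ht' h); apply: commrB; [exact/commr_sym/ht|exact: commr_refl].
set s := h * st h; have us : s \is a GRing.unit by rewrite unitrMl.
have step g : N g -> s * g = ((h * g + st (h * g)) - (g * h + st (g * h))) * st h + g * s.
  move=> Ng; have ct : GRing.comm (h * g + st (h * g)) (st h) by apply/ht/(usgM gN).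
  rewrite mulrBl ct /s chs -[st h * h * g]mulrA.
  have -> : st h * (h * g) = st h * (h * g + st (h * g)) - st h * st (h * g).
    by rewrite -mulrBr addrK.
  have -> : st h * st (h * g) = st (g * h) * st h.
    by rewrite !(starM inv) mulrA.
  by rewrite mulrDl -chs; ncring.
apply: (subnormal_weights_central hF hA hF4 sN nc us) => g Ng.
suff e : s * g = g * s by rewrite /commutator e mulrK // divrr ?(usgU gN) //; exact: central1.
set c := (h * g + st (h * g)) - (g * h + st (g * h)).
have cc : central c by apply: centralB; apply/ht/(usgM gN).
have [c0|c0] := eqVneq c 0; first by rewrite step // -/c c0 mul0r add0r.
have uc := central_unit cc c0.
have ghh := step _ (usgM gN Ng Nh).
set c' := (h * (g * h) + _) - _ in ghh.
have cc' : central c' by apply: centralB; apply/ht; do ?apply: (usgM gN).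
have e1 : c' = c * h.
  apply: (mulIr ush); move: ghh; rewrite mulrA (step g Ng) -/c.
  have -> : (c * st h + g * s) * h = c * (st h * h) + g * (s * h) by ncring.
  have -> : g * h * s = g * (s * h).
    by rewrite -[LHS]mulrA; congr (g * _); rewrite /s -[RHS]mulrA -chs.
  by rewrite -mulrA; move/addIr => <-; rewrite -chs !mulrA.
have ch : central h.
  have -> : h = c^-1 * c' by rewrite e1 mulKr.
  by apply: centralM => //; apply: centralV.
by rewrite /s (st1 ch); apply: centralM.
Qed.

(** Let s = st g g. Expressing that x and g x g^-1 both have central norms gives x
    s^-1 x^-1 as a central multiple of s^-1 for every x in N. *)
Lemma norm_central_step n N H : subnormal_in (@unit_elements A) n N ->
  (exists2 a, N a & ~ central a) -> unit_subgroup H -> normal_in N H ->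
  (forall x, N x -> central (x * st x)) -> forall x, H x -> central (x * st x).
Proof.
move=> sN nc gH nN hn g Hg; have gN := subnormal_usg (unit_elements_usg A) sN.
have ug := usgU gH Hg; have usg := star_unit inv ug.
set s := st g * g; have us : s \is a GRing.unit by rewrite unitrMl.
suff cs : central s^-1.
  have cs' : central s by rewrite -[s]invrK; apply: centralV.
  have -> : g * st g = s.
    by apply: (mulIr ug); rewrite -mulrA -/s (cs' g).
  by [].
apply: (subnormal_weights_central hF hA hF4 sN nc) => [|x Nx]; first by rewrite unitrV.
have ux := usgU gN Nx; have usx := star_unit inv ux.
have := hn _ (normal_inV gH nN Nx Hg); set c := _ * st _ => cc.
have un : x * st x \is a GRing.unit by rewrite unitrMl.
have cn := hn _ Nx; set m := x * st x in un cn.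
have sgV : st g^-1 = (st g)^-1 by rewrite (starV inv).
have e : x * s^-1 * st x = c * s^-1.
  have -> : x * s^-1 * st x = g^-1 * c * (st g)^-1.
    rewrite /c !(starM inv) sgV /s invrM // !mulrA mulVr // mul1r.
    by rewrite mulrK.
  by rewrite -(cc g^-1) -mulrA /s invrM.
have uc : c \is a GRing.unit.
  have -> : c = (x * s^-1 * st x) * s by rewrite e mulrVK.
  by rewrite !unitrMl ?unitrV.
have ex : st x = m * x^-1 by rewrite (cn x^-1) /m mulKr.
clearbody m c s.
have e2 : x * s^-1 = c * m^-1 * s^-1 * x.
  have := e; rewrite ex mulrA -(cn (x * s^-1)) => e3.
  have : m * (x * s^-1) = c * s^-1 * x by rewrite -e3 mulrVK.
  move=> e4; apply: (mulrI un); rewrite e4 !mulrA (cn c) -(mulrA c m) mulrV //.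
  by rewrite mulr1.
rewrite /commutator invrK.
have -> : s^-1 * x * s * x^-1 = m * c^-1.
  have ucm : c * m^-1 \is a GRing.unit by rewrite unitrMl ?unitrV.
  have -> : m * c^-1 = (c * m^-1)^-1 by rewrite invrM ?unitrV // invrK.
  apply: (mulrI ucm); rewrite mulrV // !mulrA -e2 mulrVK // divrr //.
by apply: centralM => //; apply: centralV.
Qed.

(** For l in F other than 0 and -1, e + l is a unit, of norm e st e + l (e + st e) +
    l^2. Two different such l show that e + st e is central. *)
Lemma norm_central_idem : (forall x, x \is a GRing.unit -> central (x * st x)) ->
  forall e, e * e = e -> st e * e = e * st e.
Proof.
move=> hn e ee; have [l [l0 lN _]] := avoid_three hF4 0 (-1) (-1).
have [m [m0 mN ml]] := avoid_three hF4 0 (-1) l.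
have stZ (a : F) : st (a%:A) = a%:A by apply/st1/(scalar_central hF).
have ce (a : F) : a != 0 -> a != -1 -> central (a *: (e + st e) + e * st e).
  move=> a0 aN; have ca : central (a%:A : A) := scalar_central hF a.
  have ua : e + a%:A \is a GRing.unit.
    have a1 : a * (1 + a) != 0 by rewrite mulf_neq0 // addrC addr_eq0.
    have eb : (a * (1 + a))%:A = a%:A + a%:A * a%:A :> A.
      by rewrite mulrDr mulr1 scalerDl -scalerAl mul1r scalerA.
    have ce : a%:A * e = e * a%:A := ca e.
    have h1 : (1 + a%:A - e) * (e + a%:A) = (a * (1 + a))%:A.
      transitivity (a%:A + a%:A * a%:A + (e - e * e) + (a%:A * e - e * a%:A)); first by ncring.
      by rewrite ee ce !subrr !addr0 eb.
    have h2 : (e + a%:A) * (1 + a%:A - e) = (a * (1 + a))%:A.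
      transitivity (a%:A + a%:A * a%:A + (e - e * e) + (e * a%:A - a%:A * e)); first by ncring.
      by rewrite ee ce !subrr !addr0 eb.
    apply/unitrP; exists ((a * (1 + a))^-1 *: (1 + a%:A - e)).
    by rewrite -scalerAl h1 -scalerAr h2 scalerA mulVf // scale1r.
  have := hn _ ua; rewrite (starD inv) stZ.
  have -> : (e + a%:A) * (st e + a%:A) = a *: (e + st e) + e * st e + a%:A * a%:A.
    rewrite -[a *: (e + st e)]mulr_algl; have ce : a%:A * e = e * a%:A := ca e.
    move: (a%:A : A) ce => b ce.
    transitivity (e * st e + e * b + b * st e + b * b); first by ncring.
    by rewrite -ce; ncring.
  move=> h; rewrite -[X in central X](addrK (a%:A * a%:A)); apply: centralB => //.
  exact: centralM.
have := centralB (ce m m0 mN) (ce l l0 lN).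
have -> : m *: (e + st e) + e * st e - (l *: (e + st e) + e * st e) = (m - l) *: (e + st e).
  by rewrite scalerBl opprD addrACA subrr addr0.
move=> h; have : central (e + st e).
  rewrite -[e + st e]scale1r -(@mulVf _ (m - l)) ?subr_eq0 // -scalerA -mulr_algl.
  by apply: centralM => //; exact: scalar_central hF _.
move/(_ e); rewrite /GRing.comm mulrDl mulrDr => /addrI.
by [].
Qed.

End GroupConditions.

(** * Quaternion division algebras *)

Section SymplecticUnique.
Variables (D : unitRingType) (st tau : D -> D) (p q : D).
Hypothesis hD : GRing.field_axiom D.
Hypothesis npq : ~ GRing.comm p q.
Hypothesis inv : involution st.
Hypothesis st1 : first_kind st.
Hypothesis sy : symplectic st.
Hypothesis invt : involution tau.
Hypothesis syt : symplectic tau.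

Lemma central_factor (a x : D) : central a -> central (x * a) -> a != 0 -> central x.
Proof.
move=> ca cx a0; have ua := hD a0; have -> : x = x * a * a^-1 by rewrite mulrK.
by apply: centralM => // z; apply/commr_sym/commrV/commr_sym.
Qed.

(** Let z be central. Comparing the central elements z p + tau p tau z and (p + tau
    p) tau z shows that p times tau z - z is central, for any p. *)
Lemma symplectic_first_kind : first_kind tau.
Proof.
move=> z cz; apply/eqP; rewrite -subr_eq0; apply: contraT => nz.
have ctz : central (tau z).
  by move=> v; rewrite -[v](starK invt); apply: (star_comm invt).
have cd : central (tau z - z) by apply: centralB.
case: npq; apply: (central_factor cd) => //.
have := syt (z * p); rewrite (starM invt) => h.
have -> : p * (tau z - z) = (p + tau p) * tau z - (z * p + tau p * tau z).
  by rewrite (cz p); ncring.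
by apply: centralB => //; apply: centralM => //; apply: syt.
Qed.

(** Both norms x tau x and x st x are central, so their difference, x times the
    central element tau x - st x, is too. *)
Lemma symplectic_unique : tau =1 st.
Proof.
move=> x; have [cx|nx] := pselect (central x).
  by rewrite (st1 cx) symplectic_first_kind.
have cs : central (tau x - st x).
  have -> : tau x - st x = (x + tau x) - (x + st x) by rewrite opprD addrACA subrr add0r.
  by apply: centralB; [exact: syt|exact: sy].
apply/eqP; rewrite -subr_eq0; apply: contraT => n0; case: nx.
apply: (central_factor cs) => //; rewrite mulrBr; apply: centralB.
  exact: symplectic_norm_central.
exact: symplectic_norm_central.
Qed.

End SymplecticUnique.

Section Quaternion.
Variables (F : fieldType) (A : unitAlgType F) (st : A -> A) (p q : A).
Hypothesis hF : has_center A.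
Hypothesis hD : GRing.field_axiom A.
Hypothesis inv : involution st.
Hypothesis st1 : first_kind st.
Hypothesis sy : symplectic st.
Hypothesis npq : ~ GRing.comm p q.
Implicit Types (x y z : A) (a b : F).

Let tr x : F := sval (cid ((hF (x + st x)).1 (sy x))).
Let trE x : (tr x)%:A = x + st x. Proof. by rewrite /tr; case: (cid _) => a /= ->. Qed.

Let scal_inj a b : a%:A = b%:A :> A -> a = b.
Proof.
move=> /eqP; rewrite -subr_eq0 -scalerBl scaler_eq0 oner_eq0 orbF subr_eq0.
by move/eqP.
Qed.

Let stZ a x : st (a *: x) = a *: st x.
Proof.
by rewrite -mulr_algl (starM inv) (st1 (scalar_central hF a)) -scalar_central // mulr_algl.
Qed.

Let trD x y : tr (x + y) = tr x + tr y.
Proof. by apply: scal_inj; rewrite scalerDl !trE (starD inv) addrACA. Qed.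
Let trZ a x : tr (a *: x) = a * tr x.
Proof. by apply: scal_inj; rewrite -scalerA !trE stZ scalerDr. Qed.
Let tr0 x : st x = - x -> tr x = 0.
Proof. by move=> h; apply: scal_inj; rewrite trE h subrr scale0r. Qed.

Let c := p * q - q * p.
Let c0 : c != 0. Proof. by rewrite subr_eq0; apply/eqP. Qed.

Let skew_comm z w : st (z * w - w * z) = - (z * w - w * z).
Proof.
have e v : st v = (v + st v) - v by rewrite addrC addKr.
have cz := sy z; have cw := sy w.
rewrite (starB inv) !(starM inv) (e z) (e w); move: (z + st z) (w + st w) cz cw => a b ca cb.
have a1 : a * w = w * a := ca w; have a2 : a * b = b * a := ca b; have b1 : b * z = z * b := cb z.
transitivity ((b * a - a * b) - (b * z - z * b) + (a * w - w * a) - (z * w - w * z)); first by ncring.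
by rewrite a1 a2 b1 !subrr !add0r.
Qed.

Let sc : st c = - c. Proof. exact: skew_comm. Qed.

Let quad z : z * z = (z + st z) * z - z * st z.
Proof. by rewrite mulrDl (symplectic_comm z sy) addrK. Qed.

(** By Cayley-Hamilton, z^2 = t z - n with t and n central. *)
Let twist_comm z w : (z * w - w * z) * z = st z * (z * w - w * z).
Proof.
have cz := sy z; have ez : st z = (z + st z) - z by rewrite addrC addKr.
have cn := symplectic_norm_central inv sy z.
rewrite [in RHS]ez; have := quad z; move: (z + st z) (z * st z) cz cn => a n ca cn e.
have a1 : a * (w * z) = w * z * a := ca _; have a2 : a * z = z * a := ca z; have n1 : n * w = w * n := cn w.
transitivity (z * w * z - w * (z * z)); first by ncring.
transitivity (a * (z * w) - a * (w * z) - (z * z) * w + z * w * z); last by ncring.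
rewrite e; transitivity (z * w * z - w * (a * z) + w * n); first by ncring.
transitivity (z * w * z - a * (w * z) + n * w); last by ncring.
by rewrite a1 a2 n1 mulrA.
Qed.

Let cp : c * p = st p * c. Proof. exact: twist_comm. Qed.
Let cq : c * q = st q * c.
Proof. by have := twist_comm q p; rewrite -[q * p - p * q]opprB -/c mulNr mulrN => /oppr_inj. Qed.
Let cp' : c * st p = p * c.
Proof.
have e : (p + st p) * c = c * (p + st p) := sy p c.
by move: e; rewrite mulrDl [c * (_ + _)]mulrDr cp addrC => /addrI.
Qed.

Let k := tr (c * (p * q)).
Let k_sq : k%:A = c * c.
Proof.
have e : st (c * (p * q)) = - (c * (q * p)).
  by rewrite !(starM inv) sc mulrN -[_ * _ * c]mulrA -cp mulrA -cq mulrA.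
by rewrite trE e -mulrBr.
Qed.
Let k0 : k != 0.
Proof.
apply/eqP => h; have := k_sq; rewrite h scale0r => /esym/(div_mulf_eq0 hD).
by case=> /eqP; rewrite (negPf c0).
Qed.

Let psi1 x := tr (c * x).
Let psi2 x := tr (p * c * x).
Let psi3 x := tr (c * q * x).
Let psi4 x := tr (p * c * q * x).

Let neg_k x : x + st x = - (c * c) -> tr x = - k.
Proof. by move=> h; apply: scal_inj; rewrite trE h scaleNr k_sq. Qed.

Let v11 : psi1 1 = 0. Proof. by apply: tr0; rewrite mulr1. Qed.
Let v1p : psi1 p = 0. Proof. by apply: tr0; rewrite (starM inv) sc mulrN cp. Qed.
Let v1q : psi1 q = 0. Proof. by apply: tr0; rewrite (starM inv) sc mulrN cq. Qed.
Let v21 : psi2 1 = 0. Proof. by apply: tr0; rewrite mulr1 (starM inv) sc mulNr cp'. Qed.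
Let v2p : psi2 p = 0.
Proof.
apply: tr0; rewrite !(starM inv) sc !mulNr mulrN; congr (- _).
by rewrite cp' mulrA symplectic_comm // -[RHS]mulrA cp mulrA.
Qed.
Let star_p_comm : st p * q - q * st p = - c.
Proof.
have -> : st p = (p + st p) - p by rewrite addrC addKr.
have ca := sy p; move: (p + st p) ca => a ca; have e : a * q = q * a := ca q.
rewrite /c; transitivity ((a * q - q * a) - (p * q - q * p)); first by ncring.
by rewrite e subrr sub0r.
Qed.
Let pcq : p * c * q + st (p * c * q) = - (c * c).
Proof.
rewrite !(starM inv) sc mulNr mulrN -cp' mulrA -cq -!mulrA -mulrBr star_p_comm.
by rewrite mulrN.
Qed.
Let v2q : psi2 q = - k. Proof. exact: neg_k. Qed.
Let v31 : psi3 1 = 0. Proof. by rewrite /psi3 mulr1. Qed.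
Let v3p : psi3 p = - k.
Proof.
apply: neg_k; rewrite !(starM inv) sc !mulrN -cq mulrA -cp -!mulrA -mulrBr.
by rewrite -[q * p - p * q]opprB -/c mulrN.
Qed.
Let v3q : psi3 q = 0.
Proof. by apply: tr0; rewrite !(starM inv) sc !mulrN -cq mulrA -cq. Qed.
Let v41 : psi4 1 = - k. Proof. by apply: neg_k; rewrite mulr1. Qed.

(** If u and p u have trace 0, then p u = u st p. For u = c y this says that y
    commutes with p, and for u = c q y that q y does. So c y = p q y - q p y
    vanishes. *)
Let psi_kernel y : psi1 y = 0 -> psi2 y = 0 -> psi3 y = 0 -> psi4 y = 0 -> y = 0.
Proof.
have skew z : tr z = 0 -> st z = - z.
  by move=> h; apply/eqP; rewrite -addr_eq0 addrC -trE h scale0r.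
have twist u : tr u = 0 -> tr (p * u) = 0 -> p * u = u * st p.
  move=> h1 h2; have := skew _ h2; rewrite (starM inv) (skew _ h1) mulNr.
  by move/oppr_inj.
rewrite /psi1 /psi2 /psi3 /psi4 => h1 h2 h3 h4.
have uc := hD c0; have sp : st p = (p + st p) - p by rewrite addrC addKr.
have comm_p z : st p * z = z * st p -> p * z = z * p.
  rewrite sp => h; have ca := sy p; have e : (p + st p) * z = z * (p + st p) := ca z.
  move: h; rewrite mulrBl mulrBr e => /addrI/oppr_inj.
  by [].
have e1 : p * y = y * p.
  apply: comm_p; apply: (mulrI uc); rewrite !mulrA cp'.
  by rewrite -[p * c * y]mulrA; apply: twist; rewrite ?mulrA.
have e2 : p * (q * y) = (q * y) * p.
  apply: comm_p; apply: (mulrI uc); rewrite !mulrA cp'.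
  by have := @twist (c * q * y) h3; rewrite !mulrA; apply.
apply: (mulrI uc); rewrite mulr0 /c mulrBl -!mulrA e2 -mulrA e1 subrr.
by [].
Qed.

Let psiD (u x y : A) : tr (u * (x + y)) = tr (u * x) + tr (u * y).
Proof. by rewrite mulrDr trD. Qed.
Let psiZ (u x : A) a : tr (u * (a *: x)) = a * tr (u * x).
Proof. by rewrite -scalerAr trZ. Qed.

Definition quaternion_basis (i : 'I_4) : A := [:: 1; p; q; p * q]`_i.

Let combination (d : 'rV[F]_4) : \sum_i d 0 i *: quaternion_basis i =
  d 0 0 *: 1 + d 0 1 *: p + d 0 2%:R *: q + d 0 3%:R *: (p * q).
Proof.
have i1 : lift ord0 ord0 = 1 :> 'I_4 by exact: val_inj.
have i2 : lift ord0 (lift ord0 ord0) = 2%:R :> 'I_4 by exact: val_inj.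
have i3 : lift ord0 (lift ord0 (lift ord0 ord0)) = 3%:R :> 'I_4 by exact: val_inj.
by rewrite !big_ord_recl big_ord0 addr0 i1 i2 i3 !addrA.
Qed.

(** In the order psi1, psi2 and psi3, psi4, the functionals determine the
    coefficients of p q, of q and p, and of 1 one after the other. *)
Lemma quaternion_basisP x : exists! d : 'rV[F]_4, x = \sum_i d 0 i *: quaternion_basis i.
Proof.
pose d3 := tr (c * x) / k.
pose d2 := (d3 * psi2 (p * q) - psi2 x) / k.
pose d1 := (d3 * psi3 (p * q) - psi3 x) / k.
pose d0 := (d1 * psi4 p + d2 * psi4 q + d3 * psi4 (p * q) - psi4 x) / k.
have free a0 a1 a2 a3 : a0 *: 1 + a1 *: p + a2 *: q + a3 *: (p * q) = 0 ->
   [/\ a0 = 0, a1 = 0, a2 = 0 & a3 = 0].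
  move=> e; have psi u : a0 * tr (u * 1) + a1 * tr (u * p) + a2 * tr (u * q) +
      a3 * tr (u * (p * q)) = 0.
    rewrite -!psiZ -!psiD e; apply: tr0.
    by rewrite mulr0 (star0 inv) oppr0.
  have e3 : a3 = 0.
    have := psi c; rewrite -/(psi1 1) -/(psi1 p) -/(psi1 q) v11 v1p v1q !mulr0 !add0r => /eqP.
    by rewrite mulf_eq0 (negPf k0) orbF => /eqP.
  have e2 : a2 = 0.
    have := psi (p * c); rewrite -/(psi2 1) -/(psi2 p) -/(psi2 q) v21 v2p v2q e3.
    rewrite mul0r !mulr0 !add0r addr0 => /eqP.
    by rewrite mulrN oppr_eq0 mulf_eq0 (negPf k0) orbF => /eqP.
  have e1 : a1 = 0.
    have := psi (c * q); rewrite -/(psi3 1) -/(psi3 p) -/(psi3 q) v31 v3p v3q e3.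
    rewrite mul0r !mulr0 !add0r !addr0 => /eqP.
    by rewrite mulrN oppr_eq0 mulf_eq0 (negPf k0) orbF => /eqP.
  have e0 : a0 = 0.
    have := psi (p * c * q); rewrite -/(psi4 1) v41 e1 e2 e3.
    rewrite !mul0r !addr0 => /eqP.
    by rewrite mulrN oppr_eq0 mulf_eq0 (negPf k0) orbF => /eqP.
  by split.
have trB u y z : tr (u * (y - z)) = tr (u * y) - tr (u * z).
  by rewrite -[- z]scaleN1r psiD psiZ mulN1r.
have ex : x = d0 *: 1 + d1 *: p + d2 *: q + d3 *: (p * q).
  apply/eqP; rewrite -subr_eq0; apply/eqP.
  apply: psi_kernel; rewrite /psi1 /psi2 /psi3 /psi4 trB !psiD !psiZ.
  - rewrite -/(psi1 1) -/(psi1 p) -/(psi1 q) -/k v11 v1p v1q !mulr0 !add0r.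
    by rewrite /d3 divfK // subrr.
  - rewrite -/(psi2 1) -/(psi2 p) -/(psi2 q) -/(psi2 (p * q)) v21 v2p v2q !mulr0 !add0r.
    by rewrite mulrN {1}/d2 divfK // opprB subrK subrr.
  - rewrite -/(psi3 1) -/(psi3 p) -/(psi3 q) -/(psi3 (p * q)) v31 v3p v3q !mulr0 add0r addr0.
    by rewrite mulrN {1}/d1 divfK // opprB subrK subrr.
  - rewrite -/(psi4 1) -/(psi4 p) -/(psi4 q) -/(psi4 (p * q)) v41.
    rewrite -/(psi4 x) mulrN {1}/d0 divfK //; move: (psi4 x) (psi4 p) (psi4 q) (psi4 _) => *; ring.
exists (\row_i [:: d0; d1; d2; d3]`_i); split; first by rewrite combination !mxE.
move=> d; rewrite combination => e'.
have [] := free (d0 - d 0 0) (d1 - d 0 1) (d2 - d 0 2%:R) (d3 - d 0 3%:R).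
  rewrite !scalerBl; apply/eqP.
  have -> : forall a0 a1 a2 a3 b0 b1 b2 b3 : A,
     (a0 - b0) + (a1 - b1) + (a2 - b2) + (a3 - b3) = (a0 + a1 + a2 + a3) - (b0 + b1 + b2 + b3).
    by move=> *; ncring.
  by rewrite subr_eq0 -ex -e'.
do 4![move/eqP; rewrite subr_eq0 => /eqP ?].
apply/rowP => -[[|[|[|[|i]]]] hi] //; rewrite mxE /=.
- by have -> : Ordinal hi = 0 by exact: val_inj.
- by have -> : Ordinal hi = 1 by exact: val_inj.
- by have -> : Ordinal hi = 2%:R by exact: val_inj.
- by have -> : Ordinal hi = 3%:R by exact: val_inj.
Qed.

Lemma quaternion_structure : quaternion_division_algebra A.
Proof. by split=> //; exists quaternion_basis; apply: quaternion_basisP. Qed.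

End Quaternion.

(** * The equivalences and the structure of A *)

Section Reduction.
Variables (F : fieldType) (A : unitAlgType F) (st : A -> A).
Hypothesis hF : has_center A.
Hypothesis hA : almost_locally_simple_artinian A.
Hypothesis hF4 : exists s : seq F, uniq s /\ size s = 4%N.
Hypothesis inv : involution st.
Hypothesis st1 : first_kind st.

Lemma division_or_idempotent : GRing.field_axiom A \/
  exists e : A, [/\ e * e = e, e != 0 & e != 1].
Proof.
have [hD|/existsNP[r /not_implyP[r0 /negP nr]]] :=
  pselect (forall r : A, r != 0 -> r \is a GRing.unit); [by left|right].
exact: idempotent_of_nonunit r0 nr.
Qed.

(** Used for C1, C2 and C3, which differ only in the division ring case and in the
    reason why idempotents commute with their images. *)
Lemma symplectic_of_normal :
  (forall e : A, e * e = e -> st e * e = e * st e) ->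
  (GRing.field_axiom A -> forall x : A, GRing.comm (st x) x) -> symplectic st.
Proof.
move=> hi hd; have [hD|he] := division_or_idempotent.
  exact: normal_symplectic hD inv (hd hD).
exact: split_symplectic hA inv hi he.
Qed.

Lemma three_scalars : exists s : seq A,
  [/\ uniq s, size s = 3%N & forall a, a \in s -> a != 0 /\ central a].
Proof.
have [a [a0 _ _]] := avoid_three hF4 0 0 0.
have [b [b0 ba _]] := avoid_three hF4 0 a a.
have [c [c0 ca cb]] := avoid_three hF4 0 a b.
have inj : injective (fun a : F => a%:A : A).
  move=> x y /eqP; rewrite -subr_eq0 -scalerBl scaler_eq0 oner_eq0 orbF subr_eq0.
  by move/eqP.
exists [seq x%:A | x <- [:: a; b; c]]; split=> // [|_ /mapP[x xs ->]].
  by rewrite map_inj_uniq //= !inE negb_or ![a == _]eq_sym [b == c]eq_sym ba ca cb.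
split; last exact: scalar_central.
rewrite scaler_eq0 oner_eq0 orbF.
by move: xs; rewrite !inE => /or3P[] /eqP->.
Qed.

Lemma symplectic_of_norm : (forall x, x \is a GRing.unit -> central (x * st x)) ->
  symplectic st.
Proof.
move=> hn; have [hD|he] := division_or_idempotent; last first.
  exact: (split_symplectic hA inv (norm_central_idem hF hF4 inv st1 hn) he).
apply: (norm_central_symplectic inv) => x.
have [->|x0] := eqVneq x 0; last exact/hn/hD.
by rewrite mul0r => y; apply/commr_sym/commr0.
Qed.

End Reduction.

Theorem corollary5p4 (F : fieldType) (A : unitAlgType F)
    (G : {pred A}) (star : A -> A)
    (hF : has_center A)
    (hA : almost_locally_simple_artinian A)
    (hF4 : exists s : seq F, uniq s /\ size s = 4%N)
    (hG : subnormal_in_units G)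
    (hGab : ~ abelian_set G)
    (hstar : involution star)
    (hstar1 : first_kind star) :
  let C1 := forall x, star x * x = x * star x in
  let C2 := forall x, exists N : nat,
      (0 < N)%N /\ iter N (inner_der x) (star x) = 0 in
  let C3 := forall x, exists N : nat,
      (0 < N)%N /\ star x * x ^+ N = x ^+ N * star x in
  let C4 := forall x, central (x + star x) in
  let C5 := forall x, central (x * star x) in
  let P1 := forall x, x \in G -> central (x + star x) in
  let P2 := forall x, x \in G -> central (x * star x) in
  [<-> C1; C2; C3; C4; C5; P1; P2] /\
  (C1 \/ C2 \/ C3 \/ C4 \/ C5 \/ P1 \/ P2 ->
     (quaternion_division_algebra A /\
      symplectic star /\
      (forall tau : A -> A, involution tau -> symplectic tau -> tau =1 star))
  \/ (exists f : {lrmorphism A -> 'M[F]_2},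
        bijective f /\
        forall x, f (star x) = ordinary_symplectic (f x))).
Proof.
move=> C1 C2 C3 C4 C5 P1 P2.
have [p [q [Gp Gq npq]]] : exists p q, [/\ p \in G, q \in G & ~ GRing.comm p q].
  apply: contrapT => h; apply: hGab => p q Gp Gq; apply: contrapT => npq.
  by apply: h; exists p, q.
have [n [H [H0 Hn HS]]] := hG.
have chain := subnormal_in_units_chain H0 HS.
have down j : (j <= n)%N -> p \in H (n - j)%N.
  elim: j => [|j IH] le; first by rewrite subn0 Hn.
  have lt : (n - j.+1 < n)%N by rewrite ltn_subrL (leq_ltn_trans _ le).
  have [+ _ _] := HS _ lt; apply.
  by rewrite subnSK //; apply: IH; apply: ltnW.
have noncentral_mem i : (i <= n)%N -> exists2 a, a \in H i & ~ central a.
  move=> le; exists p; last by move/(_ q).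
  by rewrite -(subKn le); apply: down; rewrite leq_subr.
have c41 : C4 -> C1 by move=> h x; apply: symplectic_comm.
have c45 : C4 -> C5 by apply: symplectic_norm_central.
have idem_C4 : C4 -> forall e : A, e * e = e -> star e * e = e * star e.
  by move=> h e _; apply: c41.
have c14 : C1 -> C4.
  by move=> h; apply: (symplectic_of_normal hA hstar) => [e _|_ x]; apply: h.
have c24 : C2 -> C4.
  move=> h; apply: (symplectic_of_normal hA hstar) => [e ee|hD].
    by have [N [_ hN]] := h e; apply: derivation_idem ee hN.
  by apply: (engel_division_normal hD hstar) => x; have [N [_ hN]] := h x; exists N.
have c34 : C3 -> C4.
  move=> h; apply: (symplectic_of_normal hA hstar) => [e ee|hD].
    have [[|N] [// _ hN]] := h e; have eX k : e ^+ k.+1 = e.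
      by elim: k => // k IH; rewrite exprS IH.
    by rewrite eX in hN.
  exact: (power_division_normal hD hstar hstar1 (three_scalars hF hF4)).
have p24 : P2 -> C4.
  move=> h; apply: (symplectic_of_norm hF hA hF4 hstar hstar1).
  suff hj j : (j <= n)%N -> forall x, x \in H (n - j)%N -> central (x * star x).
    by move=> x ux; apply: (hj n) => //; rewrite subnn H0.
  elim: j => [|j IH] le; first by move=> x; rewrite subn0 Hn; apply: h.
  have lt : (n - j.+1 < n)%N by rewrite ltn_subrL (leq_ltn_trans _ le).
  have le' := ltnW lt; have gH := subnormal_usg (unit_elements_usg A) (chain _ le').
  have nN := normal_subgroup_in (usgU gH) (HS _ lt).
  apply: (norm_central_step hF hA hF4 hstar (chain _ lt) (noncentral_mem _ lt) gH nN).
  by rewrite subnSK //; apply: IH; apply: ltnW.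
have c54 : C5 -> C4 by apply: norm_central_symplectic.
have p12 : P1 -> P2.
  move=> h x Gx; apply: (trace_norm_central hF hA hF4 hstar hstar1 (chain _ (leqnn n)) (noncentral_mem _ (leqnn n))).
    by move=> y; rewrite Hn; apply: h.
  by rewrite Hn.
have c12 : C1 -> C2.
  by move=> h x; exists 1%N; split=> //; rewrite /= /inner_der h subrr.
have c13 : C1 -> C3 by move=> h x; exists 1%N; split=> //; rewrite expr1; apply: h.
split.
  tfae.
  - exact: c12.
  - by move/c24/c41/c13.
  - exact: c34.
  - exact: c45.
  - by move/c54 => h x _; apply: h.
  - exact: p12.
  - by move/p24/c41.
move=> hC; have h4 : C4.
  by case: hC => [/c14|[/c24|[/c34|[//|[/c54|[/p12/p24|/p24]]]]]].
have [hD|he] := division_or_idempotent hA; [left|right].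
  split; first exact: quaternion_structure hF hD hstar hstar1 h4 npq.
  by split=> // tau ht hs; apply: (symplectic_unique hD npq hstar hstar1 h4 ht hs).
exact: (split_structure hF hA hstar hstar1 (idem_C4 h4) he).
Qed.
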